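(* Let $\chi$ be a fixed Dirichlet character modulo $q$, and put $$L_N(s,\chi)=\sum_{n\le N}\chi(n)n^{-s}.$$ Let $J_{N,\chi}$ be its Jessen function and $M_{N,\chi}=\max\{n\le N:(n,q)=1\}$. Then, as $N\to\infty$, $$\frac{J_{N,\chi}(\sigma)}{\log N}\longrightarrow\left(\frac12-\sigma\right)_+$$ locally uniformly for $\sigma\in\mathbb R$, and $$\frac1{\log M_{N,\chi}}J_{N,\chi}''\longrightarrow\delta_{1/2}$$ weakly as probability measures on $\mathbb R$.
   Context: $x_+=\max\{x,0\}$, $(n,q)$ is the greatest common divisor, and $\delta_{1/2}$ is the Dirac mass at $1/2$. The Jessen function of a finite Dirichlet sum $P(s)=\sum_{n\le N}a_nn^{-s}$ with $a_1\ne0$ is $$J_P(\sigma)=\lim_{T\to\infty}\frac1{2T}\int_{-T}^{T}\log|P(\sigma+it)|\,dt\qquad(\sigma\in\mathbb R);$$ the limit exists and $J_P$ is finite and convex on $\mathbb R$. $J_P''$ denotes its distributional second derivative, a positive Radon measure on $\mathbb R$ (the Lebesgue--Stieltjes measure of the increasing right derivative of $J_P$). Its total mass is $\log M$, where $M=\max\{n\le N:a_n\ne0\}$. Weak convergence means convergence of integrals of all bounded continuous functions. *)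

(* Defs.v *)
From HB Require Import structures.
From mathcomp Require Import all_boot all_order all_algebra.
From mathcomp Require Import all_classical all_reals all_analysis.
From mathcomp Require Import complex.
Set Implicit Arguments.
Unset Strict Implicit.
Unset Printing Implicit Defensive.
Import Order.TTheory GRing.Theory Num.Theory.
Import numFieldNormedType.Exports.
Local Open Scope classical_set_scope.
Local Open Scope complex_scope.
Local Open Scope ring_scope.

Section DirichletSums.
Context {R : realType}.

Definition expC (z : R[i]) : R[i] :=
  let: x +i* y := z in (expR x * cos y) +i* (expR x * sin y).

Definition natpowC (n : nat) (s : R[i]) : R[i] := expC (s * (ln n%:R)%:C).

Definition dirichlet_sum (a : nat -> R[i]) (N : nat) (s : R[i]) : R[i] :=
  \sum_(1 <= n < N.+1) a n * natpowC n (- s).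

Definition dirichlet_character (q : nat) (chi : nat -> R[i]) : Prop :=
  [/\ chi 1%N = 1,
      forall m n, chi (m * n)%N = chi m * chi n,
      forall m n, m = n %[mod q] -> chi m = chi n &
      forall n, (chi n != 0) = coprime n q].

(* The integrand is Lebesgue integrable when P is a nonzero Dirichlet sum; the
   convention [ln 0 = 0] only affects the isolated zeros of P on the line. *)
Definition jessen (P : R[i] -> R[i]) (sigma : R) : R :=
  lim ((2 * T)^-1 *
       (\int[lebesgue_measure]_(t in `[- T, T])
          ln (Normc.normc (P (sigma +i* t))))
    @[T --> +oo]).

End DirichletSums.

Section SecondDerivative.
Context {R : realType}.

Definition right_derivative (f : R -> R) (x : R) : R :=
  lim ((f (x + h) - f x) / h @[h --> 0^'+]).

(* A cumulative function is nondecreasing and right-continuous; the right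
   derivative of a finite convex function on R always is, so the default value
   is never taken for such functions. *)
Definition cumulative_or0 (F : R -> R) : R -> R :=
  if pselect (nondecreasing F /\ right_continuous F) then F else cst 0.

Lemma cumulative_or0_nondecreasing F : nondecreasing (cumulative_or0 F).
Proof.
rewrite /cumulative_or0; case: pselect => [[ndF rcF]|nF] /=; first exact: ndF.
by move=> x y _; exact: lexx.
Qed.

Lemma cumulative_or0_right_continuous F : right_continuous (cumulative_or0 F).
Proof.
rewrite /cumulative_or0; case: pselect => [[ndF rcF]|nF] /=; first exact: rcF.
by move=> x; exact: cvg_cst.
Qed.

HB.instance Definition _ F := isCumulative.Build R _ R (cumulative_or0 F)
  (@cumulative_or0_nondecreasing F) (@cumulative_or0_right_continuous F).

(* The distributional second derivative of a convex function [f]. *)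
Definition second_derivative_measure (f : R -> R) :
    {measure set (measurableTypeR R) -> \bar R} :=
  lebesgue_stieltjes_measure (cumulative_or0 (right_derivative f)).

Definition weak_cvg (mu : nat -> {measure set (measurableTypeR R) -> \bar R})
    (nu : {measure set (measurableTypeR R) -> \bar R}) : Prop :=
  forall f : R -> R, continuous f -> [bounded f x | x in [set: R]] ->
    (\int[mu N]_x (f x)%:E)%E @[N --> \oo] --> (\int[nu]_x (f x)%:E)%E.

Definition locally_uniform_cvg (f : nat -> R -> R) (g : R -> R) : Prop :=
  forall x : R, exists2 U : set R, nbhs x U & {uniform U, f @ \oo --> g}.

End SecondDerivative.

Section CharacterSums.
Context {R : realType}.

Definition max_coprime (q N : nat) : nat :=
  \max_(1 <= n < N.+1 | coprime n q) n.

Lemma inv_ln_nat_ge0 (n : nat) : 0 <= (ln n%:R)^-1 :> R.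
Proof.
rewrite invr_ge0; case: n => [|n]; first by rewrite ln0.
by rewrite ln_ge0// ler1n.
Qed.

Definition jessen_char (chi : nat -> R[i]) (N : nat) : R -> R :=
  jessen (dirichlet_sum chi N).

Definition jessen_char_measure (q : nat) (chi : nat -> R[i]) (N : nat) :
    {measure set (measurableTypeR R) -> \bar R} :=
  mscale (NngNum (inv_ln_nat_ge0 (max_coprime q N)))
    (second_derivative_measure (jessen_char chi N)).

End CharacterSums.

(* Main.v *)
(** The Jessen function of [P = L_N(., chi)] at [sigma] is half the mean of
    [ln |P(sigma + i t)|^2]. It exists because a trigonometric sum is rarely small,
    which reduces the mean of [ln |P|^2] to means of [ln (|P|^2 + d)]; these are
    limits of combinations of the moments of [|P|^2], and are therefore unchanged
    when the coefficients are multiplied by a completely multiplicative phase.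

    Jensen's inequality gives [2 J(sigma) <= ln (\sum n^(-2 sigma))], whence the upper
    bound [(1/2 - sigma)_+ ln N + O(ln ln N)]. For the lower bound at [sigma = 0], split
    the primes of [(N/2, N]] into [K] blocks of equal size. A completely
    multiplicative phase rotates them independently, and averaging over the
    rotations bounds [ln |P|^2] from below by [ln (\sum_j |A_j|^2) - O(K)], where the
    [A_j] are the block sums. The second moment shows that [\sum_j |A_j|^2] is close to
    the number of primes except on a set of density [O(1/K)], and by Chebyshev's
    bound this number is [N^(1 - o(1))]; hence [J(0) >= (1/2 - o(1)) ln N].

    [J] is convex, bounded below by [- ln 2], and has slopes in [[- ln M, 0]]. Convexity
    propagates the bound at [0] to every [sigma], locally uniformly. The slopes of [J]
    tend to [- ln M] and [0] at infinity, which gives the total mass; locally uniform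
    convergence to a function with a kink at [1/2] forces almost all of the slope to
    change near [1/2]. *)

Require Import Defs.
From mathcomp Require Import all_boot all_order all_algebra.
From mathcomp Require Import all_classical all_reals all_analysis.
From mathcomp Require Import measurable_realfun complex.
From mathcomp Require cyclic.
From mathcomp Require Import ring lra zify.
Set Implicit Arguments.
Unset Strict Implicit.
Unset Printing Implicit Defensive.
Import Order.TTheory GRing.Theory Num.Theory.
Import numFieldNormedType.Exports.
Local Open Scope classical_set_scope.
Local Open Scope complex_scope.
Local Open Scope ring_scope.

(** The obstacle is the singularity of the logarithm at the zeros of [P]: polynomials in [|P|^2]
    approximate [ln (|P|^2 + d)] uniformly, but not [ln |P|^2]. Phase invariance, convexity and the
    rotation of blocks are therefore proved for fixed [d > 0], in a form that survives [d -> 0], and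
    [d] is removed by the estimate of small values. Moments see only additive relations among the
    [ln n], that is, equalities of products of integers; this replaces equidistribution on a torus.
    In the same spirit rotations are averaged over finitely many roots of unity, and convexity comes
    from the subharmonicity of [ln (|F|^2 + d)], tested on four points.

    For the lower bound Jensen's inequality must be almost sharp. One long sum over primes may be
    far from its mean square, but the sum of [|A_j|^2] over [K] blocks has relative variance
    [O(1/K)], because quotients of two distinct primes are distinct. Since [K] is fixed while [N]
    grows, the cost [O(K)] is negligible against [ln N]. The abscissa [0] suffices: the limit
    function has the extreme slope [-1] up to [1/2], so the slope bound carries the estimate to the
    right and convexity to the left. *)

Local Notation normc := Normc.normc.
Local Notation Re := complex.Re.
Local Notation Im := complex.Im.

(** * Means over long intervals *)

Section Mean.
Context {R : realType}.
Local Notation mu := (@lebesgue_measure R).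
Implicit Types (f g : R -> R) (a b c l : R).

Lemma eq_ler a b : a = b -> a <= b. Proof. by move=> ->. Qed.

Definition linteg f : Prop :=
  forall a b, mu.-integrable `[a, b] (EFin \o f).

Lemma continuous_linteg f : continuous f -> linteg f.
Proof.
move=> cf a b; apply: continuous_compact_integrable.
  exact: segment_compact.
exact: continuous_subspaceT.
Qed.

Lemma lintegD f g : linteg f -> linteg g -> linteg (fun t => f t + g t).
Proof. by move=> hf hg a b; exact: integrableD (hf a b) (hg a b). Qed.

Lemma lintegZ c f : linteg f -> linteg (fun t => c * f t).
Proof. by move=> hf a b; exact: integrableZl (hf a b). Qed.

Lemma linteg_cst c : linteg (fun=> c).
Proof. by apply: continuous_linteg => x; exact: cvg_cst. Qed.

Lemma lintegB f g : linteg f -> linteg g -> linteg (fun t => f t - g t).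
Proof. by move=> hf hg a b; exact: integrableB (hf a b) (hg a b). Qed.

Definition itg f a b : R := \int[mu]_(t in `[a, b]) f t.

Lemma itg_split f a b c : linteg f -> a <= b -> b <= c ->
  itg f a c = itg f a b + itg f b c.
Proof.
move=> hf ab bc; apply/eqP; rewrite addrC -subr_eq; apply/eqP; rewrite /itg.
rewrite (Rintegral_itvB (hf a c)) ?bnd_simp//.
rewrite Rintegral_itv_obnd_cbnd//.
apply: (integrableS _ _ _ (hf b c)) => // t /=.
by rewrite !in_itv/= => /andP[/ltW -> ->].
Qed.

Lemma le_itg f g a b : linteg f -> linteg g ->
  (forall t, a <= t <= b -> f t <= g t) -> itg f a b <= itg g a b.
Proof.
move=> hf hg fg; apply: le_Rintegral => //.
Qed.

Lemma itg_ge0 f a b : (forall t, 0 <= f t) -> 0 <= itg f a b.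
Proof. by move=> h; apply: Rintegral_ge0. Qed.

Lemma itg_cst c a b : a <= b -> itg (fun=> c) a b = c * (b - a).
Proof.
move=> ab; rewrite /itg Rintegral_cst//= lebesgue_measure_itv/= lte_fin.
move: ab; rewrite le_eqVlt => /predU1P[->|->//].
by rewrite ltxx subrr.
Qed.

Lemma itgD f g a b : linteg f -> linteg g ->
  itg (fun t => f t + g t) a b = itg f a b + itg g a b.
Proof. by move=> hf hg; rewrite /itg RintegralD. Qed.

Lemma itgZ c f a b : linteg f -> itg (fun t => c * f t) a b = c * itg f a b.
Proof. by move=> hf; rewrite /itg RintegralZl//; exact: hf. Qed.

Definition avg f (T : R) : R := (2 * T)^-1 * itg f (- T) T.

Lemma avgD f g T : linteg f -> linteg g ->
  avg (fun t => f t + g t) T = avg f T + avg g T.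
Proof. by move=> hf hg; rewrite /avg itgD// mulrDr. Qed.

Lemma avgZ c f T : linteg f -> avg (fun t => c * f t) T = c * avg f T.
Proof. by move=> hf; rewrite /avg itgZ// mulrCA. Qed.

Lemma avgB f g T : linteg f -> linteg g ->
  avg (fun t => f t - g t) T = avg f T - avg g T.
Proof.
move=> hf hg; rewrite -[in RHS]mulN1r -avgZ// -avgD//; last exact: lintegZ.
by congr avg; apply/funext => t; rewrite mulN1r.
Qed.

Lemma avg_cst c T : 0 < T -> avg (fun=> c) T = c.
Proof.
move=> T0; rewrite /avg itg_cst; last by lra.
by field; rewrite gt_eqF.
Qed.

Lemma le_avg f g T : 0 <= T -> linteg f -> linteg g ->
  (forall t, f t <= g t) -> avg f T <= avg g T.
Proof.
move=> T0 hf hg fg; rewrite /avg ler_wpM2l ?invr_ge0 ?mulr_ge0//.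
by apply: le_itg.
Qed.

Lemma avg_dist_le f g c T : 0 < T -> linteg f -> linteg g ->
  (forall t, `|f t - g t| <= c) -> `|avg f T - avg g T| <= c.
Proof.
move=> T0 hf hg h; rewrite -avgB// ler_norml.
have hfg : linteg (fun t => f t - g t) by exact: lintegB.
apply/andP; split.
  rewrite -[leLHS](avg_cst _ T0); apply: le_avg => //; first exact: ltW.
    exact: linteg_cst.
  by move=> t; have := h t; rewrite ler_norml => /andP[].
rewrite -[leRHS](avg_cst _ T0); apply: le_avg => //; first exact: ltW.
  exact: linteg_cst.
by move=> t; have := h t; rewrite ler_norml => /andP[].
Qed.

(** Integrability is bundled with the limit because additivity and monotonicity of [avg] are derived
    from it. *)
Definition mean f l : Prop := linteg f /\ avg f T @[T --> +oo] --> l.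

Lemma mean_linteg f l : mean f l -> linteg f. Proof. by case. Qed.

Lemma meanD f g l l' : mean f l -> mean g l' ->
  mean (fun t => f t + g t) (l + l').
Proof.
move=> [hf fl] [hg gl]; split; first exact: lintegD.
under eq_fun do rewrite avgD//.
exact: cvgD.
Qed.

Lemma meanZ c f l : mean f l -> mean (fun t => c * f t) (c * l).
Proof.
move=> [hf fl]; split; first exact: lintegZ.
under eq_fun do rewrite avgZ//.
exact: cvgMr.
Qed.

Lemma mean_cst c : mean (fun=> c) c.
Proof.
split; first exact: linteg_cst.
apply: (@cvg_near_cst _ _ (c : R^o) _ (+oo)%R).
by near=> T; rewrite avg_cst.
Unshelve. all: by end_near. Qed.

Lemma meanB f g l l' : mean f l -> mean g l' ->
  mean (fun t => f t - g t) (l - l').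
Proof.
move=> hf hg; have := meanD hf (meanZ (-1) hg).
by rewrite mulN1r; under [X in mean X _ -> _]funext do rewrite mulN1r.
Qed.

Lemma mean_sum (I : Type) (s : seq I) (F : I -> R -> R) (L : I -> R) :
  (forall i, mean (F i) (L i)) ->
  mean (fun t => \sum_(i <- s) F i t) (\sum_(i <- s) L i).
Proof.
move=> hF; elim: s => [|i s IH].
  rewrite big_nil; under [X in mean X]funext do rewrite big_nil.
  exact: mean_cst.
rewrite big_cons; under [X in mean X]funext do rewrite big_cons.
exact: meanD.
Qed.

Lemma le_mean_near f g l l' : mean f l -> mean g l' ->
  (\forall T \near +oo, avg f T <= avg g T) -> l <= l'.
Proof.
move=> [hf fl] [hg gl] fg.
rewrite -(cvg_lim _ fl)// -(cvg_lim _ gl)//.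
by apply: ler_lim => //; [exact: cvgP fl|exact: cvgP gl].
Qed.

Lemma le_mean f g l l' : mean f l -> mean g l' ->
  (forall t, f t <= g t) -> l <= l'.
Proof.
move=> mf mg fg; apply: (le_mean_near mf mg).
have [hf _] := mf; have [hg _] := mg.
by near=> T; apply: le_avg.
Unshelve. all: by end_near. Qed.

Lemma mean_dist f g l l' e : mean f l -> mean g l' ->
  (forall T, 1 <= T -> `|avg f T - avg g T| <= e) -> `|l - l'| <= e.
Proof.
move=> mf mg fg; have [hf _] := mf; have [hg _] := mg.
have h (T : R) : 1 <= T -> avg g T - e <= avg f T <= avg g T + e.
  by move=> /fg; rewrite ler_distl.
have h1 : avg (fun t => g t - e) T @[T --> +oo] --> l' - e.
  by apply: (meanB mg (mean_cst e)).2.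
have h2 : avg (fun t => g t + e) T @[T --> +oo] --> l' + e.
  by apply: (meanD mg (mean_cst e)).2.
rewrite ler_distl; apply/andP; split.
  apply: le_mean_near (meanB mg (mean_cst e)) mf _.
  near=> T; rewrite avgB//; last exact: linteg_cst.
  by rewrite avg_cst//; have /h/andP[] : 1 <= T by [].
apply: le_mean_near mf (meanD mg (mean_cst e)) _.
near=> T; rewrite avgD//; last exact: linteg_cst.
by rewrite avg_cst//; have /h/andP[] : 1 <= T by [].
Unshelve. all: by end_near. Qed.

(** Closeness of the averages, uniform in [T], already makes the averages of [f] Cauchy. Pointwise
    closeness would be too much to ask: near a zero the logarithm is far from its regularisation. *)
Lemma mean_approx f : linteg f ->
  (forall e : R, 0 < e -> exists g, exists2 l, mean g l &
     forall T, 1 <= T -> `|avg f T - avg g T| <= e) ->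
  exists l, mean f l.
Proof.
move=> hf happ.
suff /cvg_ex[/= l fl] : cvg (avg f T @[T --> +oo]) by exists l.
apply/cauchy_cvgP/cauchy_exP => e e0.
have e20 : 0 < e / 2 by rewrite divr_gt0.
have [g [l [hg gl] fg]] := happ _ e20.
exists l; rewrite /fmap/=.
have /cvgrPdist_lt/(_ _ e20) H := gl.
near=> T; rewrite /= /ball/=.
rewrite (splitr e) -(subrK (avg g T) l) -addrA (le_lt_trans (ler_normD _ _))//.
apply: ltr_leD; first by near: T.
by rewrite distrC; apply: fg.
Unshelve. all: by end_near. Qed.

End Mean.

(** * Trigonometric sums *)

Section ComplexReal.
Context {R : realType}.
Implicit Types (x y z : R[i]) (a b t : R).

Definition nsq z : R := Re z ^+ 2 + Im z ^+ 2.

Definition cis t : R[i] := cos t +i* sin t.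

Lemma nsq_ge0 z : 0 <= nsq z. Proof. by rewrite addr_ge0// sqr_ge0. Qed.

Lemma nsqM x y : nsq (x * y) = nsq x * nsq y.
Proof. by case: x => a b; case: y => c d; rewrite /nsq; simpc => /=; ring. Qed.

Lemma nsq1 : nsq 1 = 1. Proof. by rewrite /nsq/=; ring. Qed.

Lemma nsq0 : nsq 0 = 0. Proof. by rewrite /nsq/=; ring. Qed.

Lemma nsqN z : nsq (- z) = nsq z.
Proof. by case: z => a b; rewrite /nsq/=; ring. Qed.

Lemma nsq_eq0 z : (nsq z == 0) = (z == 0).
Proof.
rewrite /nsq paddr_eq0 ?sqr_ge0// !sqrf_eq0; case: z => a b /=.
by rewrite eq_complex.
Qed.

Lemma nsq_real a : nsq a%:C = a ^+ 2. Proof. by rewrite /nsq/=; ring. Qed.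

Lemma nsqX z k : nsq (z ^+ k) = nsq z ^+ k.
Proof. by elim: k => [|k IH]; rewrite ?expr0 ?nsq1// !exprS nsqM IH. Qed.

Lemma normc_nsq z : normc z = Num.sqrt (nsq z).
Proof. by case: z. Qed.

Lemma nsq_normc z : nsq z = normc z ^+ 2.
Proof. by rewrite normc_nsq sqr_sqrtr// nsq_ge0. Qed.

Lemma normc_ge0 z : 0 <= normc z.
Proof. by rewrite normc_nsq sqrtr_ge0. Qed.

Lemma cisD a b : cis (a + b) = cis a * cis b.
Proof. by rewrite /cis cosD sinD; simpc; congr (_ +i* _); rewrite addrC. Qed.

Lemma cis0 : cis 0 = 1. Proof. by rewrite /cis cos0 sin0. Qed.

Lemma nsq_cis a : nsq (cis a) = 1. Proof. by rewrite /nsq/= cos2Dsin2. Qed.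

Lemma conjcM x y : (x * y)^*%C = x^*%C * y^*%C.
Proof. by rewrite rmorphM. Qed.

Lemma conj_cis a : (cis a)^*%C = cis (- a).
Proof. by rewrite /cis cosN sinN. Qed.

Lemma nsq_conj z : z * z^*%C = (nsq z)%:C.
Proof. by case: z => a b; simpc; rewrite /nsq/=; congr (_ +i* _); ring. Qed.

Lemma Re_sum (I : Type) (s : seq I) (P : pred I) (F : I -> R[i]) :
  Re (\sum_(i <- s | P i) F i) = \sum_(i <- s | P i) Re (F i).
Proof. by apply: (big_morph (@Re R)) => // -[a b] [c d]. Qed.

Lemma Im_sum (I : Type) (s : seq I) (P : pred I) (F : I -> R[i]) :
  Im (\sum_(i <- s | P i) F i) = \sum_(i <- s | P i) Im (F i).
Proof. by apply: (big_morph (@Im R)) => // -[a b] [c d]. Qed.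

Lemma nsq_sum (I : Type) (s : seq I) (F : I -> R[i]) :
  nsq (\sum_(i <- s) F i) =
  \sum_(i <- s) \sum_(j <- s) Re (F i * (F j)^*%C).
Proof.
have -> : nsq (\sum_(i <- s) F i) =
    Re ((\sum_(i <- s) F i) * (\sum_(i <- s) F i)^*%C).
  by rewrite nsq_conj.
rewrite mulr_suml Re_sum; apply: eq_bigr => i _.
rewrite (big_morph (@conjc R) (@rmorphD _ _ _) (@rmorph0 _ _ _)).
by rewrite mulr_sumr Re_sum.
Qed.

Definition tsum (I : Type) (s : seq I) (c : I -> R[i]) (lam : I -> R) (t : R) :
  R[i] := \sum_(i <- s) c i * cis (lam i * t).

End ComplexReal.

(** * Mean values of trigonometric functions *)

Section Calculus.
Context {R : realType}.
Implicit Types (f g F G : R -> R) (a b m : R).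

Lemma derive_continuous f g : (forall x : R, is_derive x 1 f (g x)) -> continuous f.
Proof.
move=> h x; apply: differentiable_continuous.
by apply/derivable1_diffP; have [] := h x.
Qed.

Lemma itg_derive F f a b : (forall x : R, is_derive x 1 F (f x)) -> continuous f ->
  a <= b -> itg f a b = F b - F a.
Proof.
move=> dF cf; rewrite le_eqVlt => /predU1P[->|ab].
  by rewrite subrr /itg set_itv1 Rintegral_set1.
rewrite /itg /Rintegral (@continuous_FTC2 _ _ F)//.
- exact: continuous_subspaceT.
- have cF : continuous F by exact: derive_continuous dF.
  split.
  + by move=> x _; have [] := dF x.
  + by apply: cvg_at_right_filter; exact: cF.
  + by apply: cvg_at_left_filter; exact: cF.
- by move=> x _; rewrite derive1E; exact: (@derive_val _ _ _ _ _ _ _ (dF x)).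
Qed.

(** A bounded primitive keeps the integral over [[-T, T]] below [2 B], and division by [2 T] sends
    it to zero. *)
Lemma mean_derive F f (B : R) : (forall x : R, is_derive x 1 F (f x)) -> continuous f ->
  (forall x, `|F x| <= B) -> mean f 0.
Proof.
move=> dF cf FB; split; first exact: continuous_linteg.
apply/cvgrPdist_le => /= e e0.
have B0 : 0 <= B by apply: le_trans (FB 0).
near=> T.
have T0 : 0 < T by [].
rewrite sub0r normrN /avg (itg_derive dF)//; last by lra.
rewrite normrM gtr0_norm ?invr_gt0 ?mulr_gt0//.
rewrite ler_pdivrMl ?mulr_gt0//.
have : `|F T - F (- T)| <= 2 * B.
  by rewrite (le_trans (ler_normB _ _))// mulr_natl mulr2n lerD.
move=> /le_trans; apply.
rewrite -mulrA ler_pM2l// -ler_pdivrMr//.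
Unshelve. all: by end_near. Qed.

Lemma is_derive_cosM m a b (x : R) :
  is_derive x 1 (fun t => a * cos (m * t) - b * sin (m * t))
    (- (a * m) * sin (m * x) - (b * m) * cos (m * x)).
Proof.
apply: is_derive_eq; rewrite /GRing.scale/=; ring.
Qed.

Lemma continuous_trig m a b : continuous (fun t : R => a * cos (m * t) - b * sin (m * t)).
Proof. exact: derive_continuous (is_derive_cosM m a b). Qed.

Lemma mean_trig m a b :
  mean (fun t => a * cos (m * t) - b * sin (m * t)) (if m == 0 then a else 0).
Proof.
case: eqP => [->|/eqP m0].
  under [X in mean X]funext do rewrite mul0r cos0 sin0 mulr1 mulr0 subr0.
  exact: mean_cst.
apply: (@mean_derive (fun t => (b / m) * cos (m * t) - (- a / m) * sin (m * t))
  _ (`|b / m| + `|a / m|)).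
- move=> x; apply: (is_derive_eq (is_derive_cosM _ _ _ _)).
  by field.
- exact: continuous_trig.
- move=> x; rewrite (le_trans (ler_normB _ _))// !mulNr normrN normrM (normrM (a / m)).
  rewrite lerD// ler_piMr//.
    by rewrite ler_norml cos_geN1 cos_le1.
  by rewrite ler_norml sin_geN1 sin_le1.
Qed.

Lemma continuous_sum (I : Type) (s : seq I) (h : I -> R -> R) :
  (forall i, continuous (h i)) -> continuous (fun t : R => \sum_(i <- s) h i t).
Proof.
move=> ch x; elim: s => [|i s IH].
  rewrite /continuous_at big_nil; under eq_fun do rewrite big_nil.
  exact: cvg_cst.
rewrite /continuous_at big_cons; under eq_fun do rewrite big_cons.
by apply: cvgD; [exact: ch|exact: IH].
Qed.

End Calculus.

Section TrigSums.
Context {R : realType}.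
Variables (I : Type) (s : seq I).
Implicit Types (c : I -> R[i]) (lam : I -> R) (t : R).

Lemma Re_tsum c lam t : Re (tsum s c lam t) =
  \sum_(i <- s) (Re (c i) * cos (lam i * t) - Im (c i) * sin (lam i * t)).
Proof. by rewrite Re_sum; apply: eq_bigr => i _; case: (c i) => a b; simpc. Qed.

Lemma Im_tsum c lam t : Im (tsum s c lam t) =
  \sum_(i <- s) (Im (c i) * cos (lam i * t) - - Re (c i) * sin (lam i * t)).
Proof.
rewrite Im_sum; apply: eq_bigr => i _; case: (c i) => a b; simpc => /=; ring.
Qed.

Lemma continuous_Re_tsum c lam : continuous (fun t : R => Re (tsum s c lam t)).
Proof.
under [X in continuous X]funext do rewrite Re_tsum.
by apply: continuous_sum => i; exact: continuous_trig.
Qed.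

Lemma continuous_Im_tsum c lam : continuous (fun t : R => Im (tsum s c lam t)).
Proof.
under [X in continuous X]funext do rewrite Im_tsum.
by apply: continuous_sum => i; exact: continuous_trig.
Qed.

Lemma continuous_nsq_tsum c lam : continuous (fun t : R => nsq (tsum s c lam t)).
Proof.
move=> t; apply: cvgD; rewrite expr2; apply: cvgM;
  by [exact: continuous_Re_tsum | exact: continuous_Im_tsum].
Qed.

(** Expanding the square gives the frequencies [lam i - lam j], and only the vanishing ones have a
    nonzero mean. Equal frequencies are allowed, since powers of a sum produce them. *)
Lemma mean_nsq_tsum c lam : mean (fun t => nsq (tsum s c lam t))
  (\sum_(i <- s) \sum_(j <- s)
     if lam i == lam j then Re (c i * (c j)^*%C) else 0).
Proof.
under [X in mean X]funext do rewrite nsq_sum.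
apply: mean_sum => i; apply: mean_sum => j.
have -> : (fun t => Re (c i * cis (lam i * t) * (c j * cis (lam j * t))^*%C)) =
  fun t => Re (c i * (c j)^*%C) * cos ((lam i - lam j) * t) -
           Im (c i * (c j)^*%C) * sin ((lam i - lam j) * t).
  apply/funext => t.
  have -> : c i * cis (lam i * t) * (c j * cis (lam j * t))^*%C =
            c i * (c j)^*%C * cis ((lam i - lam j) * t).
    by rewrite conjcM conj_cis mulrBl cisD mulrACA.
  by case: (c i * _) => a b; simpc.
by rewrite -subr_eq0; exact: mean_trig.
Qed.

End TrigSums.

(** * Phase invariance of the moments *)

Section Moments.
Context {R : realType}.
Implicit Types (c psi : nat -> R[i]) (t : R).

Lemma cis_sum (J : Type) (s : seq J) (F : J -> R) :
  cis (\sum_(j <- s) F j) = \prod_(j <- s) cis (F j).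
Proof. by apply: (big_morph (@cis R)) => [x y|]; [exact: cisD|exact: cis0]. Qed.

Lemma nsq_prod (J : Type) (s : seq J) (F : J -> R[i]) :
  nsq (\prod_(j <- s) F j) = \prod_(j <- s) nsq (F j).
Proof. by apply: (big_morph (@nsq R)) => [x y|]; [exact: nsqM|exact: nsq1]. Qed.

Variable I : finType.

(** A power of a trigonometric sum is a trigonometric sum over tuples of indices, so that every
    moment of the squared modulus is a second moment. *)
Lemma tsum_expn (c : I -> R[i]) (lam : I -> R) k t :
  tsum (index_enum I) c lam t ^+ k =
  tsum (index_enum {ffun 'I_k -> I}) (fun f => \prod_(j < k) c (f j))
    (fun f => \sum_(j < k) lam (f j)) t.
Proof.
rewrite /tsum -[X in _ ^+ X](card_ord k) -prodr_const bigA_distr_bigA/=.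
apply: eq_bigr => f _; rewrite big_split/=; congr (_ * _).
by rewrite mulr_suml cis_sum.
Qed.

Definition moment (c : I -> R[i]) (lam : I -> R) k : R :=
  \sum_(f : {ffun 'I_k -> I}) \sum_(g : {ffun 'I_k -> I})
    if \sum_(j < k) lam (f j) == \sum_(j < k) lam (g j)
    then Re ((\prod_(j < k) c (f j)) * (\prod_(j < k) c (g j))^*%C) else 0.

Lemma mean_moment (c : I -> R[i]) (lam : I -> R) k :
  mean (fun t => nsq (tsum (index_enum I) c lam t) ^+ k) (moment c lam k).
Proof.
under [X in mean X]funext do rewrite -nsqX tsum_expn.
exact: mean_nsq_tsum.
Qed.

(* A phase factor [psi] that depends on the frequency only through additive
   relations does not change any moment. *)
Definition compatible_phase (psi : I -> R[i]) (lam : I -> R) : Prop :=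
  (forall i, nsq (psi i) = 1) /\
  forall k (f g : {ffun 'I_k -> I}),
    \sum_(j < k) lam (f j) = \sum_(j < k) lam (g j) ->
    \prod_(j < k) psi (f j) = \prod_(j < k) psi (g j).

(** A pair [(f, g)] contributes only if its frequency sums agree; then the phases of [f] and [g]
    coincide, and one cancels the conjugate of the other. *)
Lemma moment_phase (c psi : I -> R[i]) (lam : I -> R) k :
  compatible_phase psi lam ->
  moment (fun i => c i * psi i) lam k = moment c lam k.
Proof.
move=> [psi1 psi2]; apply: eq_bigr => f _; apply: eq_bigr => g _.
case: eqP => // /psi2 fg; congr Re.
rewrite !big_split/= conjcM mulrACA -fg nsq_conj nsq_prod.
by rewrite (eq_bigr (fun=> 1)) ?big1_eq ?mulr1// => j _; exact: psi1.
Qed.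

End Moments.

(** * The regularised logarithm as a limit of polynomials *)

Section LogMean.
Context {R : realType}.
Implicit Types (X Y : R -> R) (e t : R).

Lemma is_derive_ln_partial n (y : R) : y < 1 ->
  is_derive y 1 (fun u => ln (1 - u) + \sum_(k < n) u ^+ k.+1 / k.+1%:R)
    (- (y ^+ n / (1 - y))).
Proof.
move=> y1; elim: n => [|n IH].
  under [X in is_derive _ _ X]funext do rewrite big_ord0 addr0.
  have y10 : 0 < 1 - y by rewrite subr_gt0.
  have h1 := is_derive1_ln y10.
  have h2 : is_derive y 1 (fun u : R => 1 - u) (-1).
    apply: is_derive_eq.
    by rewrite add0r mul1r.
  have := @is_derive1_comp _ (@ln R) (fun u : R => 1 - u) y _ _ h1 h2.
  by move=> h; apply: (is_derive_eq h); rewrite expr0; ring.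
under [X in is_derive _ _ X]funext do rewrite big_ord_recr/= addrA.
have h : is_derive y 1 (fun u : R => u ^+ n.+1 / n.+1%:R) (y ^+ n).
  under [X in is_derive _ _ X]funext do rewrite mulrC.
  have h : is_derive y 1 (fun u : R => u ^+ n.+1) (n.+1%:R * y ^+ n).
    have := @is_derive_poly R ('X^(n.+1)) y; rewrite derivXn hornerMn hornerXn mulr_natl.
    by under [X in is_derive _ _ X]funext do rewrite hornerXn.
  apply: (is_derive_eq (is_deriveZ n.+1%:R^-1 h)).
  by rewrite /GRing.scale/= mulKf.
apply: (is_derive_eq (is_deriveD IH h)).
by rewrite exprS; field; rewrite subr_eq0 gt_eqF.
Qed.

Lemma ln_partial_le n (r y : R) : 0 <= y <= r -> r < 1 ->
  `|ln (1 - y) + \sum_(k < n) y ^+ k.+1 / k.+1%:R| <= r ^+ n / (1 - r).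
Proof.
move=> /andP[y0 yr] r1.
have r0 : 0 <= r by apply: le_trans yr.
have y1 : y < 1 by apply: le_lt_trans r1.
pose g (u : R) := ln (1 - u) + \sum_(k < n) u ^+ k.+1 / k.+1%:R.
have dg (u : R) : u <= y -> is_derive u 1 g (- (u ^+ n / (1 - u))).
  by move=> uy; apply: is_derive_ln_partial; apply: le_lt_trans y1.
have g0 : g 0 = 0.
  by rewrite /g subr0 ln1 add0r big1// => k _; rewrite expr0n/= mul0r.
have [||c] := @MVT_segment _ g (fun u => - (u ^+ n / (1 - u))) 0 y y0.
- by move=> u; rewrite in_itv/= => /andP[_ /ltW]; exact: dg.
- apply: continuous_in_subspaceT => u; rewrite inE/= in_itv/= => /andP[_ uy].
  apply: differentiable_continuous; apply/derivable1_diffP.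
  by have [] := dg _ uy.
rewrite in_itv/= => /andP[c0 cy]; rewrite g0 !subr0 -/(g y) => ->.
have cr : c <= r by apply: le_trans yr.
have c1 : 0 < 1 - c by rewrite subr_gt0 (le_lt_trans cr).
have r1' : 0 < 1 - r by rewrite subr_gt0.
have h0 : 0 <= c ^+ n / (1 - c) by rewrite divr_ge0 ?exprn_ge0// ltW.
rewrite mulNr normrN ger0_norm; last exact: mulr_ge0.
apply: (@le_trans _ _ (c ^+ n / (1 - c))); first by rewrite ler_piMr// ltW.
apply: ler_pM; first exact: exprn_ge0.
- by rewrite invr_ge0 ltW.
- by rewrite lerXn2r ?nnegrE.
- by rewrite lef_pV2 ?posrE// lerB.
Qed.

(** The expansion is made at the right end [B]: [x + e] is [B + e] times [1 - y], where
    [y = (B - x) / (B + e)] stays in [[0, r]] with [r = B / (B + e) < 1], so the logarithmic series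
    converges uniformly on the whole interval. *)
Lemma ln_poly_approx (B e d : R) : 0 <= B -> 0 < e -> 0 < d ->
  exists p : {poly R}, forall x, 0 <= x <= B -> `|ln (x + e) - p.[x]| <= d.
Proof.
move=> B0 e0 d0.
have Be : 0 < B + e by rewrite ltr_wpDl.
pose r := B / (B + e).
have r1 : r < 1 by rewrite ltr_pdivrMr// mul1r ltrDl.
have r0 : 0 <= r by rewrite divr_ge0// ltW.
have [n rn] : exists n, r ^+ n / (1 - r) <= d.
  have : (fun n => r ^+ n / (1 - r)) @ \oo --> 0 / (1 - r).
    by apply: cvgMl; apply: cvg_expr; rewrite ger0_norm.
  rewrite mul0r => /cvgrPdist_le/(_ _ d0)[n _ /(_ n (leqnn n))].
  rewrite sub0r normrN => h; exists n; apply: le_trans h; exact: ler_norm.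
exists ((ln (B + e))%:P - \sum_(k < n)
  ((B + e)^-1 *: (B%:P - 'X)) ^+ k.+1 * (k.+1%:R^-1)%:P).
move=> x /andP[x0 xB]; rewrite !hornerE horner_sum.
pose y := (B - x) / (B + e).
have yr : 0 <= y <= r.
  by rewrite divr_ge0 ?subr_ge0 ?(ltW Be)//= ler_pM2r ?invr_gt0// gerBl.
have -> : ln (x + e) = ln (B + e) + ln (1 - y).
  rewrite -lnM ?posrE//; last by rewrite subr_gt0; case/andP: yr => _ /le_lt_trans; exact.
  by congr ln; rewrite /y; field; rewrite gt_eqF.
apply: le_trans rn.
rewrite opprD opprK addrACA subrr add0r.
under eq_bigr do rewrite !hornerE /= [X in X ^+ _]mulrC -/y.
exact: ln_partial_le.
Qed.

Lemma continuous_lnD X e : (forall t, 0 <= X t) -> 0 < e -> continuous X ->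
  continuous (fun t : R => ln (X t + e)).
Proof.
move=> X0 e0 cX t; apply: (@continuous_comp _ _ _ (fun t => X t + e) (@ln R)).
  by apply: cvgD; [exact: cX|exact: cvg_cst].
by apply: continuous_ln; rewrite ltr_wpDl.
Qed.

Lemma mean_horner X (M : nat -> R) (p : {poly R}) :
  (forall k, mean (fun t => X t ^+ k) (M k)) ->
  mean (fun t => p.[X t]) (\sum_(i < size p) p`_i * M i).
Proof.
move=> hM; under [X in mean X]funext do rewrite horner_coef.
by apply: mean_sum => i; exact: meanZ.
Qed.

(** The mean of a polynomial in [X] depends only on the moments, and one polynomial close to
    [ln (x + e)] on [[0, B]] serves both [X] and [Y]. The common [l] expresses equality of the two
    means. *)
Lemma mean_ln_moments X Y (M : nat -> R) (B e : R) : 0 < e ->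
  (forall t, 0 <= X t <= B) -> (forall t, 0 <= Y t <= B) ->
  continuous X -> continuous Y ->
  (forall k, mean (fun t => X t ^+ k) (M k)) ->
  (forall k, mean (fun t => Y t ^+ k) (M k)) ->
  exists l, mean (fun t => ln (X t + e)) l /\ mean (fun t => ln (Y t + e)) l.
Proof.
move=> e0 XB YB cX cY MX MY.
have B0 : 0 <= B by have /andP[] := XB 0; exact: le_trans.
have cvge (Z : R -> R) : (forall t, 0 <= Z t <= B) -> continuous Z ->
    linteg (fun t => ln (Z t + e)).
  move=> ZB cZ; apply/continuous_linteg/continuous_lnD => // t.
  by case/andP: (ZB t).
have app (Z : R -> R) d (p : {poly R}) : (forall t, 0 <= Z t <= B) ->
    continuous Z -> (forall k, mean (fun t => Z t ^+ k) (M k)) ->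
    (forall x, 0 <= x <= B -> `|ln (x + e) - p.[x]| <= d) ->
    forall T, 1 <= T ->
    `|avg (fun t => ln (Z t + e)) T - avg (fun t => p.[Z t]) T| <= d.
  move=> ZB cZ MZ hp T T1; apply: avg_dist_le.
  - exact: lt_le_trans T1.
  - exact: cvge.
  - exact: (mean_linteg (mean_horner p MZ)).
  - by move=> t; exact: hp.
have ex (Z : R -> R) : (forall t, 0 <= Z t <= B) -> continuous Z ->
    (forall k, mean (fun t => Z t ^+ k) (M k)) ->
    exists l, mean (fun t => ln (Z t + e)) l.
  move=> ZB cZ MZ; apply: mean_approx => [|d d0]; first exact: cvge.
  have [p hp] := ln_poly_approx B0 e0 d0.
  exists (fun t => p.[Z t]); eexists; first exact: mean_horner MZ.
  exact: app.
have [l Xl] := ex X XB cX MX; have [l' Yl] := ex Y YB cY MY.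
exists l; split => //; suff -> : l = l' by [].
apply/eqP; rewrite -subr_eq0 -normr_le0; apply/ler_addgt0Pl => d d0.
rewrite addr0.
have d20 : 0 < d / 2 by rewrite divr_gt0.
have [p hp] := ln_poly_approx B0 e0 d20.
have h1 := mean_dist Xl (mean_horner p MX) (app _ _ _ XB cX MX hp).
have h2 := mean_dist Yl (mean_horner p MY) (app _ _ _ YB cY MY hp).
rewrite (splitr d) (le_trans (ler_distD (\sum_(i < size p) p`_i * M i) _ _))//.
by rewrite lerD// distrC.
Qed.

End LogMean.

(** * Small values of trigonometric sums *)

Section SmallValues.
Context {R : realType}.
Implicit Types (t a b d eta l : R) (z w : R[i]).

Lemma Re_le_normc z : `|Re z| <= normc z.
Proof.
rewrite normc_nsq -sqrtr_sqr ler_sqrt ?nsq_ge0//.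
by rewrite /nsq lerDl sqr_ge0.
Qed.

Lemma normc_unit z : exists w, nsq w = 1 /\ w * z = (normc z)%:C.
Proof.
have [->|z0] := eqVneq z 0.
  by exists 1; rewrite nsq1 mul1r Normc.normc0.
have n0 : normc z != 0.
  by apply: contra z0 => /eqP/Normc.eq0_normc ->.
exists (z^*%C * ((normc z)^-1)%:C); split.
  rewrite nsqM nsq_real.
  have -> : nsq z^*%C = nsq z by case: (z) => x y; rewrite /nsq/= sqrrN.
  by rewrite nsq_normc exprVn divff// expf_neq0.
rewrite mulrAC [_ * z]mulrC nsq_conj nsq_normc -rmorphM/= expr2.
by rewrite mulfK.
Qed.

Lemma is_derive_Re_tsum (I : Type) (s : seq I) (c : I -> R[i]) (lam : I -> R) t :
  is_derive t 1 (fun t => Re (tsum s c lam t))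
    (Re (tsum s (fun i => c i * (0 +i* lam i)) lam t)).
Proof.
elim: s => [|i s IH].
  rewrite /tsum big_nil; under [X in is_derive _ _ X]funext do rewrite big_nil.
  exact: is_derive_cst.
rewrite Re_tsum big_cons -Re_tsum.
under [X in is_derive _ _ X]funext do rewrite Re_tsum big_cons -Re_tsum.
apply: (is_derive_eq (is_deriveD (is_derive_cosM _ _ _ _) IH)).
by congr (_ + _); case: (c i) => x y; simpc => /=; ring.
Qed.

Lemma tsum_mull (I : Type) (s : seq I) (c : I -> R[i]) (lam : I -> R) w t :
  w * tsum s c lam t = tsum s (fun i => w * c i) lam t.
Proof. by rewrite /tsum mulr_sumr; apply: eq_bigr => i _; rewrite mulrA. Qed.

Lemma normc_cis t : normc (cis t) = 1.
Proof. by rewrite normc_nsq nsq_cis sqrtr1. Qed.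

Lemma normc_sum (I : Type) (s : seq I) (F : I -> R[i]) :
  normc (\sum_(i <- s) F i) <= \sum_(i <- s) normc (F i).
Proof.
elim: s => [|i s IH]; first by rewrite !big_nil Normc.normc0.
by rewrite !big_cons (le_trans (le_normcD _ _))// lerD2l.
Qed.

Lemma tsum_bound (I : Type) (s : seq I) (c : I -> R[i]) (lam : I -> R) t :
  normc (tsum s c lam t) <= \sum_(i <- s) normc (c i).
Proof.
rewrite (le_trans (normc_sum _ _))//; apply: ler_sum => i _.
by rewrite Normc.normcM normc_cis mulr1.
Qed.

(** A bound for the derivative: the coefficients are those of the sum differentiated term by
    term. *)
Definition lip_tsum (I : Type) (s : seq I) (c : I -> R[i]) (lam : I -> R) : R :=
  \sum_(i <- s) normc (c i * (0 +i* lam i)).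

Lemma Re_tsum_lip (I : Type) (s : seq I) (c : I -> R[i]) (lam : I -> R) w a t :
  nsq w = 1 -> a <= t ->
  `|Re (w * tsum s c lam t) - Re (w * tsum s c lam a)| <=
  lip_tsum s c lam * (t - a).
Proof.
move=> w1 at_; rewrite !tsum_mull.
have [u _ ->] := MVT_segment at_ (fun x _ => is_derive_Re_tsum s _ lam x)
  (continuous_subspaceT (@continuous_Re_tsum _ _ s (fun i => w * c i) lam)).
rewrite normrM [X in _ * X <= _]ger0_norm ?subr_ge0//.
rewrite ler_wpM2r ?subr_ge0// (le_trans (Re_le_normc _))//.
rewrite (le_trans (tsum_bound _ _ _ _))// ler_sum// => i _.
by rewrite -mulrA Normc.normcM normc_nsq w1 sqrtr1 mul1r.
Qed.

Lemma lip_tsum_ge0 (I : Type) (s : seq I) (c : I -> R[i]) (lam : I -> R) :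
  0 <= lip_tsum s c lam.
Proof. by apply: sumr_ge0 => i _; exact: normc_ge0. Qed.

(** A smooth substitute for the indicator of [x <= d^2], at least [1/2] there. This shape is chosen
    because it integrates to an arctangent along a monotone function and because it controls the
    increments of [ln (x + d^2)] in [d]. *)
Definition bump d (x : R) : R := d ^+ 2 / (d ^+ 2 + x).

Lemma bump_ge0 d x : 0 < d -> 0 <= x -> 0 <= bump d x.
Proof. by move=> d0 x0; rewrite divr_ge0 ?addr_ge0 ?sqr_ge0. Qed.

Lemma bump_le1 d x : 0 < d -> 0 <= x -> bump d x <= 1.
Proof.
by move=> d0 x0; rewrite ler_pdivrMr ?mul1r ?lerDl// ltr_pwDl// exprn_gt0.
Qed.

Lemma continuous_bump d (X : R -> R) : 0 < d -> (forall t, 0 <= X t) ->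
  continuous X -> continuous (fun t => bump d (X t)).
Proof.
move=> d0 X0 cX t; apply: cvgM; first exact: cvg_cst.
apply: cvgV; first by rewrite gt_eqF// ltr_pwDl// exprn_gt0.
by apply: cvgD; [exact: cvg_cst|exact: cX].
Qed.

(** A primitive of [f' / eta * bump d (f^2)] is [d / eta * atan (f / d)], whose total variation is
    at most [pi * d / eta < 4 * d / eta]; the factor [f' / eta >= 1] only increases the
    integrand. *)
Lemma itg_bump_monotone (f f' X : R -> R) d eta a b :
  0 < d -> 0 < eta -> a <= b ->
  (forall x : R, is_derive x 1 f (f' x)) -> continuous f' ->
  (forall t, f t ^+ 2 <= X t) -> continuous X ->
  (forall t, a <= t <= b -> eta <= f' t) ->
  itg (fun t => bump d (X t)) a b <= 4 * d / eta.
Proof.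
move=> d0 eta0 ab df cf' fX cX hf'.
have X0 t : 0 <= X t by apply: le_trans (fX t); rewrite sqr_ge0.
have cf : continuous f by exact: derive_continuous df.
pose G t : R := (d / eta) * atan (d^-1 * f t).
pose G' t : R := (f' t / eta) * bump d (f t ^+ 2).
have dG (x : R) : is_derive x 1 G (G' x).
  have h1 : is_derive x 1 (fun t => d^-1 * f t) (d^-1 * f' x) by exact: is_deriveZ.
  have h2 := @is_derive1_comp _ (@atan R) _ x _ _ (is_derive1_atan _) h1.
  apply: (is_derive_eq (is_deriveZ (d / eta) h2)).
  rewrite /GRing.scale/= /G' /bump.
  field; rewrite !gt_eqF//= ?exprn_gt0//.
  by rewrite ltr_pwDl ?sqr_ge0 ?exprn_gt0.
have cG' : continuous G'.
  move=> t; apply: cvgM; first by apply: cvgMl; exact: cf'.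
  apply: (@continuous_bump d (fun t => f t ^+ 2)) => // [u|u]; first exact: sqr_ge0.
  exact: (cvgM (cf u) (cf u)).
apply: (@le_trans _ _ (itg G' a b)).
  apply: le_itg => [||t tab]; first exact/continuous_linteg/continuous_bump.
    exact: continuous_linteg.
  have e1 : 1 <= f' t / eta by rewrite ler_pdivlMr// mul1r hf'.
  apply: (@le_trans _ _ (bump d (f t ^+ 2))).
    rewrite /bump ler_wpM2l ?sqr_ge0// lef_pV2 ?posrE ?ltr_pwDl ?sqr_ge0 ?exprn_gt0//.
    by rewrite lerD2l.
  by rewrite ler_peMl// bump_ge0// sqr_ge0.
rewrite (itg_derive dG)// /G -mulrBr -[leRHS]mulrA [leRHS]mulrC ler_pM2l ?divr_gt0//.
have := @pihalf_lt2 R; have := atan_ltpi2 (d^-1 * f b); have := atan_gtNpi2 (d^-1 * f a).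
lra.
Qed.

Lemma continuous_bump_tsum (I : Type) (s : seq I) (c : I -> R[i]) (lam : I -> R) d :
  0 < d -> continuous (fun t => bump d (nsq (tsum s c lam t))).
Proof.
move=> d0; apply: continuous_bump => // [t|]; first exact: nsq_ge0.
exact: continuous_nsq_tsum.
Qed.

(** The derivative [h] changes by at most [eta] in the window, so its value at the left end decides.
    If [|h a| <= 2 eta], then [|h| <= 3 eta] throughout and [2 * bump (3 eta)] is at least [1].
    Otherwise the rotation that makes [h a] positive gives a real part whose derivative is at least
    [eta] throughout. *)
Lemma itg_bump_window (I : Type) (s : seq I) (c : I -> R[i]) (lam : I -> R)
    (h := tsum s (fun i => c i * (0 +i* lam i)) lam) d eta l a :
  0 < d -> 0 < eta -> 0 <= l ->
  lip_tsum s (fun i => c i * (0 +i* lam i)) lam * l <= eta ->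
  itg (fun t => bump d (nsq (tsum s c lam t))) a (a + l) <=
  4 * d / eta + 2 * itg (fun t => bump (3 * eta) (nsq (h t))) a (a + l).
Proof.
move=> d0 eta0 l0 Ll.
have eta30 : 0 < 3 * eta by rewrite mulr_gt0.
have al : a <= a + l by rewrite lerDl.
have cb e : 0 < e -> linteg (fun t => bump e (nsq (h t))).
  by move=> e0; apply/continuous_linteg/continuous_bump_tsum.
have hlip w t : nsq w = 1 -> a <= t <= a + l ->
    `|Re (w * h t) - Re (w * h a)| <= eta.
  move=> w1 /andP[at_ tl]; rewrite (le_trans (Re_tsum_lip _ _ _ w1 at_))//.
  by apply: le_trans Ll; rewrite ler_wpM2l ?lip_tsum_ge0// lerBlDl.
have [small|big] := leP (normc (h a)) (2 * eta).
  apply: (@le_trans _ _ (itg (fun t => 2 * bump (3 * eta) (nsq (h t))) a (a + l))).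
    apply: le_itg => [||t tal].
    - exact/continuous_linteg/continuous_bump_tsum.
    - exact/lintegZ/cb.
    apply: (le_trans (bump_le1 d0 (nsq_ge0 _))).
    have [w [w1 wh]] := normc_unit (h t).
    have := hlip w t w1 tal; rewrite wh/= => ht.
    have hn : normc (h t) <= 3 * eta.
      have := Re_le_normc (w * h a).
      rewrite Normc.normcM (normc_nsq w) w1 sqrtr1 mul1r.
      by move: ht; rewrite !ler_norml => /andP[_ ?] /andP[_ ?]; lra.
    have hn2 : nsq (h t) <= (3 * eta) ^+ 2.
      by rewrite nsq_normc lerXn2r ?nnegrE ?normc_ge0// ltW.
    rewrite /bump mulrA ler_pdivlMr ?mul1r; last first.
      by rewrite ltr_pwDl ?nsq_ge0 ?exprn_gt0.
    lra.
  by rewrite itgZ ?lerDr ?divr_ge0 ?mulr_ge0 ?(ltW d0) ?(ltW eta0)//; exact: cb.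
have [w [w1 wh]] := normc_unit (h a).
apply: (@le_trans _ _ (4 * d / eta)); last first.
  rewrite lerDl mulr_ge0// itg_ge0// => t.
  by rewrite bump_ge0// nsq_ge0.
apply: (@itg_bump_monotone (fun t => Re (w * tsum s c lam t))
  (fun t => Re (w * h t))) => //.
- move=> x; under [X in is_derive _ _ X]funext do rewrite tsum_mull.
  apply: (is_derive_eq (is_derive_Re_tsum _ _ _ _)).
  rewrite /h tsum_mull; congr (Re (tsum s _ lam x)).
  by apply/funext => i; rewrite mulrA.
- under [X in continuous X]funext do rewrite tsum_mull.
  exact: continuous_Re_tsum.
- move=> t; rewrite -[leRHS]mul1r -w1 -nsqM -real_normK ?num_real//.
  by rewrite nsq_normc lerXn2r ?nnegrE ?normc_ge0 ?Re_le_normc.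
- exact: continuous_nsq_tsum.
- move=> t tal; have := hlip w t w1 tal; rewrite wh/=.
  by rewrite ler_norml => /andP[? _]; lra.
Qed.

Lemma itg_windows (f g : R -> R) (c l : R) (n : nat) a : linteg f -> linteg g ->
  0 <= l -> (forall a, itg f a (a + l) <= c + itg g a (a + l)) ->
  itg f a (a + n%:R * l) <= n%:R * c + itg g a (a + n%:R * l).
Proof.
move=> hf hg l0 h; elim: n => [|n IH].
  by rewrite !mul0r addr0 add0r /itg set_itv1 !Rintegral_set1.
have -> : a + n.+1%:R * l = a + n%:R * l + l.
  by rewrite -natr1 mulrDl mul1r addrA.
have h1 : a <= a + n%:R * l by rewrite lerDl mulr_ge0.
have h2 : a + n%:R * l <= a + n%:R * l + l by rewrite lerDl.
rewrite (itg_split hf h1 h2) (itg_split hg h1 h2).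
rewrite -natr1 mulrDl mul1r addrACA lerD//; exact: h.
Qed.

(* Smallness of [X] is measured by [bump (beta ^+ k)]. For trigonometric sums the
   bound is proved by induction on the number of terms: after a rotation that
   makes one frequency zero, the derivative has one term less, and where the
   derivative is at least [eta] the sum crosses small values quickly. *)
Definition small_values (X : R -> R) : Prop :=
  exists beta C rho : R, [/\ 0 < beta < 1, 0 <= C, 0 <= rho < 1 &
    forall k a, itg (fun t => bump (beta ^+ k) (X t)) a (a + 1) <= C * rho ^+ k].

Lemma itg_bump_unit (I : Type) (s : seq I) (c : I -> R[i]) (lam : I -> R)
    (h := tsum s (fun i => c i * (0 +i* lam i)) lam)
    (L := lip_tsum s (fun i => c i * (0 +i* lam i)) lam) d eta a :
  0 < d -> 0 < eta ->
  itg (fun t => bump d (nsq (tsum s c lam t))) a (a + 1) <=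
  (L / eta + 1) * (4 * d / eta) +
  2 * itg (fun t => bump (3 * eta) (nsq (h t))) a (a + 1).
Proof.
move=> d0 eta0.
have L0 : 0 <= L by exact: lip_tsum_ge0.
have Le0 : 0 <= L / eta by rewrite divr_ge0// ltW.
(* Windows of length [1 / n] with [n >= L / eta], so that [h] changes by at most [eta] in each of
   them. *)
pose n := (Num.truncn (L / eta)).+1.
have /andP[nL1 /ltW nL] := truncn_itv Le0.
have {}nL1 : n%:R <= L / eta + 1 by rewrite -natr1 lerD2r.
have n0 : 0 < n%:R :> R by rewrite ltr0n.
have e0 : 0 < 3 * eta by rewrite mulr_gt0.
have cb e c' : 0 < e -> linteg (fun t => bump e (nsq (tsum s c' lam t))).
  by move=> ?; apply/continuous_linteg/continuous_bump_tsum.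
have := @itg_windows (fun t => bump d (nsq (tsum s c lam t)))
  (fun t => 2 * bump (3 * eta) (nsq (h t))) (4 * d / eta) n%:R^-1 n a.
rewrite mulfV ?gt_eqF// => H.
apply: (le_trans (H _ _ _ _)).
- exact: cb.
- exact/lintegZ/cb.
- by rewrite invr_ge0 ltW.
- move=> b; rewrite itgZ; last exact: cb.
  have W := @itg_bump_window _ s c lam d eta n%:R^-1 b d0 eta0; apply: W.
    by rewrite invr_ge0 ltW.
  by rewrite -/L ler_pdivrMr// mulrC -ler_pdivrMr.
rewrite itgZ; last exact: cb.
by rewrite lerD2r ler_wpM2r// divr_ge0 ?(ltW eta0)// mulr_ge0// ltW.
Qed.

Lemma small_values_tsum (I : eqType) (s : seq I) (c : I -> R[i]) (lam : I -> R) :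
  s != [::] -> uniq s -> {in s &, injective lam} -> {in s, forall i, c i != 0} ->
  small_values (fun t => nsq (tsum s c lam t)).
Proof.
elim: s c lam => // i0 s IH c lam _ /= /andP[i0s us] injl c0.
pose mu i := lam i - lam i0.
have eqX : (fun t => nsq (tsum (i0 :: s) c lam t)) =
           (fun t => nsq (tsum (i0 :: s) c mu t)).
  apply/funext => t; rewrite -[LHS]mul1r -(nsq_cis (- lam i0 * t)) -nsqM.
  congr nsq; rewrite /tsum mulr_sumr; apply: eq_bigr => i _.
  by rewrite mulrCA -cisD; congr (_ * cis _); rewrite /mu; ring.
rewrite eqX.
(* A single term has constant modulus, so the bump at scale [b] is at most [b^2] over that
   constant. *)
have [s0|s0] := eqVneq s [::].
  have c00 : 0 < nsq (c i0).
    by rewrite lt_def nsq_ge0 nsq_eq0 c0// mem_head.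
  exists 2^-1, (nsq (c i0))^-1, 2^-1; split.
  - by apply/andP; split; lra.
  - by rewrite invr_ge0 ltW.
  - by apply/andP; split; lra.
  move=> k a; set b := 2^-1 ^+ k.
  have b0 : 0 < b by rewrite exprn_gt0// invr_gt0.
  have b1 : b <= 1 by rewrite exprn_ile1// invf_le1// ler1n.
  apply: (@le_trans _ _ (itg (fun=> (nsq (c i0))^-1 * b) a (a + 1))).
    apply: le_itg; first exact/continuous_linteg/continuous_bump_tsum.
      exact: linteg_cst.
    move=> t _; rewrite s0 /tsum big_seq1 nsqM nsq_cis mulr1 /bump.
    move: (nsq (c i0)) c00 => v v0.
    apply: (@le_trans _ _ (b ^+ 2 / v)).
      rewrite ler_wpM2l ?sqr_ge0// lef_pV2 ?posrE ?addr_gt0 ?exprn_gt0//.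
      by rewrite lerDr sqr_ge0.
    by rewrite mulrC ler_pM2l ?invr_gt0// expr2 ger_pMl.
  by rewrite itg_cst ?lerDl// addrAC subrr add0r mulr1.
pose c' i := c i * (0 +i* mu i).
have hE t : tsum (i0 :: s) c' mu t = tsum s c' mu t.
  rewrite /tsum big_cons /c' /mu subrr [X in _ * X * _](_ : _ = 0)//.
  by rewrite mulr0 mul0r add0r.
have [||beta [C [rho [/andP[b0 b1] C0 /andP[r0 r1] H]]]] := IH c' mu s0 us.
- move=> i j is_ js /addIr; apply: injl; by rewrite inE ?is_ ?js orbT.
- move=> i is_; rewrite mulf_neq0//; first by rewrite c0// inE is_ orbT.
  rewrite eq_complex/= eqxx/= subr_eq0; apply: contra i0s => /eqP.
  by move=> /injl <-//; rewrite inE ?eqxx ?is_ ?orbT.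
pose L := lip_tsum (i0 :: s) c' mu.
have L0 : 0 <= L by exact: lip_tsum_ge0.
(* With [e = beta^k], the scale [d = e^3] and the threshold [eta = e / 3] are used. Crossing costs
   about [d / eta^2], so the cube leaves one factor [e]: the cost is exactly [36 L e + 12 e^2]. The
   term [2 C] comes from the derivative. *)
exists (beta ^+ 3), (36 * L + 12 + 2 * C), (Num.max beta rho); split.
- by rewrite exprn_gt0// exprn_ilt1// ltW.
- by rewrite !addr_ge0 ?mulr_ge0.
- by rewrite le_max r0 orbT gt_max b1 r1.
move=> k a; set e := beta ^+ k.
have e0 : 0 < e by rewrite exprn_gt0.
have e1 : e <= 1 by rewrite exprn_ile1// ltW.
have eta0 : 0 < e / 3 by rewrite divr_gt0.
have d0 : 0 < (beta ^+ 3) ^+ k by rewrite !exprn_gt0.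
have := @itg_bump_unit _ (i0 :: s) c mu ((beta ^+ 3) ^+ k) (e / 3) a d0 eta0.
move=> /le_trans; apply.
rewrite [3 * (e / 3)](_ : _ = e); last by field.
under [X in 2 * itg X _ _]funext do rewrite -/c' hE.
have := H k a; rewrite -/e -/L.
set J := itg _ _ _ => HJ.
set m := Num.max beta rho.
have er : e <= m ^+ k by rewrite lerXn2r ?nnegrE ?le_max ?lexx ?(ltW b0).
have rr : rho ^+ k <= m ^+ k by rewrite lerXn2r ?nnegrE ?le_max ?lexx ?orbT ?(ltW b0).
have -> : (beta ^+ 3) ^+ k = e ^+ 3 by rewrite -!exprM mulnC.
have -> : (L / (e / 3) + 1) * (4 * e ^+ 3 / (e / 3)) = 36 * L * e + 12 * e ^+ 2.
  by field; rewrite gt_eqF.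
have h1 : 36 * L * e <= 36 * L * m ^+ k by rewrite ler_wpM2l// mulr_ge0.
have h2 : 12 * e ^+ 2 <= 12 * m ^+ k.
  by rewrite ler_wpM2l// (le_trans _ er)// expr2 ger_pMl.
have h3 : 2 * J <= 2 * C * m ^+ k.
  by rewrite -mulrA ler_wpM2l// (le_trans HJ)// ler_wpM2l.
have -> : (36 * L + 12 + 2 * C) * m ^+ k =
  36 * L * m ^+ k + 12 * m ^+ k + 2 * C * m ^+ k by ring.
by rewrite !lerD.
Qed.

End SmallValues.

(** * Integrability of the logarithm and removal of the regularisation *)

Section LogIntegrable.
Context {R : realType}.
Local Notation mu := (@lebesgue_measure R).
Implicit Types (t a b d T : R).

Lemma linteg_symmetric (f : R -> R) :
  (forall T, 1 <= T -> mu.-integrable `[- T, T] (EFin \o f)) -> linteg f.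
Proof.
move=> h a b; pose T := 1 + `|a| + `|b|.
apply: (integrableS _ _ _ (h T _)) => //; last first.
  by rewrite /T -addrA lerDl addr_ge0.
move=> t /=; rewrite !in_itv/= => /andP[at_ tb].
have := ler_norm b; have := ler_norm (- a); rewrite normrN => h1 h2.
have h3 := normr_ge0 a; have h4 := normr_ge0 b.
by apply/andP; split; rewrite /T; lra.
Qed.

(** By [ln u <= u - 1] for the quotient of the two arguments: one change of scale in the
    regularisation is paid for by one bump. *)
Lemma ln_bump_step (x b beta : R) : 0 <= x -> 0 < b -> 0 < beta ->
  ln (x + b ^+ 2) - ln (x + (beta * b) ^+ 2) <= beta ^- 2 * bump (beta * b) x.
Proof.
move=> x0 b0 be0.
have h1 : 0 < x + b ^+ 2 by rewrite ltr_wpDl// exprn_gt0.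
have h2 : 0 < x + (beta * b) ^+ 2 by rewrite ltr_wpDl// exprn_gt0// mulr_gt0.
rewrite -ln_div ?posrE//.
set u := _ / _.
have u0 : 0 < u by rewrite divr_gt0.
have -> : ln u = ln (1 + (u - 1)) by rewrite addrC subrK.
apply: (@le_trans _ _ (u - 1)); first by rewrite le_ln1Dx// ltrBrDl subrr.
have -> : u - 1 = (b ^+ 2 - (beta * b) ^+ 2) / (x + (beta * b) ^+ 2).
  by rewrite /u; field; rewrite gt_eqF.
rewrite /bump mulrA [_ + x]addrC ler_pM2r ?invr_gt0//.
by rewrite exprMn mulKf ?gt_eqF ?exprn_gt0// gerBl mulr_ge0 ?sqr_ge0.
Qed.

(** At most [2 T + 1 <= 3 T] unit intervals cover [[-T, T]]; this is where [1 <= T] enters. *)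
Lemma itg_bump_sym (X : R -> R) d (c T : R) : 0 < d -> (forall t, 0 <= X t) ->
  continuous X -> 0 <= c ->
  (forall a, itg (fun t => bump d (X t)) a (a + 1) <= c) -> 1 <= T ->
  itg (fun t => bump d (X t)) (- T) T <= 3 * T * c.
Proof.
move=> d0 X0 cX c0 h T1.
have cb : linteg (fun t => bump d (X t)) by apply/continuous_linteg/continuous_bump.
pose n := (Num.truncn (2 * T)).+1.
have T20 : 0 <= 2 * T by lra.
have /andP[nT1 /ltW nT] := truncn_itv T20.
have {}nT1 : n%:R <= 2 * T + 1 by rewrite /n -natr1 lerD2r.
have z : itg (fun=> 0) (- T) (- T + n%:R * 1) = 0.
  by rewrite itg_cst ?mul0r// mulr1 lerDl.
apply: (@le_trans _ _ (itg (fun t => bump d (X t)) (- T) (- T + n%:R * 1))).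
  have TT : - T <= T by lra.
  rewrite -/n in nT.
  have Tn : T <= - T + n%:R * 1 by rewrite mulr1; lra.
  rewrite (itg_split cb TT Tn).
  by rewrite lerDl itg_ge0// => t; rewrite bump_ge0.
have := @itg_windows _ (fun t => bump d (X t)) (fun=> 0) c 1 n (- T) cb (linteg_cst _).
move=> /(_ ler01) H; apply: (le_trans (H _)).
  by move=> a; rewrite itg_cst ?mul0r ?lerDl ?addr0.
by rewrite z addr0 ler_wpM2r//; lra.
Qed.

(** Telescoping over the scales [beta^i]: each step costs a bump integral of size [rho^i], and the
    geometric series gives a bound uniform in [j]. *)
Lemma itg_ln_tail (X : R -> R) : (forall t, 0 <= X t) -> continuous X ->
  small_values X ->
  exists beta E rho : R, [/\ 0 < beta < 1, 0 <= E, 0 <= rho < 1 &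
    forall k j T, 1 <= T ->
      itg (fun t => ln (X t + (beta ^+ k) ^+ 2) - ln (X t + (beta ^+ (k + j)) ^+ 2))
        (- T) T <= 2 * T * (E * rho ^+ k)].
Proof.
move=> X0 cX [beta [C [rho [/andP[b0 b1] C0 /andP[r0 r1] H]]]].
pose D := beta ^- 2 * C.
have D0 : 0 <= D by rewrite mulr_ge0// invr_ge0 exprn_ge0// ltW.
have DE : D = beta ^- 2 * C by [].
clearbody D.
have r10 : 0 < 1 - rho by rewrite subr_gt0.
exists beta, (3 / 2 * D / (1 - rho)), rho; split; [exact/andP| |exact/andP|].
  by rewrite divr_ge0 ?(ltW r10)// mulr_ge0.
move=> k j T T1.
have T0 : 0 <= T by lra.
have bk i : 0 < beta ^+ i by rewrite exprn_gt0.
have cl i : linteg (fun t => ln (X t + (beta ^+ i) ^+ 2)).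
  by apply/continuous_linteg/continuous_lnD => //; rewrite exprn_gt0.
(* The induction on [j] keeps the exact partial geometric sum. *)
suff : itg (fun t => ln (X t + (beta ^+ k) ^+ 2) - ln (X t + (beta ^+ (k + j)) ^+ 2))
    (- T) T <= 3 * T * D * (rho ^+ k - rho ^+ (k + j)) / (1 - rho).
  move=> /le_trans; apply.
  have -> : 2 * T * (3 / 2 * D / (1 - rho) * rho ^+ k) =
            3 * T * D * rho ^+ k / (1 - rho) by field; rewrite gt_eqF.
  rewrite ler_wpM2r ?invr_ge0 ?(ltW r10)// ler_wpM2l ?mulr_ge0//.
  by rewrite gerBl exprn_ge0.
elim: j => [|j IH].
  rewrite addn0 subrr mulr0 mul0r.
  under [X in itg X]funext do rewrite subrr.
  by rewrite itg_cst ?mul0r//; lra.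
have -> : (fun t => ln (X t + (beta ^+ k) ^+ 2) - ln (X t + (beta ^+ (k + j.+1)) ^+ 2)) =
  (fun t => (ln (X t + (beta ^+ k) ^+ 2) - ln (X t + (beta ^+ (k + j)) ^+ 2)) +
            (ln (X t + (beta ^+ (k + j)) ^+ 2) - ln (X t + (beta ^+ (k + j.+1)) ^+ 2))).
  by apply/funext => t; rewrite addrA subrK.
rewrite itgD; [|exact: lintegB|exact: lintegB].
have st : itg (fun t => ln (X t + (beta ^+ (k + j)) ^+ 2) -
    ln (X t + (beta ^+ (k + j.+1)) ^+ 2)) (- T) T <= 3 * T * D * rho ^+ (k + j).
  apply: (@le_trans _ _ (itg (fun t => beta ^- 2 *
      bump (beta ^+ (k + j).+1) (X t)) (- T) T)).
    apply: le_itg; first exact: lintegB.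
      by apply/lintegZ/continuous_linteg/continuous_bump.
    by move=> t _; rewrite addnS (exprS beta (k + j)) ln_bump_step.
  rewrite itgZ; last by apply/continuous_linteg/continuous_bump.
  have := itg_bump_sym (bk (k + j).+1) X0 cX _ (H (k + j).+1) T1.
  move=> /(_ (mulr_ge0 C0 (exprn_ge0 _ r0))) h.
  have -> : 3 * T * D * rho ^+ (k + j) = beta ^- 2 * (3 * T * (C * rho ^+ (k + j))).
    by rewrite DE; ring.
  rewrite ler_wpM2l ?invr_ge0 ?exprn_ge0 ?(ltW b0)// (le_trans h)//.
  rewrite ler_wpM2l ?mulr_ge0// ler_wpM2l// (exprS rho) ler_piMl ?exprn_ge0//.
  exact: ltW.
apply: (le_trans (lerD IH st)).
rewrite addnS (exprS rho) le_eqVlt; apply/orP; left; apply/eqP.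
by field; rewrite gt_eqF.
Qed.

(** For [x > 0] both sides are equal. At [x = 0] the convention [ln 0 = 0] makes the left side
    finite, while the increments on the right tend to infinity. *)
Lemma ln_tail_pointwise (x beta : R) (k : nat) : 0 <= x -> 0 < beta < 1 ->
  (`|ln (x + (beta ^+ k) ^+ 2) - ln x|%:E <=
   limn (fun j => (ln (x + (beta ^+ k) ^+ 2) - ln (x + (beta ^+ (k + j)) ^+ 2))%:E))%E.
Proof.
move=> x0 /andP[b0 b1].
have bk i : 0 < (beta ^+ i) ^+ 2 by rewrite !exprn_gt0.
have nd : nondecreasing_seq (fun j =>
    (ln (x + (beta ^+ k) ^+ 2) - ln (x + (beta ^+ (k + j)) ^+ 2))%:E).
  move=> i j ij; rewrite lee_fin lerD2l lerN2 ler_ln ?posrE ?ltr_wpDl//.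
  rewrite lerD2l lerXn2r ?nnegrE ?exprn_ge0 ?(ltW b0)//.
  by rewrite ler_wiXn2l ?ltW// leq_add2l.
have [xpos|] := ltP 0 x; last first.
  move=> x0'; have {x0'} x00 : x = 0 by apply/eqP; rewrite eq_le x0 x0'.
  rewrite {}x00 in nd *.
  rewrite (ln0 (lexx 0)) subr0.
  set A := ln _.
  have lb : 0 < - ln beta by rewrite oppr_gt0 ln_lt0// b0.
  have E j : (ln (0 + (beta ^+ k) ^+ 2) - ln (0 + (beta ^+ (k + j)) ^+ 2) =
              (- ln beta) *+ (j * 2)).
    rewrite !add0r -!exprM !lnXn// mulnDl mulrnDr; ring.
  have [j Aj] : exists j, `|A| <= (- ln beta) *+ (j * 2).
    exists (Num.truncn (`|A| / (- ln beta))).+1.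
    have q0 : 0 <= `|A| / (- ln beta) by rewrite divr_ge0// ltW.
    have /andP[_ /ltW h] := truncn_itv q0.
    rewrite -mulr_natr natrM mulrA -[leLHS]mulr1 ler_pM// ?ler1n//.
    by rewrite mulrC -ler_pdivrMr.
  apply: (@le_trans _ _ (ln (0 + (beta ^+ k) ^+ 2) - ln (0 + (beta ^+ (k + j)) ^+ 2))%:E).
    by rewrite lee_fin E.
  have := ereal_nondecreasing_cvgn nd => /cvg_lim -> //.
  by apply: ereal_sup_ubound; exists j.
have -> : limn (fun j => (ln (x + (beta ^+ k) ^+ 2) -
    ln (x + (beta ^+ (k + j)) ^+ 2))%:E) = (ln (x + (beta ^+ k) ^+ 2) - ln x)%:E.
  apply/cvg_lim => //; apply: cvg_EFin; first exact: nearW.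
  apply: cvgB; first exact: cvg_cst.
  apply: (@cvg_comp _ _ _ (fun j => x + (beta ^+ (k + j)) ^+ 2) (@ln R) _ (nbhs x));
    last exact: continuous_ln.
  suff h : (fun j => (beta ^+ (k + j)) ^+ 2) @ \oo --> (beta ^+ k) ^+ 2 * 0.
    rewrite mulr0 in h.
    have : (fun j => x + (beta ^+ (k + j)) ^+ 2) @ \oo --> x + 0.
      by apply: cvgD => //; exact: cvg_cst.
    by rewrite addr0.
  under eq_fun do rewrite exprD exprMn -[(beta ^+ _) ^+ 2 in X in _ * X]exprM mulnC exprM.
  apply: cvgMr.
  by apply: cvg_expr; rewrite ger0_norm ?exprn_ge0 ?(ltW b0)// exprn_ilt1// ltW.
rewrite lee_fin ger0_norm// subr_ge0 ler_ln ?posrE ?ltr_wpDl//.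
by rewrite lerDl ltW.
Qed.

(** Letting [j] tend to infinity in the bound of the tail yields at once that [ln X] is integrable
    and that its averages are close to those of [ln (X + d)], uniformly in [T]. *)
Lemma mean_ln_dist (X : R -> R) : (forall t, 0 <= X t) -> continuous X ->
  small_values X ->
  linteg (fun t => ln (X t)) /\
  forall e : R, 0 < e -> exists d : R, 0 < d <= e /\
    forall T, 1 <= T -> `|avg (fun t => ln (X t)) T - avg (fun t => ln (X t + d)) T| <= e.
Proof.
move=> X0 cX sX.
have [beta [E [rho [/andP[b0 b1] E0 /andP[r0 r1] H]]]] := itg_ln_tail X0 cX sX.
have bk i : 0 < (beta ^+ i) ^+ 2 by rewrite !exprn_gt0.
have cl i : linteg (fun t => ln (X t + (beta ^+ i) ^+ 2)).
  by apply/continuous_linteg/continuous_lnD.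
pose Phi k t := ln (X t + (beta ^+ k) ^+ 2) - ln (X t).
have mlnX D : measurable_fun D (fun t => ln (X t)).
  apply: (measurable_funS measurableT) => //.
  apply: measurableT_comp; last exact: continuous_measurable_fun.
  exact: measurable_ln.
have mln d D : 0 < d -> measurable_fun D (fun t => ln (X t + d)).
  move=> d0; apply: (measurable_funS measurableT) => //.
  by apply: continuous_measurable_fun; exact: continuous_lnD.
have mPhi k D : measurable_fun D (Phi k) by apply: measurable_funB; [exact: mln|exact: mlnX].
have main k T : 1 <= T ->
    (\int[mu]_(t in `[(- T)%R, T]) `|(Phi k t)%:E| <= (2 * T * (E * rho ^+ k))%:E)%E.
  move=> T1.
  pose g j t := (ln (X t + (beta ^+ k) ^+ 2) - ln (X t + (beta ^+ (k + j)) ^+ 2))%:E.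
  have mg j D : measurable_fun D (g j).
    by apply/measurable_EFinP; apply: measurable_funB; exact: mln.
  have nd t : {homo g^~ t : i j / (i <= j)%N >-> (i <= j)%E}.
    move=> i j ij; rewrite lee_fin lerD2l lerN2 ler_ln ?posrE ?ltr_wpDl//.
    rewrite lerD2l lerXn2r ?nnegrE ?exprn_ge0 ?(ltW b0)//.
    by rewrite ler_wiXn2l ?ltW// leq_add2l.
  have g0 j t : (0 <= g j t)%E.
    apply: (@le_trans _ _ (g 0 t)); last exact: nd.
    by rewrite /g addn0 subrr.
  apply: (@le_trans _ _ (\int[mu]_(t in `[(- T)%R, T]) limn (g^~ t))%E).
    apply: ge0_le_integral => //.
    - apply: measurableT_comp => //; apply/measurable_EFinP.
      exact: mPhi.
    - apply: (emeasurable_fun_cvg g) => //.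
      by move=> t _; apply: ereal_nondecreasing_is_cvgn.
    - by move=> t _; apply: ln_tail_pointwise => //; apply/andP.
  (* The increments grow with [j] from the value [0], so the limit may be taken under the
     integral. *)
  rewrite (monotone_convergence mu (measurable_itv `[- T, T]) (fun j => mg j _)) //.
  apply: lime_le.
    apply: ereal_nondecreasing_is_cvgn => i j ij.
    by apply: ge0_le_integral => //; do ?[exact: mg]; move=> t _; exact: nd.
  apply: nearW => j.
  have := H k j T T1; rewrite /itg -lee_fin; apply: le_trans.
  rewrite fineK//.
  by apply: integral_fune_fin_num => //; exact: (lintegB (cl k) (cl (k + j)%N)).
have Phii k : linteg (Phi k).
  apply: linteg_symmetric => T T1; apply/integrableP; split.
    by apply/measurable_EFinP; exact: mPhi.
  by apply: (le_lt_trans (main k T T1)); rewrite ltry.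
have lX : linteg (fun t => ln (X t)).
  have := lintegB (cl 0%N) (Phii 0%N).
  by under [X in linteg X -> _]funext do rewrite opprB addrC subrK.
split=> // e e0.
have [k [k1 k2]] : exists k, E * rho ^+ k <= e /\ (beta ^+ k) ^+ 2 <= e.
  have h1 : (fun k => E * rho ^+ k) @ \oo --> E * 0.
    by apply: cvgMr; apply: cvg_expr; rewrite ger0_norm.
  have h2 : (fun k => (beta ^+ k) ^+ 2) @ \oo --> (0 : R).
    under eq_fun do rewrite -exprM mulnC exprM.
    by apply: cvg_expr; rewrite ger0_norm ?exprn_ge0 ?(ltW b0)// exprn_ilt1// ltW.
  rewrite mulr0 in h1.
  move/cvgrPdist_le : h1 => /(_ _ e0) h1; move/cvgrPdist_le : h2 => /(_ _ e0) h2.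
  near \oo => k; exists k; split.
    apply: le_trans (ler_norm _) _; rewrite -normrN -sub0r; near: k; exact: h1.
  apply: le_trans (ler_norm _) _; rewrite -normrN -sub0r; near: k; exact: h2.
exists ((beta ^+ k) ^+ 2); split; first by rewrite bk.
move=> T T1; rewrite distrC -avgB// -/(Phi k).
have T0 : 0 < T by lra.
rewrite /avg normrM ger0_norm ?invr_ge0 ?mulr_ge0 ?(ltW T0)//.
rewrite ler_pdivrMl ?mulr_gt0//.
apply: (@le_trans _ _ (2 * T * (E * rho ^+ k))); last by rewrite ler_wpM2l ?mulr_ge0 ?(ltW T0).
rewrite -lee_fin; apply: le_trans (main k T T1).
rewrite /itg /Rintegral -abse_EFin fineK.
  apply: le_abse_integral => //; apply/measurable_EFinP.
  exact: mPhi.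
by apply: integral_fune_fin_num => //; exact: Phii.
Unshelve. all: by end_near. Qed.

End LogIntegrable.

(** * Logarithmic means of Dirichlet sums *)

Section LogMeans.
Context {R : realType}.
Variable N : nat.
Implicit Types (c psi : 'I_N -> R[i]) (t d : R).

(** The index [i] stands for the integer [i + 1]. With this sign the factor [n^(-s)] at
    [s = sigma + i t] is [expR (sigma * freq)] times [cis (t * freq)]. *)
Definition freq (i : 'I_N) : R := - ln (i.+1%:R).

Lemma freq_inj : injective freq.
Proof.
move=> i j /oppr_inj/ln_inj; rewrite !posrE !ltr0n => /(_ isT isT)/eqP.
by rewrite eqr_nat eqSS => /eqP/val_inj.
Qed.

Definition dsum c t : R[i] := tsum (index_enum 'I_N) c freq t.

Definition power c t : R := nsq (dsum c t).

Lemma power_ge0 c t : 0 <= power c t. Proof. exact: nsq_ge0. Qed.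

Lemma continuous_power c : continuous (power c).
Proof. exact: continuous_nsq_tsum. Qed.

Definition l1norm c : R := \sum_(i < N) normc (c i).

Lemma l1norm_ge0 c : 0 <= l1norm c.
Proof. by apply: sumr_ge0 => i _; exact: normc_ge0. Qed.

Lemma power_le c t : power c t <= l1norm c ^+ 2.
Proof.
rewrite /power nsq_normc lerXn2r ?nnegrE ?normc_ge0 ?l1norm_ge0//.
exact: tsum_bound.
Qed.

Lemma l1norm_phase c psi : (forall i, nsq (psi i) = 1) ->
  l1norm (fun i => c i * psi i) = l1norm c.
Proof.
move=> p1; apply: eq_bigr => i _.
by rewrite Normc.normcM [X in _ * X]normc_nsq p1 sqrtr1 mulr1.
Qed.

Definition lmean c d : R := lim (avg (fun t => ln (power c t + d)) T @[T --> +oo]).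

Lemma lmean_eq c d l : mean (fun t => ln (power c t + d)) l -> lmean c d = l.
Proof. by move=> [_ h]; apply/cvg_lim. Qed.

Lemma lmean_phase_aux c psi d : compatible_phase psi freq -> 0 < d ->
  exists l, mean (fun t => ln (power c t + d)) l /\
            mean (fun t => ln (power (fun i => c i * psi i) t + d)) l.
Proof.
move=> hp d0; have [p1 _] := hp.
apply: (@mean_ln_moments _ (power c) (power (fun i => c i * psi i))
  (moment c freq) (l1norm c ^+ 2) d) => //.
- by move=> t; rewrite power_ge0 power_le.
- by move=> t; rewrite power_ge0/= -(l1norm_phase c p1) power_le.
- exact: continuous_power.
- exact: continuous_power.
- by move=> k; exact: mean_moment.
- by move=> k; rewrite -(moment_phase c k hp); exact: mean_moment.
Qed.

Lemma compatible_phase1 : compatible_phase (fun=> 1) freq.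
Proof.
split; first by move=> i; exact: nsq1.
by move=> k f g _; rewrite !big1_eq.
Qed.

Lemma mean_lmean c d : 0 < d -> mean (fun t => ln (power c t + d)) (lmean c d).
Proof.
move=> d0; have [l [h _]] := lmean_phase_aux c compatible_phase1 d0.
by rewrite (lmean_eq h).
Qed.

Lemma lmean_phase c psi d : compatible_phase psi freq -> 0 < d ->
  lmean (fun i => c i * psi i) d = lmean c d.
Proof.
move=> hp d0; have [l [h h']] := lmean_phase_aux c hp d0.
by rewrite (lmean_eq h) (lmean_eq h').
Qed.

Lemma le_lmean c d d' : 0 < d -> d <= d' -> lmean c d <= lmean c d'.
Proof.
move=> d0 dd'; have d'0 : 0 < d' by exact: lt_le_trans dd'.
apply: (le_mean (mean_lmean c d0) (mean_lmean c d'0)) => t.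
by rewrite ler_ln ?posrE ?ltr_wpDl ?power_ge0// lerD2l.
Qed.

Lemma small_values_power c : (exists i, c i != 0) -> small_values (power c).
Proof.
move=> [i ci].
have -> : power c = fun t => nsq (tsum [seq i <- index_enum 'I_N | c i != 0] c freq t).
  apply/funext => t; rewrite /power /dsum /tsum big_filter; congr nsq.
  rewrite [LHS](bigID (fun i => c i != 0))/= [X in _ + X]big1 ?addr0//.
  by move=> j; rewrite negbK => /eqP ->; rewrite mul0r.
apply: small_values_tsum.
- apply/eqP => h; suff : i \in [::] by [].
  by rewrite -h mem_filter ci mem_index_enum.
- exact/filter_uniq/index_enum_uniq.
- by move=> x y _ _; exact: freq_inj.
- by move=> x; rewrite mem_filter => /andP[].
Qed.

Definition logmean c : R := lim (avg (fun t => ln (power c t)) T @[T --> +oo]).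

Lemma mean_logmean c : (exists i, c i != 0) ->
  mean (fun t => ln (power c t)) (logmean c).
Proof.
move=> cn0; suff [l h] : exists l, mean (fun t => ln (power c t)) l.
  have [_ hl] := h; suff -> : logmean c = l by [].
  exact/cvg_lim.
have [li h] := mean_ln_dist (power_ge0 c) (@continuous_power c) (small_values_power cn0).
apply: mean_approx => // e e0; have [d [/andP[d0 _] hd]] := h e e0.
by exists (fun t => ln (power c t + d)), (lmean c d) => //; exact: mean_lmean.
Qed.

Lemma logmean_lmean_dist c (e : R) : (exists i, c i != 0) -> 0 < e ->
  exists d, 0 < d <= e /\ `|logmean c - lmean c d| <= e.
Proof.
move=> cn0 e0.
have [li h] := mean_ln_dist (power_ge0 c) (@continuous_power c) (small_values_power cn0).
have [d [/andP[d0 de] hd]] := h e e0; exists d; split; first by rewrite d0.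
exact: mean_dist (mean_logmean cn0) (mean_lmean c d0) hd.
Qed.

Lemma logmean_le_lmean c d : (exists i, c i != 0) -> 0 < d ->
  logmean c <= lmean c d.
Proof.
move=> cn0 d0; apply/ler_addgt0Pr => e e0.
have m0 : 0 < Num.min d e by rewrite lt_min d0.
have [d' [/andP[d'0 d'm] h]] := logmean_lmean_dist cn0 m0.
move: d'm h; rewrite le_min => /andP[d'd _]; rewrite ler_distl => /andP[_ h].
apply: (le_trans h); apply: lerD; first exact: le_lmean.
by rewrite ge_min lexx orbT.
Qed.

Lemma lmean_near_logmean c (e : R) : (exists i, c i != 0) -> 0 < e ->
  exists d, 0 < d /\ forall d', 0 < d' <= d -> lmean c d' <= logmean c + e.
Proof.
move=> cn0 e0; have [d [/andP[d0 _] h]] := logmean_lmean_dist cn0 e0.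
exists d; split=> // d' /andP[d'0 dd']; apply: (le_trans (le_lmean c d'0 dd')).
by move: h; rewrite ler_distl => /andP[h _]; rewrite -lerBlDr.
Qed.

(** Lower bounds may thus be proved for the regularised means, provided that they are uniform in
    [d]. *)
Lemma le_logmean_lmean c (b : R) : (exists i, c i != 0) ->
  (forall d, 0 < d -> b <= lmean c d) -> b <= logmean c.
Proof.
move=> cn0 h; apply/ler_addgt0Pr => e e0.
have [d [d0 hd]] := lmean_near_logmean cn0 e0.
by apply: le_trans (h d d0) (hd d _); rewrite d0 lexx.
Qed.

(* Jensen's inequality for the concave function [ln]. *)
Lemma logmean_le_ln_l2 c : (exists i, c i != 0) ->
  logmean c <= ln (\sum_(i < N) nsq (c i)).
Proof.
move=> cn0; set S := \sum_(i < N) _.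
have S0 : 0 < S.
  have [i ci] := cn0; rewrite /S (bigD1 i)//= ltr_pwDl ?sumr_ge0//.
    by rewrite lt_def nsq_eq0 ci nsq_ge0.
  by move=> j _; exact: nsq_ge0.
have mS : mean (power c) S.
  have := @mean_nsq_tsum _ _ (index_enum 'I_N) c freq; congr mean.
  apply: eq_bigr => i _; rewrite (bigD1 i)//= eqxx big1 ?addr0.
    by rewrite nsq_conj.
  by move=> j ji; rewrite (inj_eq freq_inj) eq_sym (negbTE ji).
apply/ler_addgt0Pr => e e0.
have Se0 : 0 < S * e by rewrite mulr_gt0.
apply: (le_trans (logmean_le_lmean cn0 Se0)).
(* This is the tangent of the logarithm at [S], taken at [power c t + S * e]. The regularisation
   [S * e] is scaled so that its cost is exactly [e]. *)
have h : mean (fun t => ln S + S^-1 * power c t + (e - 1)) (ln S + S^-1 * S + (e - 1)).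
  apply: meanD (mean_cst _); apply: meanD (mean_cst _) _; exact: meanZ.
have -> : ln S + e = ln S + S^-1 * S + (e - 1).
  by rewrite mulVf ?gt_eqF//; ring.
apply: (le_mean (mean_lmean c Se0) h) => t.
have p0 := power_ge0 c t.
have -> : power c t + S * e = S * (1 + (S^-1 * power c t + e - 1)).
  by field; rewrite gt_eqF.
have h1 : 0 <= S^-1 * power c t by rewrite mulr_ge0// invr_ge0 ltW.
rewrite lnM ?posrE//; last by lra.
have : ln (1 + (S^-1 * power c t + e - 1)) <= S^-1 * power c t + e - 1.
  by apply: le_ln1Dx; lra.
lra.
Qed.

Lemma logmean_ge c (b : R) : (exists i, c i != 0) -> 0 < b ->
  (forall t, b <= normc (dsum c t)) -> ln (b ^+ 2) <= logmean c.
Proof.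
move=> cn0 b0 h; apply: (le_mean (mean_cst _) (mean_logmean cn0)) => t.
have bp : b ^+ 2 <= power c t.
  by rewrite /power nsq_normc lerXn2r ?nnegrE ?normc_ge0// ltW.
by rewrite ler_ln ?posrE ?(lt_le_trans _ bp) ?exprn_gt0.
Qed.

(** An additive relation between logarithms of integers is an equality of products, which a
    completely multiplicative function respects. *)
Lemma multiplicative_phase (f : nat -> R[i]) :
  f 1%N = 1 -> {in leq 1 &, {morph f : m n / (m * n)%N >-> m * n}} ->
  (forall n, (0 < n)%N -> nsq (f n) = 1) ->
  compatible_phase (fun i : 'I_N => f i.+1) freq.
Proof.
move=> f1 fM fu; split=> [i|k u v]; first exact: fu.
have fprod (w : {ffun 'I_k -> 'I_N}) (s : seq 'I_k) :
  [/\ \prod_(j <- s) f (w j).+1 = f (\prod_(j <- s) (w j).+1)%N,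
    (0 < \prod_(j <- s) (w j).+1)%N &
    \sum_(j <- s) freq (w j) = - ln ((\prod_(j <- s) (w j).+1)%N%:R : R)].
  elim: s => [|j s [IH1 IH2 IH3]]; first by rewrite !big_nil f1 ln1 oppr0.
  rewrite !big_cons IH1 IH3 muln_gt0 IH2 fM//; split=> //.
  by rewrite natrM lnM ?posrE ?ltr0n// opprD.
have [u1 u2 u3] := fprod u (index_enum 'I_k).
have [v1 v2 v3] := fprod v (index_enum 'I_k).
rewrite u1 v1 u3 v3 => /oppr_inj/ln_inj; rewrite !posrE !ltr0n => /(_ u2 v2)/eqP.
by rewrite eqr_nat => /eqP ->.
Qed.

End LogMeans.

(** * Convexity in the abscissa *)

Section Taylor.
Context {R : realType}.
Implicit Types (x y h K d : R).

(** The mean value theorem raises the order of vanishing by one and keeps the constant; iteration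
    produces the Taylor remainders used below. *)
Lemma bound_from_derive (g g' : R -> R) (C r : R) (k : nat) : 0 <= C ->
  g 0 = 0 -> (forall x, `|x| <= r -> is_derive x 1 g (g' x)) ->
  (forall x, `|x| <= r -> `|g' x| <= C * `|x| ^+ k) ->
  forall x, `|x| <= r -> `|g x| <= C * `|x| ^+ k.+1.
Proof.
move=> C0 g0 dg hg x xr.
have fin c : `|c| <= `|x| -> `|g' c * x| <= C * `|x| ^+ k.+1.
  move=> cx; rewrite normrM exprSr mulrA ler_wpM2r// (le_trans (hg c _))//.
    exact: le_trans xr.
  by rewrite ler_wpM2l// lerXn2r ?nnegrE.
have cont a b : (forall u, a <= u <= b -> `|u| <= r) -> {within `[a, b], continuous g}.
  move=> h; apply: continuous_in_subspaceT => u; rewrite inE/= in_itv/= => uab.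
  apply: differentiable_continuous; apply/derivable1_diffP.
  by have [] := dg _ (h _ uab).
have [x0|x0] := leP 0 x.
  have hr u : 0 <= u <= x -> `|u| <= r.
    by move=> /andP[u0 ux]; rewrite (le_trans _ xr)// !ger0_norm.
  have [||c] := @MVT_segment _ g g' 0 x x0.
  - by move=> u; rewrite in_itv/= => /andP[/ltW u0 /ltW ux]; apply/dg/hr/andP.
  - exact: cont.
  rewrite in_itv/= => /andP[c0 cx]; rewrite g0 !subr0 => ->.
  by apply: fin; rewrite !ger0_norm.
have hr u : x <= u <= 0 -> `|u| <= r.
  by move=> /andP[xu u0]; rewrite (le_trans _ xr)// !ler0_norm ?lerN2// ltW.
have [||c] := @MVT_segment _ g g' x 0 (ltW x0).
- by move=> u; rewrite in_itv/= => /andP[/ltW u0 /ltW ux]; apply/dg/hr/andP.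
- exact: cont.
rewrite in_itv/= => /andP[xc c0]; rewrite g0 !sub0r mulrN => /oppr_inj ->.
by apply: fin; rewrite !ler0_norm ?lerN2// ltW.
Qed.

Lemma ln1D_ge y : `|y| <= 2^-1 -> y - y ^+ 2 / 2 - 2 * `|y| ^+ 3 <= ln (1 + y).
Proof.
move=> y2.
pose g u : R := ln (1 + u) - u + u ^+ 2 / 2.
pose g' u : R := u ^+ 2 / (1 + u).
have pos (u : R) : `|u| <= 2^-1 -> 2^-1 <= 1 + u.
  by rewrite ler_norml => /andP[? _]; lra.
have dg (u : R) : `|u| <= 2^-1 -> is_derive u 1 g (g' u).
  move=> /pos u2; have u0 : 0 < 1 + u by lra.
  have h1 : is_derive u 1 (fun v : R => 1 + v) 1.
    apply: (is_derive_eq (is_deriveD (is_derive_cst (1 : R) u 1) (is_derive_id u 1))).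
    by rewrite add0r.
  have h2 := @is_derive1_comp _ (@ln R) (fun v : R => 1 + v) u _ _ (is_derive1_ln u0) h1.
  have h3 : is_derive u 1 (fun v : R => v ^+ 2 / 2) u.
    have e : is_derive u 1 (fun v : R => v * v) (u + u).
      by apply: is_derive_eq; rewrite /GRing.scale/= mulr1.
    under [X in is_derive _ _ X]funext do rewrite expr2 mulrC.
    by apply: (is_derive_eq (is_deriveZ 2^-1 e)); rewrite /GRing.scale/=; lra.
  apply: (is_derive_eq (is_deriveD (is_deriveB h2 (is_derive_id u 1)) h3)).
  by rewrite /g'; field; rewrite gt_eqF.
have hg' (u : R) : `|u| <= 2^-1 -> `|g' u| <= 2 * `|u| ^+ 2.
  move=> /pos u2; have u0 : 0 < 1 + u by lra.
  rewrite /g' normrM normfV (gtr0_norm u0) normrX mulrC ler_wpM2r ?exprn_ge0//.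
  by rewrite -[leRHS]invrK lef_pV2 ?posrE ?invr_gt0.
have g0 : g 0 = 0 by rewrite /g addr0 ln1 expr0n/= mul0r subrr addr0.
have := bound_from_derive (ler0n R 2) g0 dg hg' y2.
by rewrite ler_norml /g => /andP[? _]; lra.
Qed.

Lemma ln_shift_ge (X0 n K h d : R) : 0 < d -> d <= X0 -> 0 <= K -> 0 <= h ->
  4 * K * h <= d -> `|n| <= 2 * K * h ->
  ln X0 + n / X0 - (n / X0) ^+ 2 / 2 - 16 * (K / d) ^+ 3 * h ^+ 3 <= ln (X0 + n).
Proof.
move=> d0 dX K0 h0 Kh nb; have X0p : 0 < X0 by exact: lt_le_trans dX.
have yb : `|n / X0| <= 2 * (K / d) * h.
  rewrite normrM normfV (gtr0_norm X0p) ler_pdivrMr// (le_trans nb)//.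
  have -> : 2 * (K / d) * h * X0 = 2 * K * h * (X0 / d) by field; rewrite gt_eqF.
  apply: ler_peMr; first by rewrite !mulr_ge0.
  by rewrite ler_pdivlMr// mul1r.
have y2 : `|n / X0| <= 2^-1.
  rewrite (le_trans yb)//.
  have -> : 2 * (K / d) * h = 2 * K * h / d by ring.
  by rewrite ler_pdivrMr//; lra.
have -> : X0 + n = X0 * (1 + n / X0) by field; rewrite gt_eqF.
rewrite lnM ?posrE//; last by move: y2; rewrite ler_norml => /andP[? _]; lra.
have := ln1D_ge y2.
have y3 : `|n / X0| ^+ 3 <= 8 * ((K / d) ^+ 3 * h ^+ 3).
  have -> : 8 * ((K / d) ^+ 3 * h ^+ 3) = (2 * (K / d) * h) ^+ 3 by ring.
  rewrite lerXn2r ?nnegrE//.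
  by rewrite !mulr_ge0// invr_ge0 ltW.
by rewrite expr2 in y3 *; lra.
Qed.

(** Here [F0 = |F|^2], [F1 = |F'|^2], and [al], [ga] are the derivatives of [|F|^2] in the two
    coordinate directions. To second order the difference of the two sides is [h^2] times the
    Laplacian of [ln (|F|^2 + d)], which is [4 d |F'|^2 / (|F|^2 + d)^2 >= 0]; the rest is of order
    [h^3]. *)
Lemma ln_four_point (F0 F1 al ga b1 b2 b3 b4 K h d : R) :
  0 < d -> 0 <= K -> 0 <= h <= 1 -> 0 <= F0 -> 0 <= F1 ->
  al ^+ 2 + ga ^+ 2 = 4 * F0 * F1 -> `|al| <= K -> `|ga| <= K ->
  `|b1| <= K * h ^+ 2 -> `|b2| <= K * h ^+ 2 -> `|b3| <= K * h ^+ 2 ->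
  `|b4| <= K * h ^+ 2 ->
  4 * h ^+ 2 * F1 - K * h ^+ 3 <= b1 + b2 + b3 + b4 -> 4 * K * h <= d ->
  4 * ln (F0 + d) - (K / d + 6 * (K / d) ^+ 2 + 64 * (K / d) ^+ 3) * h ^+ 3 <=
  ln (F0 + d + (h * al + b1)) + ln (F0 + d + (- (h * al) + b2)) +
  ln (F0 + d + (h * ga + b3)) + ln (F0 + d + (- (h * ga) + b4)).
Proof.
move=> d0 K0 /andP[h0 h1] F00 F10 ag alK gaK b1K b2K b3K b4K bs Kh.
set X0 := F0 + d.
have dX : d <= X0 by rewrite lerDr.
have X0p : 0 < X0 by exact: lt_le_trans dX.
have K2 (b : R) : `|b| <= K * h ^+ 2 -> `|b| <= K * h.
  move=> /le_trans; apply; rewrite ler_wpM2l// expr2 ler_piMl//.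
have nb (s b : R) : `|s| <= K -> `|b| <= K * h ^+ 2 -> `|h * s + b| <= 2 * K * h.
  move=> sK bK; rewrite (le_trans (ler_normD _ _))// normrM (ger0_norm h0).
  have -> : 2 * K * h = h * K + K * h by ring.
  by rewrite lerD ?K2// ler_wpM2l.
have sq (s b : R) : `|s| <= K -> `|b| <= K * h ^+ 2 ->
    (h * s + b) ^+ 2 <= h ^+ 2 * s ^+ 2 + 3 * K ^+ 2 * h ^+ 3.
  move=> sK bK; have sb : h * (s * b) <= h * (K * (K * h ^+ 2)).
    rewrite ler_wpM2l// (le_trans (ler_norm _))// normrM.
    by rewrite ler_pM.
  have bb : b ^+ 2 <= K ^+ 2 * h ^+ 3.
    have -> : K ^+ 2 * h ^+ 3 = (K * h ^+ 2) * (K * h) by ring.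
    by rewrite -real_normK ?num_real// expr2 ler_pM ?K2.
  have -> : (h * s + b) ^+ 2 = h ^+ 2 * s ^+ 2 + 2 * (h * (s * b)) + b ^+ 2 by ring.
  have : h * (K * (K * h ^+ 2)) = K ^+ 2 * h ^+ 3 by ring.
  lra.
have alN : `|- al| <= K by rewrite normrN.
have gaN : `|- ga| <= K by rewrite normrN.
have L (s b : R) (hs : `|s| <= K) (hb : `|b| <= K * h ^+ 2) :=
  ln_shift_ge d0 dX K0 h0 Kh (nb s b hs hb).
rewrite -(mulrN h al) -(mulrN h ga).
have := L _ _ alK b1K; have := L _ _ alN b2K; have := L _ _ gaK b3K; have := L _ _ gaN b4K.
rewrite !expr_div_n.
have := sq _ _ alK b1K; have := sq _ _ alN b2K; have := sq _ _ gaK b3K; have := sq _ _ gaN b4K.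
rewrite !sqrrN.
set n1 := h * al + b1; set n2 := h * - al + b2.
set n3 := h * ga + b3; set n4 := h * - ga + b4.
move=> q4 q3 q2 q1 l4 l3 l2 l1.
have ns : n1 + n2 + n3 + n4 = b1 + b2 + b3 + b4 by rewrite /n1 /n2 /n3 /n4; ring.
have qs : n1 ^+ 2 + n2 ^+ 2 + n3 ^+ 2 + n4 ^+ 2 <=
    2 * (h ^+ 2 * (4 * F0 * F1)) + 12 * (K ^+ 2 * h ^+ 3).
  by rewrite -ag; lra.
have main : - (K / d + 6 * (K / d) ^+ 2) * h ^+ 3 <=
   (n1 + n2 + n3 + n4) / X0 - (n1 ^+ 2 + n2 ^+ 2 + n3 ^+ 2 + n4 ^+ 2) / X0 ^+ 2 / 2.
  have h30 : 0 <= h ^+ 3 by rewrite exprn_ge0.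
  have e1 : (4 * h ^+ 2 * F1 - K * h ^+ 3) / X0 <= (n1 + n2 + n3 + n4) / X0.
    by rewrite ns ler_wpM2r// invr_ge0 ltW.
  have e2 : (n1 ^+ 2 + n2 ^+ 2 + n3 ^+ 2 + n4 ^+ 2) / X0 ^+ 2 <=
     (2 * (h ^+ 2 * (4 * F0 * F1)) + 12 * (K ^+ 2 * h ^+ 3)) / X0 ^+ 2.
    by rewrite ler_wpM2r// invr_ge0 exprn_ge0// ltW.
  have e3 : (4 * h ^+ 2 * F1 - K * h ^+ 3) / X0 -
     (2 * (h ^+ 2 * (4 * F0 * F1)) + 12 * (K ^+ 2 * h ^+ 3)) / X0 ^+ 2 / 2 =
     4 * h ^+ 2 * F1 * d / X0 ^+ 2 - (K / X0) * h ^+ 3 - 6 * (K / X0) ^+ 2 * h ^+ 3.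
    by rewrite /X0; field; rewrite gt_eqF.
  have e4 : K / X0 <= K / d by rewrite ler_wpM2l// lef_pV2 ?posrE.
  have e5 : (K / X0) ^+ 2 <= (K / d) ^+ 2.
    by rewrite lerXn2r ?nnegrE ?divr_ge0// ltW.
  have e6 : (K / X0) * h ^+ 3 <= (K / d) * h ^+ 3 by rewrite ler_wpM2r.
  have e7 : (K / X0) ^+ 2 * h ^+ 3 <= (K / d) ^+ 2 * h ^+ 3 by rewrite ler_wpM2r.
  have e8 : 0 <= 4 * h ^+ 2 * F1 * d / X0 ^+ 2.
    by rewrite divr_ge0 ?mulr_ge0 ?exprn_ge0// ltW.
  rewrite mulNr mulrDl; lra.
have tE n : n / X0 - n ^+ 2 / X0 ^+ 2 / 2 = n / X0 - (n / X0) ^+ 2 / 2.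
  by rewrite expr_div_n.
have {}main : - (K / d + 6 * (K / d) ^+ 2) * h ^+ 3 <=
    (n1 / X0 - (n1 / X0) ^+ 2 / 2) + (n2 / X0 - (n2 / X0) ^+ 2 / 2) +
    (n3 / X0 - (n3 / X0) ^+ 2 / 2) + (n4 / X0 - (n4 / X0) ^+ 2 / 2).
  apply: (le_trans main); rewrite -!tE le_eqVlt; apply/orP; left; apply/eqP; ring.
rewrite -!expr_div_n in l1 l2 l3 l4 *.
clear ns qs q1 q2 q3 q4 L tE nb sq; clearbody n1 n2 n3 n4.
lra.
Qed.

(** With [F = a + i b] and [F' = p + i q], the four increments approximate [h F'], [- h F'],
    [i h F'] and [- i h F']; this sign pattern encodes the Cauchy-Riemann equations. The smallness
    of the sums of the [u] and of the [v] expresses that both parts are harmonic. *)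
Lemma ln_four_point_plane (a b p q u1 u2 u3 u4 v1 v2 v3 v4 K h d : R) :
  0 < d -> 0 <= K -> 0 <= h <= 1 -> 80 * K ^+ 2 * h <= d ->
  `|a| <= K -> `|b| <= K -> `|p| <= K -> `|q| <= K ->
  `|u1 - h * p| <= K * h ^+ 2 -> `|v1 - h * q| <= K * h ^+ 2 ->
  `|u2 + h * p| <= K * h ^+ 2 -> `|v2 + h * q| <= K * h ^+ 2 ->
  `|u3 + h * q| <= K * h ^+ 2 -> `|v3 - h * p| <= K * h ^+ 2 ->
  `|u4 - h * q| <= K * h ^+ 2 -> `|v4 + h * p| <= K * h ^+ 2 ->
  `|u1 + u2 + u3 + u4| <= K * h ^+ 3 -> `|v1 + v2 + v3 + v4| <= K * h ^+ 3 ->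
  forall (k : R) (Y : R -> R -> R), k = 20 * K ^+ 2 / d ->
  (forall u v, Y u v = ln (nsq ((a + u) +i* (b + v)) + d)) ->
  4 * Y 0 0 - (k + 6 * k ^+ 2 + 64 * k ^+ 3) * h ^+ 3 <=
  Y u1 v1 + Y u2 v2 + Y u3 v3 + Y u4 v4.
Proof.
move=> d0 K0 /andP[h0 h1] Kh aK bK pK qK.
have MM (x y A B : R) : `|x| <= A -> `|y| <= B -> `|x * y| <= A * B.
  by move=> xA yB; rewrite normrM ler_pM.
have KK0 : 0 <= K ^+ 2 by rewrite exprn_ge0.
have h20 : 0 <= h ^+ 2 by rewrite exprn_ge0.
have h30 : 0 <= h ^+ 3 by rewrite exprn_ge0.
have h32 : h ^+ 3 <= h ^+ 2 by rewrite exprS ler_piMl.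
have h21 : h ^+ 2 <= h by rewrite expr2 ler_piMl.
(* The increment [u] splits as a main part of size [h] and an error. *)
have part (s u p' : R) : `|p'| <= K -> `|s| <= K -> `|u - h * p'| <= K * h ^+ 2 ->
   `|s * (u - h * p')| <= K ^+ 2 * h ^+ 2 /\
   (0 <= u ^+ 2 <= 4 * K ^+ 2 * h ^+ 2 /\
    h ^+ 2 * p' ^+ 2 - 2 * (K ^+ 2 * h ^+ 3) <= u ^+ 2).
  move=> pK' sK uK; split.
    by have := MM _ _ _ _ sK uK; rewrite expr2 mulrA.
  have ub : `|u| <= 2 * K * h.
    rewrite -(subrK (h * p') u) (le_trans (ler_normD _ _))//.
    have e1 : `|h * p'| <= h * K by apply: (MM _ _ _ _ _ pK'); rewrite ger0_norm.
    have e2 : K * h ^+ 2 <= K * h by rewrite ler_wpM2l.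
    lra.
  split.
    rewrite sqr_ge0/=; have := MM _ _ _ _ ub ub; rewrite -expr2 ger0_norm ?sqr_ge0//.
    by move=> /le_trans; apply; apply: eq_ler; ring.
  have e : `|(h * p') * (u - h * p')| <= (h * K) * (K * h ^+ 2).
    by apply: (MM _ _ _ _ _ uK); apply: (MM _ _ _ _ _ pK'); rewrite ger0_norm.
  have -> : u ^+ 2 = (u - h * p') ^+ 2 + 2 * ((h * p') * (u - h * p')) + h ^+ 2 * p' ^+ 2.
    by ring.
  have := sqr_ge0 (u - h * p').
  have -> : K ^+ 2 * h ^+ 3 = (h * K) * (K * h ^+ 2) by ring.
  by move: e; rewrite ler_norml => /andP[? _]; lra.
have pK' : `|- p| <= K by rewrite normrN.
have qK' : `|- q| <= K by rewrite normrN.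
move=> U1 V1 U2 V2 U3 V3 U4 V4 Us Vs k Y -> YY.
have {}U2 : `|u2 - h * - p| <= K * h ^+ 2 by rewrite mulrN opprK.
have {}V2 : `|v2 - h * - q| <= K * h ^+ 2 by rewrite mulrN opprK.
have {}U3 : `|u3 - h * - q| <= K * h ^+ 2 by rewrite mulrN opprK.
have {}V4 : `|v4 - h * - p| <= K * h ^+ 2 by rewrite mulrN opprK.
have asum := MM _ _ _ _ aK Us; have bsum := MM _ _ _ _ bK Vs.
have ap := MM _ _ _ _ aK pK; have bq := MM _ _ _ _ bK qK.
have aq := MM _ _ _ _ aK qK; have bp := MM _ _ _ _ bK pK.
have YE (u v s w : R) : s + w = 2 * (a * u + b * v) + u ^+ 2 + v ^+ 2 ->
    Y u v = ln (a ^+ 2 + b ^+ 2 + d + (s + w)).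
  by move=> ->; rewrite YY /nsq/=; congr ln; ring.
pose be (s u v : R) := 2 * (a * u + b * v) + u ^+ 2 + v ^+ 2 - s.
have Y0 : Y 0 0 = ln (a ^+ 2 + b ^+ 2 + d).
  by rewrite YY /nsq/= !addr0.
pose al := 2 * (a * p + b * q); pose ga := 2 * (b * p - a * q).
have KKh2 : 0 <= K ^+ 2 * h ^+ 2 by rewrite mulr_ge0.
have err (p' q' u v s : R) : `|p'| <= K -> `|q'| <= K -> `|u - h * p'| <= K * h ^+ 2 ->
    `|v - h * q'| <= K * h ^+ 2 -> s = h * (2 * (a * p' + b * q')) ->
    `|be s u v| <= 20 * K ^+ 2 * h ^+ 2 /\
    h ^+ 2 * (p' ^+ 2 + q' ^+ 2) - 4 * (K ^+ 2 * h ^+ 3) <= u ^+ 2 + v ^+ 2.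
  move=> pp qq U V ->; have [A [/andP[A1 A2] A3]] := part a u p' pp aK U.
  have [B [/andP[B1 B2] B3]] := part b v q' qq bK V; split; last by rewrite mulrDr; lra.
  have -> : be (h * (2 * (a * p' + b * q'))) u v =
    2 * (a * (u - h * p')) + 2 * (b * (v - h * q')) + u ^+ 2 + v ^+ 2 by rewrite /be; ring.
  move: A B; rewrite !ler_norml => /andP[A4 A5] /andP[B4 B5].
  by clear - A1 A2 A4 A5 B1 B2 B4 B5 KKh2; apply/andP; split; lra.
have [E1 Q1] := err p q u1 v1 (h * al) pK qK U1 V1 erefl.
have [|E2 Q2] := err (- p) (- q) u2 v2 (- (h * al)) pK' qK' U2 V2; first by rewrite /al; ring.
have [|E3 Q3] := err (- q) p u3 v3 (h * ga) qK' pK U3 V3; first by rewrite /ga; ring.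
have [|E4 Q4] := err q (- p) u4 v4 (- (h * ga)) qK pK' U4 V4; first by rewrite /ga; ring.
rewrite !sqrrN in Q2 Q3 Q4.
rewrite Y0 (YE u1 v1 (h * al) (be (h * al) u1 v1)); last by rewrite /be; ring.
rewrite (YE u2 v2 (- (h * al)) (be (- (h * al)) u2 v2)); last by rewrite /be; ring.
rewrite (YE u3 v3 (h * ga) (be (h * ga) u3 v3)); last by rewrite /be; ring.
rewrite (YE u4 v4 (- (h * ga)) (be (- (h * ga)) u4 v4)); last by rewrite /be; ring.
have K20 : 0 <= 20 * K ^+ 2 by rewrite mulr_ge0.
have KKh3 : 0 <= K ^+ 2 * h ^+ 3 by rewrite mulr_ge0.
have EK : K * (K * h ^+ 3) = K ^+ 2 * h ^+ 3 by ring.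
rewrite EK in asum bsum.
have EK2 : K * K = K ^+ 2 by ring.
rewrite EK2 in ap bq aq bp.
move: asum bsum ap bq aq bp; rewrite !ler_norml.
move=> /andP[as1 as2] /andP[bs1 bs2] /andP[ap1 ap2] /andP[bq1 bq2].
move=> /andP[aq1 aq2] /andP[bp1 bp2].
apply: (@ln_four_point _ (p ^+ 2 + q ^+ 2)) => //.
- by rewrite h0.
- by rewrite addr_ge0 ?sqr_ge0.
- by rewrite addr_ge0 ?sqr_ge0.
- by rewrite /al /ga; ring.
- by clear - ap1 ap2 bq1 bq2 KK0; rewrite ler_norml /al; apply/andP; split; lra.
- by clear - aq1 aq2 bp1 bp2 KK0; rewrite ler_norml /ga; apply/andP; split; lra.
- have -> : be (h * al) u1 v1 + be (- (h * al)) u2 v2 + be (h * ga) u3 v3 +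
    be (- (h * ga)) u4 v4 = 2 * (a * (u1 + u2 + u3 + u4)) + 2 * (b * (v1 + v2 + v3 + v4)) +
    (u1 ^+ 2 + v1 ^+ 2 + u2 ^+ 2 + v2 ^+ 2 + u3 ^+ 2 + v3 ^+ 2 + u4 ^+ 2 + v4 ^+ 2).
    by rewrite /be; ring.
  clear - as1 as2 bs1 bs2 Q1 Q2 Q3 Q4 KKh3; lra.
- by apply: le_trans Kh; apply: eq_ler; ring.
Qed.

End Taylor.

(** * Taylor remainders of the exponential and trigonometric functions *)

Section ElementaryBounds.
Context {R : realType}.
Implicit Types (x : R).

Let E : R := expR 1.

Let E0 : 0 <= E. Proof. exact: expR_ge0. Qed.

Let expR_le x : `|x| <= 1 -> `|expR x| <= E.
Proof.
move=> x1; rewrite ger0_norm ?expR_ge0// ler_expR.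
by apply: le_trans x1; exact: ler_norm.
Qed.

Let dexpN x : is_derive x 1 (fun u : R => expR (- u)) (- expR (- x)).
Proof.
apply: (is_derive_eq (@is_derive1_comp _ (@expR R) (fun u => - u) x _ _
  (is_derive_expR _) (is_deriveNid x 1))).
by rewrite mulrN1.
Qed.

Lemma expR_sub1_le x : `|x| <= 1 -> `|expR x - 1| <= E * `|x| ^+ 1.
Proof.
apply: (@bound_from_derive _ (fun u => expR u - 1) (@expR R) E 1 0 E0).
- by rewrite expR0 subrr.
- by move=> y _; apply: (is_derive_eq (is_deriveB (is_derive_expR y)
    (is_derive_cst (1 : R) y 1))); rewrite subr0.
- by move=> y y1; rewrite expr0 mulr1; exact: expR_le.
Qed.

Lemma expR_taylor1 x : `|x| <= 1 -> `|expR x - 1 - x| <= E * `|x| ^+ 2.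
Proof.
apply: (@bound_from_derive _ (fun u => expR u - 1 - u) (fun u => expR u - 1) E 1 1 E0).
- by rewrite expR0 subrr subr0.
- move=> y _; apply: (is_derive_eq (is_deriveB (is_deriveB (is_derive_expR y)
    (is_derive_cst (1 : R) y 1)) (is_derive_id y 1))).
  by rewrite subr0.
- by move=> y y1; exact: expR_sub1_le.
Qed.

Lemma sin_le x : `|x| <= 1 -> `|sin x| <= 1 * `|x| ^+ 1.
Proof.
apply: (@bound_from_derive _ (@sin R) (@cos R) 1 1 0 ler01); first exact: sin0.
- by move=> y _; rewrite mulr1 ler_norml cos_geN1 cos_le1.
Qed.

Lemma cos_taylor1 x : `|x| <= 1 -> `|cos x - 1| <= 1 * `|x| ^+ 2.
Proof.
apply: (@bound_from_derive _ (fun u => cos u - 1) (fun u => - sin u) 1 1 1 ler01).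
- by rewrite cos0 subrr.
- by move=> y _; apply: (is_derive_eq (is_deriveB (is_derive_cos y)
    (is_derive_cst (1 : R) y 1))); rewrite subr0.
- by move=> y y1; rewrite normrN; exact: sin_le.
Qed.

Lemma sin_taylor1 x : `|x| <= 1 -> `|sin x - x| <= 1 * `|x| ^+ 2.
Proof.
apply: (@bound_from_derive _ (fun u => sin u - u) (fun u => cos u - 1) 1 1 1 ler01).
- by rewrite sin0 subrr.
- move=> y y1; rewrite (le_trans (cos_taylor1 y1))// !mul1r expr1 expr2.
  by rewrite ler_piMl.
Qed.

(** The quadratic terms of [2 cosh x] and [2 cos x] cancel, which is harmonicity in discrete form.
    Three derivatives are taken back to a bounded function. *)
Lemma cosh_cos_bound x : `|x| <= 1 ->
  `|expR x + expR (- x) + 2 * cos x - 4| <= (2 * E + 2) * `|x| ^+ 3.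
Proof.
have C0 : 0 <= 2 * E + 2 by rewrite addr_ge0// mulr_ge0.
have d2 (y : R) : is_derive y 1 (fun u => expR u + expR (- u) - 2 * cos u)
    (expR y - expR (- y) + 2 * sin y).
  apply: (is_derive_eq (is_deriveB (is_deriveD (is_derive_expR y) (dexpN y))
    (is_deriveZ 2 (is_derive_cos y)))).
  by rewrite /GRing.scale/=; ring.
have d1 (y : R) : is_derive y 1 (fun u => expR u - expR (- u) - 2 * sin u)
    (expR y + expR (- y) - 2 * cos y).
  apply: (is_derive_eq (is_deriveB (is_deriveB (is_derive_expR y) (dexpN y))
    (is_deriveZ 2 (is_derive_sin y)))).
  by rewrite /GRing.scale/=; ring.
have d0 (y : R) : is_derive y 1 (fun u => expR u + expR (- u) + 2 * cos u - 4)
    (expR y - expR (- y) - 2 * sin y).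
  apply: (is_derive_eq (is_deriveB (is_deriveD (is_deriveD (is_derive_expR y) (dexpN y))
    (is_deriveZ 2 (is_derive_cos y))) (is_derive_cst (4 : R) y 1))).
  by rewrite /GRing.scale/=; ring.
have b2 (y : R) : `|y| <= 1 ->
    `|expR y + expR (- y) - 2 * cos y| <= (2 * E + 2) * `|y| ^+ 1.
  apply: (@bound_from_derive _ _ _ _ 1 0 C0 _ (fun y _ => d2 y)).
    by rewrite oppr0 expR0 cos0; lra.
  move=> {}y y1; rewrite expr0 mulr1.
  have := expR_le y1; have := @expR_le (- y); rewrite normrN => /(_ y1).
  have := sin_geN1 y; have := sin_le1 y.
  rewrite !ler_norml => h1 h2 /andP[h3 h4] /andP[h5 h6].
  by apply/andP; split; lra.
have b1 (y : R) : `|y| <= 1 ->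
    `|expR y - expR (- y) - 2 * sin y| <= (2 * E + 2) * `|y| ^+ 2.
  apply: (@bound_from_derive _ _ _ _ 1 1 C0 _ (fun y _ => d1 y) b2).
  by rewrite oppr0 expR0 sin0; lra.
apply: (@bound_from_derive _ _ _ _ 1 2 C0 _ (fun y _ => d0 y) b1).
by rewrite oppr0 expR0 cos0; lra.
Qed.

End ElementaryBounds.

(** * Subharmonicity of the regularised logarithm of an exponential sum *)

Section FourPoint.
Context {R : realType}.
Variable I : finType.
Implicit Types (z : I -> R[i]) (lam : I -> R) (h S L d : R).

Lemma Im_le_normc (z : R[i]) : `|Im z| <= normc z.
Proof.
rewrite normc_nsq -sqrtr_sqr ler_sqrt ?nsq_ge0//.
by rewrite /nsq lerDr sqr_ge0.
Qed.

Lemma normc_le_ReIm (z : R[i]) :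
  normc z <= `|Re z| + `|Im z|.
Proof.
rewrite normc_nsq -(ler_sqr _) ?nnegrE ?sqrtr_ge0 ?addr_ge0//.
rewrite sqr_sqrtr ?nsq_ge0// /nsq sqrrD !real_normK ?num_real//.
by rewrite -addrA lerD2l lerDr mulrn_wge0// mulr_ge0.
Qed.

Lemma sum_normc_le z (w : I -> R[i]) S (K : R) : \sum_i normc (z i) <= S ->
  (forall i, normc (w i) <= K) -> 0 <= K ->
  normc (\sum_i z i * w i) <= S * K.
Proof.
move=> zS wK K0; rewrite (le_trans (normc_sum _ _))//.
apply: (@le_trans _ _ (\sum_i normc (z i) * K)).
  by apply: ler_sum => i _; rewrite Normc.normcM ler_wpM2l ?normc_ge0.
by rewrite -mulr_suml ler_wpM2r.
Qed.

(* A discrete subharmonicity: [w |-> \sum_i z i * expR (w * lam i)] is entire, and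
   the four terms are its values at [h], [- h], [i h] and [- i h]. The last two are
   translations in the variable [t], invisible to the mean. *)
Lemma four_point S L d : 0 < d -> 0 <= S -> 1 <= L ->
  exists C h0 : R, [/\ 0 <= C, 0 < h0 &
   forall z lam h, \sum_i normc (z i) <= S -> (forall i, `|lam i| <= L) ->
     0 <= h <= h0 ->
     4 * ln (nsq (\sum_i z i) + d) - C * h ^+ 3 <=
     ln (nsq (\sum_i z i * (expR (h * lam i))%:C) + d) +
     ln (nsq (\sum_i z i * (expR (- (h * lam i)))%:C) + d) +
     ln (nsq (\sum_i z i * cis (h * lam i)) + d) +
     ln (nsq (\sum_i z i * cis (- (h * lam i))) + d)].
Proof.
(* One constant dominates the value, the derivative and all remainders; [1 <= L] allows the lower
   powers of [L] to be replaced by the cube. *)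
move=> d0 S0 L1; pose E : R := expR 1.
have E1 : 1 <= E by rewrite /E -[leLHS]expR0 ler_expR.
pose K : R := S * ((2 * E + 2) * L ^+ 3).
have L0 : 0 <= L by lra.
have K0 : 0 <= K by rewrite !mulr_ge0 ?exprn_ge0//; lra.
have KE : K = S * ((2 * E + 2) * L ^+ 3) by [].
clearbody K.
have K20 : 0 <= K ^+ 2 by rewrite sqr_ge0.
pose k : R := 20 * K ^+ 2 / d.
have k0 : 0 <= k by apply: divr_ge0; [rewrite mulr_ge0|exact: ltW].
have kE : k = 20 * K ^+ 2 / d by [].
clearbody k.
(* The first bound keeps [h * lam i] in [[-1, 1]] for the Taylor estimates, the second one gives
   [80 K^2 h <= d]. *)
pose h0 : R := Num.min (L^-1) (d / (80 * K ^+ 2 + 1)).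
have KK1 : 0 < 80 * K ^+ 2 + 1 by rewrite ltr_wpDl// mulr_ge0.
exists (k + 6 * k ^+ 2 + 64 * k ^+ 3), h0; split.
- by rewrite !addr_ge0 ?mulr_ge0 ?exprn_ge0.
- by rewrite lt_min invr_gt0 divr_gt0// andbT; lra.
move=> z lam h zS lamL /andP[hp]; rewrite le_min => /andP[hL hd].
have Lp : 0 < L by lra.
have hL1 : h * L <= 1 by rewrite -ler_pdivlMr// div1r.
have h1 : h <= 1 by rewrite (le_trans _ hL1)// ler_peMr.
have x1 i : `|h * lam i| <= 1.
  by rewrite normrM ger0_norm// (le_trans _ hL1)// ler_wpM2l.
have x1N i : `|- (h * lam i)| <= 1 by rewrite normrN.
have xb i n : `|h * lam i| ^+ n <= h ^+ n * L ^+ n.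
  by rewrite -exprMn lerXn2r ?nnegrE ?mulr_ge0// normrM ger0_norm// ler_wpM2l.
have L23 : L ^+ 2 <= L ^+ 3 by rewrite [leRHS]exprS ler_peMl// exprn_ge0.
have L03 : 1 <= L ^+ 3 by rewrite exprn_ege1.
have L13 : L <= L ^+ 3 by rewrite exprS ler_peMr// exprn_ege1.
have E2 : 1 <= 2 * E + 2 by lra.
have sK (y : R) : y <= (2 * E + 2) * L ^+ 3 -> S * y <= K by move=> ?; rewrite KE ler_wpM2l.
have sKn (y : R) n : y <= (2 * E + 2) * (h ^+ n * L ^+ 3) -> S * y <= K * h ^+ n.
  move=> yb; rewrite KE -mulrA ler_wpM2l// (le_trans yb)//.
  by apply: eq_ler; ring.
pose f0 := \sum_i z i; pose f1 := \sum_i z i * (lam i)%:C.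
have f0K : normc f0 <= K.
  rewrite (le_trans (normc_sum _ _))// (le_trans zS)// -[S]mulr1 sK//.
  by rewrite (le_trans E2)// ler_peMr//; lra.
have f1K : normc f1 <= K.
  rewrite (le_trans (sum_normc_le zS (K := L) _ _))// => [i|].
    by rewrite normc_nsq nsq_real sqrtr_sqr.
  by rewrite sK// (le_trans L13)// ler_peMl ?exprn_ge0.
have D (w : I -> R[i]) (u : R[i]) :
    \sum_i z i * w i - f0 - h%:C * u * f1 =
    \sum_i z i * (w i - 1 - u * (h * lam i)%:C).
  rewrite /f0 /f1 mulr_sumr -!sumrB; apply: eq_bigr => i _.
  by rewrite rmorphM/=; ring.
have Db (w : I -> R[i]) (u : R[i]) :
    (forall i, normc (w i - 1 - u * (h * lam i)%:C) <=
       (2 * E + 2) * (h ^+ 2 * L ^+ 2)) ->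
    normc (\sum_i z i * w i - f0 - h%:C * u * f1) <= K * h ^+ 2.
  move=> hw; rewrite D (le_trans (sum_normc_le zS hw _))//.
    by rewrite !mulr_ge0 ?exprn_ge0//; lra.
  apply: (sKn _ 2%N); apply: ler_wpM2l; first lra.
  by apply: ler_wpM2l => //; exact: exprn_ge0.
have G1 := Db (fun i => (expR (h * lam i))%:C) 1 _.
have G2 := Db (fun i => (expR (- (h * lam i)))%:C) (-1) _.
have G3 := Db (fun i => cis (h * lam i)) (0 +i* 1) _.
have G4 := Db (fun i => cis (- (h * lam i))) (0 +i* (-1)) _.
have fin i (y e : R) : y <= e * `|h * lam i| ^+ 2 -> 0 <= e <= 2 * E + 2 ->
    y <= (2 * E + 2) * (h ^+ 2 * L ^+ 2).
  move=> /le_trans yx /andP[e0 eE]; apply: yx.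
  by rewrite ler_pM ?exprn_ge0.
have ex (x : R) : `|x| <= 1 -> normc ((expR x)%:C - 1 - x%:C) <= E * `|x| ^+ 2.
  move=> xb1; have -> : (expR x)%:C - 1 - x%:C = (expR x - 1 - x)%:C by rewrite !rmorphB.
  by rewrite normc_nsq nsq_real sqrtr_sqr expR_taylor1.
have cs (x : R) : `|x| <= 1 -> normc (cis x - 1 - (0 +i* 1) * x%:C) <= 2 * `|x| ^+ 2.
  move=> xb1; rewrite (le_trans (normc_le_ReIm _))//.
  have -> : Re (cis x - 1 - (0 +i* 1) * x%:C) = cos x - 1.
    by rewrite /cis/=; ring.
  have -> : Im (cis x - 1 - (0 +i* 1) * x%:C) = sin x - x.
    by rewrite /cis/=; ring.
  by have := cos_taylor1 xb1; have := sin_taylor1 xb1; lra.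
have eE : 0 <= E <= 2 * E + 2 by apply/andP; split; lra.
have e2 : 0 <= (2 : R) <= 2 * E + 2 by apply/andP; split; lra.
have g1 i : normc ((expR (h * lam i))%:C - 1 - 1 * (h * lam i)%:C) <=
    (2 * E + 2) * (h ^+ 2 * L ^+ 2).
  by rewrite mul1r; exact: fin (ex _ (x1 i)) eE.
have g2 i : normc ((expR (- (h * lam i)))%:C - 1 - -1 * (h * lam i)%:C) <=
    (2 * E + 2) * (h ^+ 2 * L ^+ 2).
  by have := ex _ (x1N i); rewrite rmorphN mulN1r normrN => /fin; exact.
have g3 i : normc (cis (h * lam i) - 1 - (0 +i* 1) * (h * lam i)%:C) <=
    (2 * E + 2) * (h ^+ 2 * L ^+ 2) by exact: fin (cs _ (x1 i)) e2.
have g4 i : normc (cis (- (h * lam i)) - 1 - (0 +i* (-1)) * (h * lam i)%:C) <=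
    (2 * E + 2) * (h ^+ 2 * L ^+ 2).
  have -> : (0 +i* (-1)) * (h * lam i)%:C = (0 +i* 1) * (- (h * lam i))%:C :> R[i].
    by simpc; congr (_ +i* _); ring.
  by have := cs _ (x1N i); rewrite normrN => /fin; exact.
move: {G1}(G1 g1) {G2}(G2 g2) {G3}(G3 g3) {G4}(G4 g4) => G1 G2 G3 G4.
set F1 := \sum_i z i * _ in G1 *; set F2 := \sum_i z i * _ in G2 *.
set F3 := \sum_i z i * _ in G3 *; set F4 := \sum_i z i * _ in G4 *.
have Gs : normc ((F1 - f0) + (F2 - f0) + (F3 - f0) + (F4 - f0)) <= K * h ^+ 3.
  have -> : (F1 - f0) + (F2 - f0) + (F3 - f0) + (F4 - f0) =
     \sum_i z i * (expR (h * lam i) + expR (- (h * lam i)) + 2 * cos (h * lam i) - 4)%:C.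
    rewrite /F1 /F2 /F3 /F4 /f0 -!sumrB -!big_split/=; apply: eq_bigr => i _.
    by case: (z i) => x y; rewrite /cis cosN sinN; simpc; congr (_ +i* _); ring.
  rewrite (le_trans (sum_normc_le zS (K := (2 * E + 2) * (h ^+ 3 * L ^+ 3)) _ _))//.
  - move=> i; rewrite normc_nsq nsq_real sqrtr_sqr (le_trans (cosh_cos_bound (x1 i)))//.
    by rewrite ler_wpM2l//; lra.
  - by rewrite !mulr_ge0 ?exprn_ge0//; lra.
  - exact: (sKn _ 3%N).
have := @ln_four_point_plane R (Re f0) (Im f0) (Re f1)
  (Im f1) (Re (F1 - f0)) (Re (F2 - f0))
  (Re (F3 - f0)) (Re (F4 - f0)) (Im (F1 - f0))
  (Im (F2 - f0)) (Im (F3 - f0)) (Im (F4 - f0)) K h d d0 K0.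
rewrite hp h1 => /(_ isT) H.
have hd' : 80 * K ^+ 2 * h <= d.
  have : (80 * K ^+ 2 + 1) * h <= d by rewrite mulrC -ler_pdivlMr.
  by rewrite mulrDl mul1r; lra.
have Reb (u : R[i]) (x : R) : normc u <= x -> `|Re u| <= x.
  exact: le_trans (Re_le_normc _).
have Imb (u : R[i]) (x : R) : normc u <= x -> `|Im u| <= x.
  exact: le_trans (Im_le_normc _).
have bound (F u : R[i]) (y y' : R) : normc (F - f0 - h%:C * u * f1) <= K * h ^+ 2 ->
   Re (h%:C * u * f1) = y -> Im (h%:C * u * f1) = y' ->
   `|Re (F - f0) - y| <= K * h ^+ 2 /\ `|Im (F - f0) - y'| <= K * h ^+ 2.
  move=> FK <- <-; split.
    by have := Reb _ _ FK; case: (F - f0) => ? ?; case: (h%:C * u * f1).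
  by have := Imb _ _ FK; case: (F - f0) => ? ?; case: (h%:C * u * f1).
have ReIm u : (Re (h%:C * u * f1) = h * (Re u * Re f1 - Im u * Im f1)) /\
  (Im (h%:C * u * f1) = h * (Re u * Im f1 + Im u * Re f1)).
  by case: u => u u'; case: (f1) => a b; simpc => /=; split; ring.
have [R1 I1] := ReIm 1; have [R2 I2] := ReIm (-1).
have [R3 I3] := ReIm (0 +i* 1); have [R4 I4] := ReIm (0 +i* (-1)).
have [r1 i1] := bound _ _ _ _ G1 R1 I1; have [r2 i2] := bound _ _ _ _ G2 R2 I2.
have [r3 i3] := bound _ _ _ _ G3 R3 I3; have [r4 i4] := bound _ _ _ _ G4 R4 I4.
move: r1 i1 r2 i2 r3 i3 r4 i4 => /=.
rewrite !oppr0 !mul0r !mul1r !mulN1r !sub0r !add0r !subr0 !addr0 ?opprK !mulrN ?opprK.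
move=> r1 i1 r2 i2 r3 i3 r4 i4.
have sumRe (u v w x : R[i]) : Re (u + v + w + x) =
   Re u + Re v + Re w + Re x.
  by case: u => ? ?; case: v => ? ?; case: w => ? ?; case: x.
have sumIm (u v w x : R[i]) : Im (u + v + w + x) =
   Im u + Im v + Im w + Im x.
  by case: u => ? ?; case: v => ? ?; case: w => ? ?; case: x.
have {}H := H hd' (Reb _ _ f0K) (Imb _ _ f0K) (Reb _ _ f1K) (Imb _ _ f1K) r1 i1 r2 i2 r3 i3 r4 i4.
have := H _ _ k (fun u v => ln (nsq ((Re f0 + u) +i* (Im f0 + v)) + d))
  kE (fun _ _ => erefl).
rewrite -sumRe -sumIm => /(_ (Reb _ _ Gs) (Imb _ _ Gs)).
have back (F : R[i]) : (Re f0 + Re (F - f0)) +i*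
    (Im f0 + Im (F - f0)) = F.
  by case: F => x y; case: (f0) => a b /=; congr (_ +i* _); ring.
rewrite !back !addr0; congr (4 * ln (nsq _ + d) - _ <= _).
Qed.

End FourPoint.

(** * From second differences to convexity of the Jessen function *)

Section Convexity.
Context {R : realType}.
Implicit Types (f phi : R -> R) (x y z s h d : R).

Definition convexR f : Prop :=
  forall x y z, x < y < z -> (z - x) * f y <= (z - y) * f x + (y - x) * f z.

(* After adding [e * u ^+ 2], the second differences are positive for small
   steps, hence the maximum of the distance to a chord is at an end point. *)
Lemma convexR_second_diff phi : continuous phi ->
  (forall A B : R, exists C h0 : R, [/\ 0 <= C, 0 < h0 & forall s h,
     A <= s <= B -> 0 <= h <= h0 ->
     2 * phi s - C * h ^+ 3 <= phi (s + h) + phi (s - h)]) ->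
  convexR phi.
Proof.
move=> cphi hphi x y z /andP[xy yz].
have zx : 0 < z - x by rewrite subr_gt0 (lt_trans xy).
(* The defect of convexity of [e * u^2] on the triple is exactly [e * K], so [e = e0 / K] costs
   [e0]. *)
pose K := (y - x) * (z - y) * (z - x).
have K0 : 0 < K by rewrite !mulr_gt0 ?subr_gt0// (lt_trans xy).
apply/ler_addgt0Pr => e0 e00.
pose e := e0 / K.
have ep : 0 < e by rewrite divr_gt0.
pose Phi u := phi u + e * (u * u).
pose l u := (z - u) * Phi x + (u - x) * Phi z.
pose psi u := (z - x) * Phi u - l u.
suff psi0 : psi y <= 0.
  have -> : e0 = e * K by rewrite /e mulfVK// gt_eqF.
  by move: psi0; rewrite /psi /l /Phi /K => psi0; lra.
have cpsi : continuous psi.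
  move=> u; apply: cvgB.
    apply: cvgMr; apply: cvgD; first exact: cphi.
    by apply: cvgMr; apply: cvgM; exact: cvg_id.
  apply: cvgD; apply: cvgMl; apply: cvgB => //; try exact: cvg_cst; exact: cvg_id.
have xz : x <= z by rewrite ltW// (lt_trans xy).
have [c + cmax] := EVT_max xz (continuous_subspaceT cpsi).
rewrite in_itv/= => /andP[xc cz].
have yc : psi y <= psi c by apply: cmax; rewrite in_itv/= !ltW.
move: xc; rewrite le_eqVlt => /predU1P[xc|xc].
  by rewrite (le_trans yc)// -xc /psi /l; lra.
move: cz; rewrite le_eqVlt => /predU1P[zc|cz].
  by rewrite (le_trans yc)// zc /psi /l; lra.
have [C [h0 [C0 h00 H]]] := hphi x z.
pose h := Num.min h0 (Num.min (Num.min (c - x) (z - c)) (e / (C + 1))).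
have C1 : 0 < C + 1 by lra.
have hp : 0 < h by rewrite !lt_min h00 !subr_gt0 xc cz divr_gt0.
have hh0 : h <= h0 by rewrite /h ge_min lexx.
have hcx : h <= c - x by rewrite /h !ge_min lexx !orbT.
have hzc : h <= z - c by rewrite /h !ge_min lexx !orbT.
have hC : h <= e / (C + 1) by rewrite /h !ge_min lexx !orbT.
clearbody h.
have hCe : C * h < 2 * e.
  have : h * (C + 1) <= e by rewrite -ler_pdivlMr.
  by move=> ?; lra.
have /H : x <= c <= z by rewrite !ltW.
move=> /(_ h); rewrite hh0 ltW// => /(_ isT) D.
have p1 : psi (c + h) <= psi c by apply: cmax; rewrite in_itv/=; apply/andP; split; lra.
have p2 : psi (c - h) <= psi c by apply: cmax; rewrite in_itv/=; apply/andP; split; lra.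
have E : psi (c + h) + psi (c - h) - 2 * psi c =
  (z - x) * (phi (c + h) + phi (c - h) - 2 * phi c + 2 * e * h ^+ 2).
  by rewrite /psi /l /Phi; ring.
have : 0 < psi (c + h) + psi (c - h) - 2 * psi c.
  rewrite E mulr_gt0//.
  have : 0 < (2 * e - C * h) * h ^+ 2 by rewrite mulr_gt0 ?exprn_gt0// subr_gt0.
  have : C * h ^+ 3 = C * h * h ^+ 2 by ring.
  by move=> e1 e2; lra.
by move=> ?; exfalso; lra.
Qed.

Variables (N : nat) (a : nat -> R[i]).

Definition dcoef s (i : 'I_N) : R[i] := a i.+1 * (expR (s * freq i))%:C.

(** The summand [1] secures the condition [1 <= L] of [four_point]. *)
Definition freq_bound : R := 1 + \sum_(i < N) `|@freq R N i|.

Lemma freq_le (i : 'I_N) : `|@freq R N i| <= freq_bound.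
Proof.
rewrite /freq_bound (bigD1 i)//= addrCA lerDl addr_ge0// sumr_ge0//.
Qed.

Lemma freq_bound_ge1 : 1 <= freq_bound.
Proof. by rewrite lerDl sumr_ge0. Qed.

Lemma l1norm_dcoef_le (B s : R) : `|s| <= B ->
  l1norm (dcoef s) <= \sum_(i < N) normc (a i.+1) * expR (B * freq_bound).
Proof.
move=> sB; apply: ler_sum => i _; rewrite Normc.normcM ler_wpM2l ?normc_ge0//.
rewrite [leLHS]normc_nsq nsq_real sqrtr_sqr ger0_norm ?expR_ge0// ler_expR.
rewrite (le_trans (ler_norm _))// normrM ler_pM// freq_le//.
Qed.

Lemma cis_phase h : compatible_phase (fun i : 'I_N => cis (h * freq i)) (@freq R N).
Proof.
split=> [i|k f g fg]; first exact: nsq_cis.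
by rewrite -!cis_sum -!mulr_sumr fg.
Qed.

(** The imaginary shifts multiply the coefficients by the phases [cis (h * freq)] and
    [cis (- h * freq)]. By [lmean_phase] these two terms equal the central one, which leaves
    [4 - 2 = 2] copies of it. *)
Lemma lmean_dcoef_second_diff d (A B : R) : 0 < d ->
  exists C h0 : R, [/\ 0 <= C, 0 < h0 & forall s h, A <= s <= B -> 0 <= h <= h0 ->
   2 * lmean (dcoef s) d - C * h ^+ 3 <= lmean (dcoef (s + h)) d + lmean (dcoef (s - h)) d].
Proof.
move=> d0; pose M := `|A| + `|B|.
pose S := \sum_(i < N) normc (a i.+1) * expR (M * freq_bound).
have S0 : 0 <= S by apply: sumr_ge0 => i _; rewrite mulr_ge0 ?normc_ge0 ?expR_ge0.
have [C [h0 [C0 h00 H]]] := four_point 'I_N d0 S0 freq_bound_ge1.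
exists C, h0; split=> // s h /andP[As sB] hh.
have sM : `|s| <= M.
  rewrite ler_norml; have := ler_norm B; have := ler_norm (- A).
  have := normr_ge0 A; have := normr_ge0 B; rewrite normrN /M => ? ? ? ?.
  by apply/andP; split; lra.
have shift (w : 'I_N -> R[i]) c' t : (forall i, c' i = dcoef s i * w i) ->
    power c' t = nsq (\sum_(i < N) (dcoef s i * cis (freq i * t)) * w i).
  move=> cE; rewrite /power /dsum /tsum; congr nsq; apply: eq_bigr => i _.
  by rewrite cE mulrAC.
have zS t : \sum_(i < N) normc (dcoef s i * cis (freq i * t)) <= S.
  apply: le_trans (l1norm_dcoef_le sM); apply: ler_sum => i _.
  by rewrite [leLHS]Normc.normcM normc_cis mulr1.
have P t : 4 * ln (power (dcoef s) t + d) - C * h ^+ 3 <=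
    ln (power (dcoef (s + h)) t + d) + ln (power (dcoef (s - h)) t + d) +
    ln (power (fun i => dcoef s i * cis (h * freq i)) t + d) +
    ln (power (fun i => dcoef s i * cis (- h * freq i)) t + d).
  rewrite (shift (fun i => (expR (h * freq i))%:C) (dcoef (s + h))); last first.
    by move=> i; rewrite /dcoef mulrDl expRD rmorphM/= mulrA.
  rewrite (shift (fun i => (expR (- (h * freq i)))%:C) (dcoef (s - h))); last first.
    by move=> i; rewrite /dcoef mulrBl expRD rmorphM/= mulrA.
  rewrite (shift (fun i => cis (h * freq i)) (fun i => dcoef s i * cis (h * freq i)))//.
  rewrite (shift (fun i => cis (- (h * freq i))) (fun i => dcoef s i * cis (- h * freq i))).
    by rewrite {1}/power /dsum /tsum; apply: H => //; exact: freq_le.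
  by move=> i; rewrite mulNr.
have L1 := meanB (meanZ 4 (mean_lmean (dcoef s) d0)) (mean_cst (C * h ^+ 3)).
have L2 := meanD (meanD (meanD (mean_lmean (dcoef (s + h)) d0)
   (mean_lmean (dcoef (s - h)) d0))
   (mean_lmean (fun i => dcoef s i * cis (h * freq i)) d0))
   (mean_lmean (fun i => dcoef s i * cis (- h * freq i)) d0).
have := le_mean L1 L2 P.
rewrite (lmean_phase (dcoef s) (cis_phase h) d0) (lmean_phase (dcoef s) (cis_phase (- h)) d0).
move: (lmean (dcoef s) d) (lmean (dcoef (s + h)) d) (lmean (dcoef (s - h)) d) => m0 m1 m2.
by clear => m; lra.
Qed.

Lemma ln_lip (u v d : R) : 0 < d -> 0 <= u -> 0 <= v ->
  `|ln (u + d) - ln (v + d)| <= `|u - v| / d.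
Proof.
move=> d0.
have main (x y : R) : 0 <= x -> x <= y -> ln (y + d) - ln (x + d) <= (y - x) / d.
  move=> x0 xy; have y0 : 0 <= y by exact: le_trans xy.
  have xd : 0 < x + d by rewrite ltr_wpDl.
  have yd : 0 < y + d by rewrite ltr_wpDl.
  rewrite -ln_div ?posrE//.
  have -> : (y + d) / (x + d) = 1 + (y - x) / (x + d) by field; rewrite gt_eqF.
  apply: (@le_trans _ _ ((y - x) / (x + d))).
    by apply: le_ln1Dx; rewrite (@lt_le_trans _ _ 0)// divr_ge0 ?subr_ge0 ?(ltW xd).
  by rewrite ler_wpM2l ?subr_ge0// lef_pV2 ?posrE// lerDr.
have mono (x y : R) : 0 <= x -> x <= y -> ln (x + d) <= ln (y + d).
  move=> x0 xy; rewrite ler_ln ?posrE ?ltr_wpDl ?lerD2r//; exact: le_trans xy.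
move=> u0 v0; have [uv|/ltW vu] := leP u v.
  by rewrite distrC [`|u - v|]distrC !ger0_norm ?subr_ge0 ?mono// main.
by rewrite !ger0_norm ?subr_ge0 ?mono// main.
Qed.

Lemma normc_dist (u v : R[i]) : `|normc u - normc v| <= normc (u - v).
Proof.
have h (x y : R[i]) : normc x - normc y <= normc (x - y).
  by rewrite lerBlDr -{1}(subrK y x) le_normcD.
by rewrite ler_norml h andbT lerNl opprB (le_trans (h _ _))// -opprB normcN.
Qed.

Lemma lmean_lip (c c' : 'I_N -> R[i]) d : 0 < d ->
  `|lmean c d - lmean c' d| <=
  (l1norm c + l1norm c') * (\sum_(i < N) normc (c i - c' i)) / d.
Proof.
move=> d0; apply: (mean_dist (mean_lmean c d0) (mean_lmean c' d0)) => T T1.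
apply: avg_dist_le.
- exact: lt_le_trans T1.
- exact: (mean_linteg (mean_lmean c d0)).
- exact: (mean_linteg (mean_lmean c' d0)).
move=> t; rewrite (le_trans (ln_lip d0 (power_ge0 _ _) (power_ge0 _ _)))//.
rewrite ler_wpM2r ?invr_ge0 ?(ltW d0)// /power !nsq_normc subr_sqr normrM mulrC.
have n0 := @normc_ge0 R.
rewrite ler_pM//.
  by rewrite ger0_norm ?addr_ge0// lerD// tsum_bound.
have D : dsum c t - dsum c' t = tsum (index_enum 'I_N) (fun i => c i - c' i) (@freq R N) t.
  by rewrite /dsum /tsum -sumrB; apply: eq_bigr => i _; rewrite mulrBl.
by rewrite (le_trans (normc_dist _ _))// D tsum_bound.
Qed.

Lemma continuous_lmean_dcoef d : 0 < d -> continuous (fun s => lmean (dcoef s) d).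
Proof.
move=> d0 s0.
have cexp (i : 'I_N) : continuous (fun s : R => expR (s * freq i)).
  move=> s; apply: (@continuous_comp _ _ _ (fun s => s * freq i) (@expR R)).
    by apply: cvgMl; exact: cvg_id.
  exact: continuous_expR.
have ncoef s (i : 'I_N) : normc (dcoef s i) = normc (a i.+1) * expR (s * freq i).
  by rewrite Normc.normcM [X in _ * X]normc_nsq nsq_real sqrtr_sqr ger0_norm ?expR_ge0.
pose G s := (l1norm (dcoef s) + l1norm (dcoef s0)) *
  (\sum_(i < N) normc (dcoef s i - dcoef s0 i)) / d.
have GE : G = fun s => (\sum_(i < N) normc (a i.+1) * expR (s * freq i) +
    l1norm (dcoef s0)) *
  (\sum_(i < N) normc (a i.+1) * `|expR (s * freq i) - expR (s0 * freq i)|) / d.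
  apply/funext => s; rewrite /G; congr ((_ + _) * _ / d).
    by apply: eq_bigr => i _; exact: ncoef.
  apply: eq_bigr => i _; rewrite /dcoef -mulrBr -rmorphB/= Normc.normcM.
  by rewrite [X in _ * X = _]normc_nsq nsq_real sqrtr_sqr.
have cG : continuous G.
  rewrite GE => s; apply: cvgMl; apply: cvgM.
    apply: cvgD; last exact: cvg_cst.
    apply: (@continuous_sum R _ (index_enum 'I_N)
      (fun i s => normc (a i.+1) * expR (s * freq i)) _ s).
    by move=> i u; apply: cvgMr; exact: cexp.
  apply: (@continuous_sum R _ (index_enum 'I_N) (fun i s => normc (a i.+1) *
    `|expR (s * freq i) - expR (s0 * freq i)|) _ s) => i u.
  apply: cvgMr; apply: cvg_norm; apply: cvgB; first exact: cexp.
  exact: cvg_cst.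
have G0 : G s0 = 0.
  by rewrite /G big1 ?mulr0 ?mul0r// => i _; rewrite subrr Normc.normc0.
apply/cvgrPdist_le => e e0.
have /cvgrPdist_le/(_ e e0) := cG s0; rewrite G0; apply: filterS => s.
rewrite sub0r normrN => h; rewrite distrC (le_trans (lmean_lip _ _ d0))//.
exact: le_trans (ler_norm _) h.
Qed.

Lemma convex_lmean_dcoef d : 0 < d -> convexR (fun s => lmean (dcoef s) d).
Proof.
move=> d0; apply: convexR_second_diff; first exact: continuous_lmean_dcoef.
by move=> A B; exact: lmean_dcoef_second_diff.
Qed.

Lemma dcoef_neq0 s : (exists i : 'I_N, a i.+1 != 0) -> exists i, dcoef s i != 0.
Proof.
move=> [i ai]; exists i; rewrite mulf_neq0// eq_complex/= negb_and.
by rewrite gt_eqF ?expR_gt0.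
Qed.

(** At the middle point [logmean <= lmean] holds for every [d], so a small [d] has to be chosen only
    for the two end points. *)
Lemma convex_logmean_dcoef : (exists i : 'I_N, a i.+1 != 0) ->
  convexR (fun s => logmean (dcoef s)).
Proof.
move=> an0 x y z /andP[xy yz].
have n0 s := dcoef_neq0 s an0.
have zx : 0 < z - x by rewrite subr_gt0 (lt_trans xy).
apply/ler_addgt0Pr => e0 e00.
pose e := e0 / (z - x).
have ep : 0 < e by rewrite divr_gt0.
have [d1 [d10 h1]] := lmean_near_logmean (n0 x) ep.
have [d2 [d20 h2]] := lmean_near_logmean (n0 z) ep.
pose d := Num.min d1 d2.
have d0 : 0 < d by rewrite lt_min d10.
have {}h1 := h1 d; have {}h2 := h2 d.
have hd1 : 0 < d <= d1 by rewrite d0 ge_min lexx.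
have hd2 : 0 < d <= d2 by rewrite d0 ge_min lexx orbT.
have H : x < y < z by rewrite xy.
have := convex_lmean_dcoef d0 H.
have k1 : (z - y) * lmean (dcoef x) d <= (z - y) * (logmean (dcoef x) + e).
  by rewrite ler_wpM2l ?h1// subr_ge0 ltW.
have k2 : (y - x) * lmean (dcoef z) d <= (y - x) * (logmean (dcoef z) + e).
  by rewrite ler_wpM2l ?h2// subr_ge0 ltW.
have k3 : (z - x) * logmean (dcoef y) <= (z - x) * lmean (dcoef y) d.
  by rewrite ler_wpM2l ?logmean_le_lmean// ltW.
have -> : e0 = e * (z - x) by rewrite /e mulfVK// gt_eqF.
move: k1 k2 k3; move: (lmean _ _) (lmean _ _) (lmean _ _) (logmean _) (logmean _) (logmean _).
by clear => m1 m2 m3 l1 l2 l3 k1 k2 k3 k4; lra.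
Qed.

Lemma ln_normc (w : R[i]) : ln (normc w) = 2^-1 * ln (nsq w).
Proof.
have [w0|w0] := eqVneq (nsq w) 0.
  by rewrite normc_nsq w0 sqrtr0 (ln0 (lexx 0)) mulr0.
have wp : 0 < nsq w by rewrite lt_def w0 nsq_ge0.
have np : 0 < normc w by rewrite normc_nsq sqrtr_gt0.
by rewrite [in RHS]nsq_normc lnXn// -[X in _ * X]mulr_natl mulKf.
Qed.

Lemma dirichlet_sum_dsum s t : dirichlet_sum a N (s +i* t) = dsum (dcoef s) t.
Proof.
rewrite /dirichlet_sum /dsum /tsum big_add1/= big_mkord; apply: eq_bigr => i _.
rewrite /dcoef -mulrA; congr (_ * _).
rewrite /natpowC /freq; simpc => /=.
by rewrite (mulrC t).
Qed.

Lemma jessen_logmean s : (exists i : 'I_N, a i.+1 != 0) ->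
  jessen (dirichlet_sum a N) s = 2^-1 * logmean (dcoef s).
Proof.
move=> an0; have h := meanZ 2^-1 (mean_logmean (dcoef_neq0 s an0)).
have [_ hl] := h; rewrite /jessen.
suff -> : (fun T : R => (2 * T)^-1 * \int[lebesgue_measure]_(t in `[- T, T])
    ln (normc (dirichlet_sum a N (s +i* t)))) =
    avg (fun t => 2^-1 * ln (power (dcoef s) t)) by exact/cvg_lim.
apply/funext => T; rewrite /avg /itg; congr (_ * Rintegral _ _ _); apply/funext => t.
by rewrite /power -ln_normc dirichlet_sum_dsum.
Qed.

End Convexity.

(** * Rotating blocks of primes *)

Section RootsOfUnity.
Context {R : realType}.
Implicit Types (A B x y z : R[i]) (e : R).

(** The roots of unity replace integration over the circle: an average over them is a finite sum of
    means, and a product over them has a closed form. The number [Q] tends to infinity only at the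
    end. *)
Lemma roots_of_unity_prod (Q : nat) : (0 < Q)%N ->
  exists r : seq R[i], [/\ size r = Q, (forall z, z \in r -> nsq z = 1) &
    forall x y, \prod_(z <- r) (x - z * y) = x ^+ Q - y ^+ Q].
Proof.
move=> Q0; have [r] := closed_field_poly_normal ('X^Q - 1 : {poly R[i]}).
rewrite lead_coefDl ?size_polyXn ?size_polyN ?size_poly1// lead_coefXn scale1r => rE.
have sr : size r = Q.
  have := size_XnsubC (1 : R[i]) Q0; rewrite polyC1 rE size_prod_XsubC.
  by case.
have prodE (w : R[i]) : \prod_(z <- r) (w - z) = w ^+ Q - 1.
  have := congr1 (fun p => p.[w]) rE; rewrite !hornerE horner_prod => ->.
  by apply: eq_bigr => z _; rewrite !hornerE.
exists r; split=> // [z zr|x y].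
  have : z ^+ Q = 1.
    apply/eqP; rewrite -subr_eq0 -prodE prodf_seq_eq0; apply/hasP.
    by exists z => //; rewrite subrr/=.
  move/(congr1 (@nsq R)); rewrite nsqX nsq1 => /eqP.
  by rewrite pexpr_eq1 ?nsq_ge0// => /eqP.
have [->|y0] := eqVneq y 0.
  under eq_bigr do rewrite mulr0 subr0.
  by rewrite big_const_seq count_predT sr expr0n eqn0Ngt Q0 subr0 iter_mulr_1.
have -> : \prod_(z <- r) (x - z * y) = \prod_(z <- r) ((x / y - z) * y).
  by apply: eq_bigr => z _; rewrite mulrBl divfK.
rewrite big_split/= prodE big_const_seq count_predT sr iter_mulr_1.
by rewrite mulrBl mul1r expr_div_n divfK// expf_neq0.
Qed.

Lemma nsqD A B : nsq (A + B) = nsq A + nsq B + 2 * Re (A * B^*%C).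
Proof. by case: A => a b; case: B => c d; rewrite /nsq; simpc => /=; ring. Qed.

(* [|A + z B|^2 + e] is written as [|u + z v|^2] with [u > |v|], so that the
   product over the roots of unity [z] becomes [|u^Q - (-v)^Q|^2]. *)
Lemma ln_avg_roots (r : seq R[i]) A B e (Q := size r) :
  (0 < Q)%N -> (forall z, z \in r -> nsq z = 1) ->
  (forall x y, \prod_(z <- r) (x - z * y) = x ^+ Q - y ^+ Q) -> 0 < e ->
  ln (nsq A + nsq B + e) - ln 2 - 2 / Q%:R * ln (2 * (nsq A + nsq B + e) / e) <=
  Q%:R^-1 * \sum_(z <- r) ln (nsq (A + z * B) + e).
Proof.
move=> Q0 r1 rprod e0; set a := nsq A + nsq B + e.
have AB0 := addr_ge0 (nsq_ge0 A) (nsq_ge0 B).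
have a0 : 0 < a by rewrite ltr_wpDl.
have ea : e <= a by rewrite lerDr.
(* [U] and [V] are the roots of [X^2 - a X + |A|^2 |B|^2] and become [|u|^2] and [|v|^2]. The
   regularisation keeps them apart: the discriminant is at least [e^2]. *)
pose disc := a ^+ 2 - 4 * (nsq A * nsq B).
have discE : e ^+ 2 <= disc.
  have -> : disc = (nsq A - nsq B) ^+ 2 + 2 * e * (nsq A + nsq B) + e ^+ 2.
    by rewrite /disc /a; ring.
  by rewrite lerDr addr_ge0 ?sqr_ge0// mulr_ge0// mulr_ge0// ltW.
pose D := Num.sqrt disc.
have D2 : D ^+ 2 = disc by rewrite sqr_sqrtr// (le_trans _ discE)// sqr_ge0.
have eD : e <= D by rewrite /D -[e]gtr0_norm// -sqrtr_sqr ler_wsqrtr.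
have Da : D <= a.
  rewrite /D -[a]gtr0_norm// -sqrtr_sqr ler_wsqrtr// /disc gerBl.
  by rewrite mulr_ge0// mulr_ge0 ?nsq_ge0.
pose U := (a + D) / 2; pose V := (a - D) / 2.
have UV : U * V = nsq A * nsq B.
  have -> : U * V = (a ^+ 2 - D ^+ 2) / 4 by rewrite /U /V; field.
  by rewrite D2 /disc; field.
have U0 : 0 < U by rewrite /U; lra.
have V0 : 0 <= V by rewrite /V; lra.
have Ua : a / 2 <= U by rewrite /U; lra.
pose p := Num.sqrt U; pose q := Num.sqrt V.
have p0 : 0 < p by rewrite sqrtr_gt0.
have q0 : 0 <= q by rewrite sqrtr_ge0.
have p2 : p ^+ 2 = U by rewrite sqr_sqrtr// ltW.
have q2 : q ^+ 2 = V by rewrite sqr_sqrtr.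
pose v := - (A^*%C * B * (p^-1)%:C).
have nv : nsq v = V.
  rewrite /v nsqN !nsqM nsq_real; have -> : nsq A^*%C = nsq A by case: (A) => ? ?; rewrite /nsq/= sqrrN.
  by rewrite -UV exprVn p2 mulrAC divff ?mul1r// gt_eqF.
have key z : nsq z = 1 -> nsq (A + z * B) + e = nsq (p%:C - z * v).
  move=> z1; rewrite !nsqD nsqN !nsqM z1 !mul1r nsq_real p2 nv.
  have -> : p%:C * (- (z * v))^*%C = A * (z * B)^*%C.
    rewrite /v mulrN opprK !conjcM conjc_real conjcK.
    have pp : p%:C * (p^-1)%:C = 1 :> R[i] by rewrite -rmorphM divff ?gt_eqF.
    rewrite -[RHS]mulr1 -pp; ring.
  have -> : U + V = a by rewrite /U /V; lra.
  by rewrite /a; ring.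
have pos z : z \in r -> 0 < nsq (p%:C - z * v).
  by move=> /r1/key <-; rewrite ltr_wpDl ?nsq_ge0.
have sumE : \sum_(z <- r) ln (nsq (A + z * B) + e) = ln (nsq (p%:C ^+ Q - v ^+ Q)).
  rewrite -rprod nsq_prod.
  rewrite (eq_big_seq (fun z => ln (nsq (p%:C - z * v)))); last first.
    by move=> z /r1/key ->.
  elim: (r) pos => [|z s IH] pos; first by rewrite !big_nil ln1.
  have zs w : w \in s -> 0 < nsq (p%:C - w * v) by move=> ws; apply: pos; rewrite inE ws orbT.
  rewrite !big_cons IH// lnM ?posrE ?pos ?mem_head//.
  by rewrite big_seq; apply: prodr_gt0 => w /zs.
have QR : 0 < Q%:R :> R by rewrite ltr0n.
have qp : q < p by rewrite -(ltr_pXn2r (n := 2)) ?nnegrE ?(ltW p0)// p2 q2 /U /V; lra.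
(* [p^Q - q^Q >= p^(Q-1) (p - q)], and [p - q = D / (p + q)] with [D >= e] and
   [p (p + q) <= 2 a]. *)
have low : p ^+ Q * (e / (2 * a)) <= normc (p%:C ^+ Q - v ^+ Q).
  apply: le_trans (normc_dist _ _).
  have nX w : normc (w ^+ Q) = normc w ^+ Q.
    by elim: (Q) => [|k IH]; rewrite ?expr0 ?Normc.normc1// !exprS Normc.normcM IH.
  rewrite !nX [normc v]normc_nsq nv normc_nsq nsq_real sqrtr_sqr (gtr0_norm p0) -/q.
  apply: le_trans (ler_norm _).
  case: (Q) Q0 => // k _.
  apply: (@le_trans _ _ (p ^+ k * (p - q))); last first.
    rewrite mulrBr -exprSr lerD2l lerN2 exprS mulrC ler_wpM2r//.
    by rewrite lerXn2r ?nnegrE ?(ltW p0) ?(ltW qp).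
  rewrite exprSr -mulrA ler_wpM2l ?exprn_ge0 ?(ltW p0)//.
  have pq : 0 < p + q by rewrite ltr_wpDr.
  have -> : p - q = D / (p + q).
    by apply: (canRL (mulfK _)); [rewrite gt_eqF|rewrite -subr_sqr p2 q2 /U /V; lra].
  rewrite mulrA ler_pdivrMr ?mulr_gt0// mulrAC ler_pdivlMr//.
  have h1 : p * (p + q) <= 2 * a.
    have : p * (p + q) <= p * (p + p) by rewrite ler_wpM2l ?lerD2l ?(ltW p0) ?(ltW qp).
    have : p * (p + p) = 2 * U by rewrite -p2; ring.
    by rewrite /U => ? ?; lra.
  have -> : p * e * (p + q) = e * (p * (p + q)) by ring.
  apply: (@le_trans _ _ (e * (2 * a))); first by rewrite ler_wpM2l ?(ltW e0).
  by apply: ler_wpM2r eD; apply: mulr_ge0 => //; exact: ltW.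
rewrite sumE [leRHS]mulrC ler_pdivlMr//.
have lowp : 0 < p ^+ Q * (e / (2 * a)).
  by rewrite mulr_gt0 ?exprn_gt0// divr_gt0 ?mulr_gt0.
have : 2 * ln (p ^+ Q * (e / (2 * a))) <= ln (nsq (p%:C ^+ Q - v ^+ Q)).
  rewrite mulr_natl -lnXn// nsq_normc ler_ln ?posrE ?exprn_gt0//.
    by rewrite lerXn2r ?nnegrE ?normc_ge0 ?(ltW lowp).
  exact: lt_le_trans low.
apply: le_trans.
have ea0 : 0 < e / (2 * a) by rewrite divr_gt0 ?mulr_gt0.
rewrite [ln (p ^+ Q * _)]lnM ?posrE ?exprn_gt0// (lnXn _ p0).
have -> : ln (e / (2 * a)) = - ln (2 * a / e).
  by rewrite -lnV ?posrE ?divr_gt0 ?mulr_gt0// invf_div.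
have lp : ln a - ln 2 <= 2 * ln p.
  rewrite mulr_natl -lnXn// p2 -ln_div ?posrE// ler_ln ?posrE//.
  exact: divr_gt0.
rewrite -[ln p *+ Q]mulr_natr.
have -> : (ln a - ln 2 - 2 / Q%:R * ln (2 * a / e)) * Q%:R =
  (ln a - ln 2) * Q%:R - 2 * ln (2 * a / e) by field; rewrite gt_eqF.
have : (ln a - ln 2) * Q%:R <= 2 * ln p * Q%:R by rewrite ler_wpM2r// ltW.
by move=> ?; lra.
Qed.

Fixpoint nested_avg (r : seq R[i]) (Bs : seq R[i]) A e : R :=
  if Bs is B :: Bs' then
    (size r)%:R^-1 * \sum_(z <- r) nested_avg r Bs' (A + z * B) e
  else ln (nsq A + e).

(** The blocks are peeled off one at a time. The squares of the remaining blocks are already inside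
    the logarithm, where they act as a larger regularisation [s + e] for [ln_avg_roots]. Each block
    costs [ln 2] and an error that vanishes as [Q] grows. *)
Lemma nested_avg_ge (r Bs : seq R[i]) A e (S : R) (Q := size r) :
  (0 < Q)%N -> (forall z, z \in r -> nsq z = 1) ->
  (forall x y, \prod_(z <- r) (x - z * y) = x ^+ Q - y ^+ Q) -> 0 < e ->
  normc A + \sum_(B <- Bs) normc B <= S ->
  ln (nsq A + \sum_(B <- Bs) nsq B + e) -
    (size Bs)%:R * (ln 2 + 2 / Q%:R * ln (2 * (S ^+ 2 + e) / e)) <=
  nested_avg r Bs A e.
Proof.
move=> Q0 r1 rprod e0.
have QR : 0 < Q%:R :> R by rewrite ltr0n.
set kap := ln 2 + _.
elim: Bs A => [|B Bs IH] A; first by move=> _; rewrite !big_nil/= mul0r subr0 addr0.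
rewrite !big_cons/= => AS.
pose s := \sum_(B <- Bs) nsq B.
have s0 : 0 <= s by apply: sumr_ge0 => *; exact: nsq_ge0.
have se0 : 0 < s + e by rewrite ltr_wpDl.
have := @ln_avg_roots r A B (s + e) Q0 r1 rprod se0.
set a := nsq A + nsq B + (s + e).
have aE : nsq A + (nsq B + s) + e = a by rewrite /a; ring.
rewrite aE => L.
have sums (t : seq R[i]) : \sum_(B <- t) nsq B <= (\sum_(B <- t) normc B) ^+ 2 /\
     0 <= \sum_(B <- t) normc B.
  have n0 := @normc_ge0 R; elim: t => [|b t [h1 h2]]; first by rewrite !big_nil expr0n.
  rewrite !big_cons; split; last by rewrite addr_ge0.
  apply: (@le_trans _ _ (nsq b + (\sum_(B <- t) normc B) ^+ 2)).
    by rewrite lerD2l.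
  rewrite nsq_normc; move: (mulr_ge0 (n0 b) h2).
  by move: (normc b) (\sum_(B <- t) _); clear => x y h; lra.
have aS : a <= S ^+ 2 + e.
  have [h1 h2] := sums [:: A, B & Bs]; rewrite !big_cons in h1 h2.
  rewrite /a -/s in h1 *; rewrite [X in X <= _](_ : _ = nsq A + (nsq B + s) + e); last by ring.
  rewrite lerD2r (le_trans h1)// lerXn2r ?nnegrE//; exact: le_trans AS.
have a0 : 0 < a by rewrite /a (ltr_wpDl (addr_ge0 (nsq_ge0 _) (nsq_ge0 _))).
have lnle : ln (2 * a / (s + e)) <= ln (2 * (S ^+ 2 + e) / e).
  rewrite ler_ln ?posrE ?divr_gt0 ?mulr_gt0//; last by rewrite ltr_wpDl ?sqr_ge0.
  rewrite -!mulrA ler_pM2l// ler_pM ?invr_ge0 ?(ltW a0) ?(ltW se0)//.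
  by rewrite lef_pV2 ?posrE// lerDr.
have step : Q%:R^-1 * \sum_(z <- r) (ln (nsq (A + z * B) + (s + e)) - (size Bs)%:R * kap) <=
    Q%:R^-1 * \sum_(z <- r) nested_avg r Bs (A + z * B) e.
  rewrite ler_wpM2l ?invr_ge0 ?(ltW QR)// big_seq [leRHS]big_seq; apply: ler_sum => z zr.
  rewrite addrA; apply: IH; apply: le_trans AS; rewrite addrA lerD2r.
  rewrite (le_trans (le_normcD _ _))// lerD2l Normc.normcM.
  by rewrite [X in X * _]normc_nsq r1// sqrtr1 mul1r.
apply: le_trans step.
have -> : Q%:R^-1 * \sum_(z <- r) (ln (nsq (A + z * B) + (s + e)) - (size Bs)%:R * kap) =
    Q%:R^-1 * \sum_(z <- r) ln (nsq (A + z * B) + (s + e)) - (size Bs)%:R * kap.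
  rewrite big_split/= big_const_seq count_predT iter_addr_0 mulrDr; congr (_ + _).
  by rewrite -[_ *+ size r]mulr_natl -/Q mulKf ?gt_eqF.
rewrite -natr1 [(_ + 1) * kap]mulrDl mul1r.
have : 2 / Q%:R * ln (2 * a / (s + e)) <= 2 / Q%:R * ln (2 * (S ^+ 2 + e) / e).
  by rewrite ler_wpM2l// divr_ge0// ltW.
move: L; rewrite -/kap; set X := Q%:R^-1 * _.
have -> : 2 / Q%:R * ln (2 * (S ^+ 2 + e) / e) = kap - ln 2 by rewrite /kap; ring.
rewrite -/Q; clearbody kap X.
move: (2 / Q%:R * _) ((size Bs)%:R * kap) (ln a) (ln 2) => w v la l2.
by clear; lra.
Qed.

End RootsOfUnity.

(** * Independent rotation of blocks *)

Section Blocks.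
Context {R : realType}.
Implicit Types (d : R).

Lemma mean_sum_in (I : eqType) (s : seq I) (F : I -> R -> R) (L : I -> R) :
  (forall i, i \in s -> mean (F i) (L i)) ->
  mean (fun t => \sum_(i <- s) F i t) (\sum_(i <- s) L i).
Proof.
move=> hF; elim: s hF => [|i s IH] hF.
  rewrite big_nil; under [X in mean X]funext do rewrite big_nil.
  exact: mean_cst.
rewrite big_cons; under [X in mean X]funext do rewrite big_cons.
apply: meanD; first by apply: hF; rewrite mem_head.
by apply: IH => j js; apply: hF; rewrite inE js orbT.
Qed.

(** Every choice of rotations gives the same mean [m], hence so does their average. *)
Lemma mean_nested_avg (r : seq R[i]) (A : R -> R[i]) (Bs : seq (R -> R[i])) d m :
  (0 < size r)%N -> (forall z, z \in r -> nsq z = 1) ->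
  (forall zs : seq R[i], size zs = size Bs -> (forall z, z \in zs -> nsq z = 1) ->
     mean (fun t => ln (nsq (A t + \sum_(j < size Bs) zs`_j * (nth (fun=> 0) Bs j) t) + d)) m) ->
  mean (fun t => nested_avg r [seq B t | B <- Bs] (A t) d) m.
Proof.
move=> r0 r1; elim: Bs A => [|B Bs IH] A H /=.
  have := H [::] erefl (fun _ => ltac:(by [])).
  by under [X in mean X _ -> _]funext do rewrite big_ord0 addr0.
have -> : m = (size r)%:R^-1 * \sum_(z <- r) m.
  rewrite big_const_seq count_predT iter_addr_0 -(mulr_natl m) mulKf//.
  by rewrite pnatr_eq0 -lt0n.
apply: meanZ; apply: mean_sum_in => z zr.
apply: (IH (fun t => A t + z * B t)) => zs szs zs1.
have := H (z :: zs); rewrite /= szs => /(_ erefl) h.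
have {}h := h _.
have : forall z0, z0 \in z :: zs -> nsq z0 = 1.
  by move=> w; rewrite inE => /predU1P[->|/zs1//]; exact: r1.
move=> /h; congr mean; apply/funext => t.
by rewrite big_ord_recl/= addrA.
Qed.

Variables (N K : nat) (lab : 'I_N -> 'I_K.+1).

(** The label [ord0] collects all indices that are not to be rotated. *)
Definition block (c : 'I_N -> R[i]) (j : 'I_K.+1) (t : R) : R[i] :=
  \sum_(i < N | lab i == j) c i * cis (freq i * t).

Lemma dsum_blocks (c : 'I_N -> R[i]) t : dsum c t = \sum_(j < K.+1) block c j t.
Proof. by rewrite /dsum /tsum (partition_big lab xpredT). Qed.

Lemma normc_block_le (c : 'I_N -> R[i]) j t : normc (block c j t) <= l1norm c.
Proof.
have h : normc (block c j t) <= \sum_(i < N | lab i == j) normc (c i).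
  rewrite /block -big_filter -[leRHS]big_filter.
  rewrite (le_trans (normc_sum _ _))//; apply: ler_sum => i _.
  by rewrite Normc.normcM normc_cis mulr1.
rewrite (le_trans h)// /l1norm [leRHS](bigID (fun i => lab i == j))/= lerDl.
by apply: sumr_ge0 => i _; exact: normc_ge0.
Qed.

Hypothesis lab_prime : forall i, lab i != ord0 -> prime i.+1 /\ (N < 2 * i.+1)%N.

(** Completely multiplicative by construction, since [logn] is additive on products: a labelled
    prime is sent to the rotation of its block, every other prime to [1]. *)
Definition block_phase (z : 'I_K.+1 -> R[i]) (n : nat) : R[i] :=
  \prod_(i < N | lab i != ord0) z (lab i) ^+ logn i.+1 n.

Lemma block_phase_compatible z : (forall j, nsq (z j) = 1) ->
  compatible_phase (fun i : 'I_N => block_phase z i.+1) (@freq R N).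
Proof.
move=> z1; apply: multiplicative_phase.
- by rewrite /block_phase big1// => i _; rewrite logn1 expr0.
- move=> m n m0 n0; rewrite /block_phase -big_split/=; apply: eq_bigr => i _.
  by rewrite lognM// exprD.
- move=> n _; rewrite /block_phase -big_filter nsq_prod big1// => i _.
  by rewrite nsqX z1 expr1n.
Qed.

Lemma block_phaseE z (k : 'I_N) : z ord0 = 1 -> block_phase z k.+1 = z (lab k).
Proof.
move=> z0.
have lg (i : 'I_N) : lab i != ord0 -> logn i.+1 k.+1 = (i == k).
  move=> li; have [ip iN] := lab_prime li.
  have [<-|ik] := eqVneq i k; first by rewrite logn_prime// eqxx.
  apply/eqP; rewrite -leqn0 leqNgt logn_gt0 mem_primes ip/=; apply/negP => /dvdnP[q qE].
  have kN := ltn_ord k; case: q qE => [//|[|q]] qE.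
    by move: ik; rewrite mul1n in qE; case: qE => /val_inj ->; rewrite eqxx.
  have : (2 * i.+1 <= k.+1)%N by rewrite qE leq_mul2r orbT.
  by move: kN iN; clear; lia.
have [lk|lk] := eqVneq (lab k) ord0.
  rewrite lk z0 /block_phase big1// => i li; rewrite lg//.
  case: eqVneq => // ik; by rewrite ik lk eqxx in li.
rewrite /block_phase (bigD1 k)//= lg// eqxx expr1 big1 ?mulr1// => i /andP[li ik].
by rewrite lg// (negbTE ik).
Qed.

(* The only multiple of a labelled prime up to [N] is the prime itself, so that
   rotating the blocks independently is a completely multiplicative phase and
   does not change [lmean]. *)
Lemma lmean_blocks (c : 'I_N -> R[i]) d (g : R -> R) (l : R) : 0 < d -> mean g l ->
  (forall t, g t <= ln (\sum_(j < K) nsq (block c (lift ord0 j) t) + d)) ->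
  l - K%:R * ln 2 <= lmean c d.
Proof.
move=> d0 gl gle.
pose Bs := [seq (fun t => block c (lift ord0 j) t) | j <- enum 'I_K].
have sBs : size Bs = K by rewrite size_map size_enum_ord.
have sumBs (F : R[i] -> R) t :
    \sum_(B <- [seq B t | B <- Bs]) F B = \sum_(j < K) F (block c (lift ord0 j) t).
  by rewrite /Bs big_map big_map big_enum.
pose S := (K.+1%:R : R) * l1norm c.
pose W := ln (2 * (S ^+ 2 + d) / d).
have step Q : (0 < Q)%N -> l - K%:R * (ln 2 + 2 / Q%:R * W) <= lmean c d.
  move=> Q0; have [r [sr r1 rprod]] := @roots_of_unity_prod R Q Q0.
  have m : mean (fun t => nested_avg r [seq B t | B <- Bs] (block c ord0 t) d) (lmean c d).
    apply: mean_nested_avg => //; first by rewrite sr.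
    rewrite sBs => zs szs zs1.
    pose z (j : 'I_K.+1) : R[i] := (1 :: zs)`_j.
    have z1 j : nsq (z j) = 1.
      rewrite /z; case: j => -[|j] jK /=; first exact: nsq1.
      by apply/zs1/mem_nth; rewrite szs.
    have := mean_lmean (fun i => c i * block_phase z i.+1) d0.
    rewrite (lmean_phase _ (block_phase_compatible z1) d0).
    congr mean; apply/funext => t; congr (ln (nsq _ + d)).
    rewrite -/(dsum _ t) dsum_blocks big_ord_recl; congr (_ + _).
      rewrite /block; apply: eq_bigr => i /eqP li.
      by rewrite block_phaseE// li mulr1.
    apply: eq_bigr => j _; rewrite (nth_map j) ?size_enum_ord// nth_ord_enum.
    rewrite /block mulr_sumr; apply: eq_bigr => i /eqP li.
    by rewrite block_phaseE// li /z lift0/= mulrCA mulrA.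
  have lb := meanB gl (mean_cst (K%:R * (ln 2 + 2 / Q%:R * W))).
  apply: (le_mean lb m) => t.
  have sr0 : (0 < size r)%N by rewrite sr.
  have rp x y : \prod_(z <- r) (x - z * y) = x ^+ size r - y ^+ size r by rewrite sr.
  have := @nested_avg_ge R r [seq B t | B <- Bs] (block c ord0 t) d S sr0 r1 rp d0.
  rewrite sr size_map sBs => H.
  apply: le_trans (H _); last first.
    rewrite sumBs /S mulr_natl mulrS lerD ?normc_block_le//.
    rewrite -[X in _ <= _ *+ X](card_ord K) -sumr_const; apply: ler_sum => j _.
    exact: normc_block_le.
  rewrite sumBs -/W lerD2r (le_trans (gle t))//.
  have p0 : 0 <= \sum_(j < K) nsq (block c (lift ord0 j) t).
    by apply: sumr_ge0 => j _; exact: nsq_ge0.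
  have n0 := nsq_ge0 (block c ord0 t).
  rewrite ler_ln ?posrE; [by rewrite lerD2r lerDr|exact: ltr_wpDl|].
  by apply: ltr_wpDl => //; exact: addr_ge0.
apply/ler_addgt0Pr => e e0.
have W0 : 0 <= `|W| * (2 * K%:R) / e by rewrite divr_ge0 ?mulr_ge0 ?(ltW e0).
(* Here [Q] is taken large enough for the errors of the root averages to sum to at most [e]; the
   loss [ln 2] per block remains. *)
pose Q := (Num.truncn (`|W| * (2 * K%:R) / e)).+1.
have /andP[_ hQ] := truncn_itv W0.
have QR : 0 < Q%:R :> R by rewrite ltr0n.
have := step Q isT.
suff : K%:R * (2 / Q%:R * W) <= e by move=> ? ?; lra.
have -> : K%:R * (2 / Q%:R * W) = W * (2 * K%:R) / Q%:R by ring.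
rewrite ler_pdivrMr// (@le_trans _ _ (`|W| * (2 * K%:R)))//.
  by rewrite ler_wpM2r ?mulr_ge0// ler_norm.
by rewrite [leRHS]mulrC -ler_pdivrMr// ltW.
Qed.

End Blocks.

(** * Concentration of the sum of the squared block sums *)

Section Concentration.
Context {R : realType}.
Variables (N K s : nat) (lab : 'I_N -> 'I_K.+2) (c : 'I_N -> R[i]).
Hypothesis lab_prime : forall i, lab i != ord0 -> prime i.+1 /\ (N < 2 * i.+1)%N.
Hypothesis c1 : forall i, lab i != ord0 -> nsq (c i) = 1.
Hypothesis s0 : (0 < s)%N.

Definition inner (j : 'I_K.+2) : bool := (j != ord0) && (j != ord_max).

(* Blocks [1 .. K] have [s] elements, block [K + 1] has one: its constant square
   keeps the logarithm nonnegative. *)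
Hypothesis lab_card : forall j, inner j -> (\sum_(i < N | lab i == j) 1 = s)%N.
Hypothesis lab_single : exists i0, forall i, (lab i == ord_max) = (i == i0).

Definition offdiag_cond (p : 'I_N * 'I_N) : bool :=
  [&& inner (lab p.1), lab p.2 == lab p.1 & p.2 != p.1].

Definition pairs : seq ('I_N * 'I_N) :=
  [seq p <- index_enum ('I_N * 'I_N)%type | offdiag_cond p].

(** The off-diagonal part of the sum of [|A_j|^2] over the inner blocks. It is again a trigonometric
    sum, with logarithms of quotients of two primes as frequencies. *)
Definition offdiag (t : R) : R[i] :=
  tsum pairs (fun p => c p.1 * (c p.2)^*%C) (fun p => freq p.1 - freq p.2) t.

Lemma mem_pairs p : (p \in pairs) = offdiag_cond p.
Proof. by rewrite mem_filter mem_index_enum andbT. Qed.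

(** By unique factorisation, a quotient of two distinct primes determines both. *)
Lemma freq_diff_inj : {in pairs &, injective (fun p : 'I_N * 'I_N => @freq R N p.1 - freq p.2)}.
Proof.
move=> [i i'] [k k']; rewrite !mem_pairs/=.
move=> /and3P[/andP[/= li _] /eqP/= li' /= ii'] /and3P[/andP[/= lk _] /eqP/= lk' /= kk'] /eqP.
have [pi _] := lab_prime li; have [pk _] := lab_prime lk.
have [pi' _] : prime i'.+1 /\ (N < 2 * i'.+1)%N by apply: lab_prime; rewrite li'.
have [pk' _] : prime k'.+1 /\ (N < 2 * k'.+1)%N by apply: lab_prime; rewrite lk'.
have -> : (@freq R N i - freq i' == freq k - freq k') =
    (ln ((i.+1 * k'.+1)%N%:R : R) == ln ((k.+1 * i'.+1)%N%:R : R)).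
  rewrite !natrM !lnM ?posrE ?ltr0n// /freq.
  by rewrite !opprK -subr_eq0 -[RHS]subr_eq0 -oppr_eq0; congr (_ == 0); ring.
move=> /eqP/ln_inj; rewrite !posrE !ltr0n => /(_ isT isT)/eqP; rewrite eqr_nat => /eqP E.
have : (i.+1 %| k.+1 * i'.+1)%N by rewrite -E dvdn_mulr.
rewrite Euclid_dvdM// !dvdn_prime2// !eqSS => /orP[/eqP/val_inj ik|/eqP/val_inj ii]; last first.
  by rewrite ii eqxx in ii'.
rewrite ik in E *; congr pair; apply/val_inj; apply/eqP => /=.
by rewrite -eqSS eq_sym -(eqn_pmul2l (m := k.+1))// E.
Qed.

Lemma sum_inner (V : nmodType) (F : 'I_N -> V) :
  \sum_(j | inner j) \sum_(i < N | lab i == j) F i = \sum_(i < N | inner (lab i)) F i.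
Proof.
rewrite [RHS](partition_big lab inner)//; apply: eq_bigr => j ij.
by apply: eq_bigl => i; case: eqP => [->|]; rewrite ?ij ?andbF.
Qed.

Lemma sum_lift (V : nmodType) (F : 'I_K.+2 -> V) :
  \sum_(j < K.+1) F (lift ord0 j) = \sum_(j | inner j) F j + F ord_max.
Proof.
have lm : lift ord0 (ord_max : 'I_K.+1) = ord_max by exact/val_inj.
have -> : \sum_(j | inner j) F j = \sum_(j < K) F (lift ord0 (widen_ord (leqnSn K) j)).
  have i0 : inner ord0 = false by [].
  have i1 : inner ord_max = false by rewrite /inner eqxx andbF.
  pose G j := if inner j then F j else 0.
  have {i0} i0 : G ord0 = 0 by rewrite /G i0.
  have {i1} i1 : G ord_max = 0 by rewrite /G i1.
  have -> : \sum_(j | inner j) F j = \sum_j G j by exact: big_mkcond.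
  rewrite big_ord_recl/= i0 add0r big_ord_recr/= lm i1 addr0 /G.
  apply: eq_bigr => j _; rewrite ifT// /inner; apply/andP; split=> //.
  by apply/eqP => /(congr1 val)/= []; rewrite add0n => E; have := ltn_ord j; rewrite E ltnn.
by rewrite big_ord_recr/= lm.
Qed.

Lemma card_inner : (\sum_(j : 'I_K.+2 | inner j) 1 = K)%N.
Proof.
apply: (@addIn 1); rewrite -[LHS](sum_lift (fun=> 1%N)).
by rewrite sum_nat_const card_ord muln1 addn1.
Qed.

Lemma count_inner : (\sum_(i < N | inner (lab i)) 1 = K * s)%N.
Proof.
rewrite -[LHS]sum_inner (eq_bigr (fun=> (1 * s)%N)); last by move=> j /lab_card ->; rewrite mul1n.
change ((\sum_(j | inner j) 1 * s)%N = (K * s)%N).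
by rewrite -big_distrl/= card_inner.
Qed.

Lemma size_pairs : (size pairs <= K * s ^ 2)%N.
Proof.
rewrite -sum1_size /pairs big_filter.
rewrite -(pair_big_dep (fun i => inner (lab i)) (fun i i' => (lab i' == lab i) && (i' != i)) (fun _ _ => 1%N))/=.
rewrite expnS expn1 mulnA -count_inner big_distrl/=; apply: leq_sum => i ii.
rewrite mul1n -(lab_card ii) [leqRHS](bigD1 i)//= leq_addl//.
Qed.

(** The frequencies are distinct and the coefficients unimodular, so the second moment counts the
    pairs inside blocks. There are at most [K s^2] of them, a factor [K] below the square of the
    diagonal [K s]; this gain is what the splitting into blocks is for. *)
Lemma mean_offdiag : exists2 m, mean (fun t => nsq (offdiag t)) m & m <= (K * s ^ 2)%:R.
Proof.
have h := mean_nsq_tsum pairs (fun p => c p.1 * (c p.2)^*%C) (fun p => @freq R N p.1 - freq p.2).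
eexists; first exact: h.
apply: (@le_trans _ _ (size pairs)%:R); last by rewrite ler_nat size_pairs.
rewrite -sum1_size natr_sum big_seq [leRHS]big_seq; apply: ler_sum => p pp.
have up : uniq pairs by rewrite filter_uniq// index_enum_uniq.
rewrite (bigD1_seq p)//= eqxx big_seq_cond big1 ?addr0.
  move: pp; rewrite mem_pairs => /and3P[/andP[l0 _] /eqP l2 _].
  rewrite nsq_conj/= nsqM c1//; have -> : nsq (c p.2)^*%C = nsq (c p.2).
    by case: (c p.2) => x y; rewrite /nsq/= sqrrN.
  by rewrite c1 ?l2// mulr1.
move=> q /andP[qp' qp]; case: eqP => // /(freq_diff_inj pp qp') pq.
by rewrite pq eqxx in qp.
Qed.

Lemma blocks_offdiag t :
  \sum_(j | inner j) nsq (block lab c j t) = (K * s)%:R + Re (offdiag t).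
Proof.
pose w i := c i * cis (@freq R N i * t).
have w1 i : inner (lab i) -> nsq (w i) = 1.
  by move=> /andP[li _]; rewrite nsqM c1// nsq_cis mul1r.
have E j : inner j -> nsq (block lab c j t) = \sum_(i < N | lab i == j)
   (1 + \sum_(i' < N | (lab i' == lab i) && (i' != i)) Re (w i * (w i')^*%C)).
  move=> ij; rewrite /block -big_filter nsq_sum big_filter.
  apply: eq_bigr => i /eqP li; rewrite big_filter (bigD1 i) ?li//= -/(w i) nsq_conj/=.
  by rewrite w1 ?li.
rewrite (eq_bigr _ E) sum_inner big_split/=; congr (_ + _).
  by rewrite -count_inner natr_sum.
rewrite /offdiag /tsum Re_sum /pairs big_filter.
rewrite (pair_big_dep (fun i => inner (lab i)) (fun i i' => (lab i' == lab i) && (i' != i))).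
apply: eq_bigr => p _; congr Re; rewrite /w conjcM conj_cis mulrBl cisD.
by rewrite mulrACA.
Qed.

(** Chebyshev's inequality: the sum of squares is at least half its diagonal [X = K s] outside a set
    of density [4 / K], and on that set the block with one element keeps the logarithm nonnegative.
    All [K + 1] rotated blocks cost [ln 2]. *)
Lemma lmean_lower d : (4 <= K)%N -> 0 < d ->
  (1 - 4 / K%:R) * ln ((K * s)%:R / 2) - (K.+1)%:R * ln 2 <= lmean c d.
Proof.
move=> K4 d0; set X : R := (K * s)%:R.
have K0 : (0 < K)%N by apply: leq_trans K4.
have KR : 0 < K%:R :> R by rewrite ltr0n.
have X0 : 0 < X by rewrite ltr0n muln_gt0 K0.
have [m mO mK] := mean_offdiag.
have blE t : \sum_(j < K.+1) nsq (block lab c (lift ord0 j) t) + d =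
    \sum_(j | inner j) nsq (block lab c j t) + 1 + d.
  rewrite (sum_lift (fun j => nsq (block lab c j t))); congr (_ + _ + _).
  have [i0 hi0] := lab_single.
  rewrite /block (big_pred1 i0)// nsqM nsq_cis mulr1 c1//.
  by have := hi0 i0; rewrite eqxx => /eqP ->.
have x0 t : 0 <= \sum_(j | inner j) nsq (block lab c j t).
  by apply: sumr_ge0 => j _; exact: nsq_ge0.
have K41 : 0 <= 1 - 4 / K%:R :> R.
  by rewrite subr_ge0 ler_pdivrMr// mul1r ler_nat.
(* If [X <= 2] the zero function is a sufficient minorant. *)
have [L0|L0] := leP (ln (X / 2)) 0.
  have := @lmean_blocks R N K.+1 lab lab_prime c d (fun=> 0) 0 d0 (mean_cst 0).
  move=> H; apply: le_trans (H _); first by rewrite lerD2r mulr_ge0_le0.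
  by move=> t; rewrite blE ln_ge0//; have := x0 t; lra.
set L := ln (X / 2) in L0 *.
(* A continuous minorant in place of an indicator: it never exceeds [L], and it is at most [0] where
   the off-diagonal part reaches [X / 2] in modulus. *)
pose g t := L - 4 / X ^+ 2 * L * nsq (offdiag t).
have mg : mean g (L - 4 / X ^+ 2 * L * m).
  by apply: meanB (mean_cst _) _; exact: meanZ.
have := @lmean_blocks R N K.+1 lab lab_prime c d g _ d0 mg.
have cX : 0 <= 4 / X ^+ 2 by rewrite divr_ge0 ?sqr_ge0.
move=> H; apply: le_trans (H _).
  rewrite lerD2r mulrBl mul1r lerD2l lerN2.
  apply: (@le_trans _ _ (4 / X ^+ 2 * L * (K * s ^ 2)%:R)).
    by rewrite ler_wpM2l// mulr_ge0// ltW.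
  apply: eq_ler.
  have sR : 0 < s%:R :> R by rewrite ltr0n.
  rewrite /X !natrM expr2; move: (K%:R) (s%:R) KR sR => k u k0 u0.
  by field; rewrite !gt_eqF.
move=> t; rewrite blE /g.
have := x0 t; rewrite blocks_offdiag -/X; set y := Re _ => xy.
have yO : y ^+ 2 <= nsq (offdiag t) by rewrite /nsq lerDl sqr_ge0.
have [yX|yX] := leP (- (X / 2)) y.
  apply: (@le_trans _ _ L); first by rewrite gerBl mulr_ge0 ?nsq_ge0// mulr_ge0// ltW.
  rewrite /L ler_ln ?posrE; [lra|by rewrite divr_gt0|lra].
apply: (@le_trans _ _ 0); last by rewrite ln_ge0//; lra.
rewrite subr_le0 mulrAC ler_peMl ?(ltW L0)//.
have : X ^+ 2 / 4 <= nsq (offdiag t).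
  apply: le_trans yO; have : 0 <= (- y - X / 2) * (- y + X / 2) by rewrite mulr_ge0//; lra.
  by move=> ?; lra.
move=> h; apply: (@le_trans _ _ (4 / X ^+ 2 * (X ^+ 2 / 4))); last by rewrite ler_wpM2l.
by rewrite mulrA divfK ?mulfV ?pnatr_eq0// expf_neq0// gt_eqF.
Qed.

End Concentration.

(** * Primes between n and 2n *)

Section PrimesInDyadicInterval.
Local Open Scope nat_scope.

Lemma central_bin_step n : n.+1 * 'C(n.+1.*2, n.+1) = 2 * (n.*2.+1 * 'C(n.*2, n)).
Proof.
have h : n.*2.+1 * 'C(n.*2, n) = n.+1 * 'C(n.*2.+1, n.+1) := mul_bin_diag n.*2.+1 n.
rewrite h doubleS binS.
have -> : 'C(n.*2.+1, n) = 'C(n.*2.+1, n.+1).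
  rewrite -[LHS]bin_sub; last by rewrite -addnn; lia.
  by congr 'C(_, _); rewrite -addnn; lia.
by lia.
Qed.

Lemma central_bin_ge n : 0 < n -> 4 ^ n <= n.*2 * 'C(n.*2, n).
Proof.
case: n => // n _; elim: n => [//|n IH].
have h := central_bin_step n.+1.
have -> : n.+2.*2 * 'C(n.+2.*2, n.+2) = 2 * (n.+2 * 'C(n.+2.*2, n.+2)) by rewrite -mul2n mulnA.
rewrite h expnS.
have : 4 * 4 ^ n.+1 <= 4 * (n.+1.*2 * 'C(n.+1.*2, n.+1)) by rewrite leq_mul2l IH orbT.
move/leq_trans; apply.
have -> : 2 * (2 * (n.+1.*2.+1 * 'C(n.+1.*2, n.+1))) = 4 * (n.+1.*2.+1 * 'C(n.+1.*2, n.+1)).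
  by lia.
by rewrite leq_mul2l/= leq_mul2r leqnSn orbT.
Qed.

Lemma odd_bin_le k : 'C(k.*2.+1, k) <= 4 ^ k.
Proof.
rewrite -(@leq_pmul2l 2)//.
have -> : 2 * 4 ^ k = \sum_(i < k.*2.+2) 'C(k.*2.+1, i).
  have := expnDn 1 1 k.*2.+1; rewrite expnS -mul2n expnM => ->.
  by apply: eq_bigr => i _; rewrite !exp1n !muln1.
have E : 'C(k.*2.+1, k.+1) = 'C(k.*2.+1, k).
  rewrite -[LHS]bin_sub; last by rewrite -addnn; lia.
  by congr 'C(_, _); rewrite -addnn; lia.
have k1 : k < k.*2.+2 by rewrite -addnn; lia.
have k2 : k.+1 < k.*2.+2 by rewrite -addnn; lia.
rewrite (bigD1 (Ordinal k1))//= (bigD1 (Ordinal k2))/=; last first.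
  by rewrite -val_eqE/= gtn_eqF.
by rewrite E addnA mul2n -[leqLHS]addnn leq_addr.
Qed.

Definition primorial m := \prod_(0 <= p < m.+1 | prime p) p.

Lemma prime_dvd_fact p n : prime p -> p %| n`! -> p <= n.
Proof.
move=> pp; elim: n => [|n IH]; first by rewrite dvdn1 => /eqP p1; rewrite p1 in pp.
rewrite factS Euclid_dvdM// => /orP[/dvdn_leq -> //|/IH pn]; exact: leqW.
Qed.

Lemma prod_primes_dvd (s : seq nat) m : uniq s -> {in s, forall p, prime p} ->
  {in s, forall p, p %| m} -> \prod_(p <- s) p %| m.
Proof.
elim: s => [|p s IH] /=; first by rewrite big_nil dvd1n.
move=> /andP[ps us] sp sd; rewrite big_cons Gauss_dvd.
  rewrite sd ?mem_head// IH// => q qs; first by apply: sp; rewrite inE qs orbT.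
  by apply: sd; rewrite inE qs orbT.
have pp : prime p by apply: sp; rewrite mem_head.
rewrite big_seq; elim/big_ind: _ => [|x y|q qs]; first exact: coprimen1.
  by rewrite coprimeMr => -> ->.
rewrite prime_coprime// dvdn_prime2//; last by apply: sp; rewrite inE qs orbT.
by apply: contra ps => /eqP ->.
Qed.

(** The primes in [(k + 1, 2 k + 1]] divide ['C(2 k + 1, k) <= 4^k], and induction handles those up
    to [k + 1]. An even number above [2] contributes nothing. *)
Lemma primorial_le m : primorial m <= 4 ^ m.
Proof.
elim/ltn_ind: m => -[|[|[|m]]] IH; rewrite /primorial.
- by rewrite !unlock.
- by rewrite !unlock.
- by rewrite !unlock.
have [pm|pm] := boolP (prime m.+3); last first.
  rewrite big_mkcond big_nat_recr//= (negbTE pm) muln1 -big_mkcond.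
  by rewrite (leq_trans (IH m.+2 _))// leq_exp2l.
have om : odd m.+3 by case/even_prime: pm => [|->].
have [k mE] : exists k, m.+3 = k.*2.+1.
  by exists m.+3./2; rewrite -[LHS]odd_double_half om.
have km : k.+1 < m.+3 by move: mE; rewrite -addnn; lia.
rewrite (@big_cat_nat _ _ _ k.+2)//=; last exact: ltnW.
have dvd : \prod_(k.+2 <= p < m.+4 | prime p) p %| 'C(m.+3, k).
  rewrite -big_filter; apply: prod_primes_dvd.
  - by rewrite filter_uniq// iota_uniq.
  - by move=> p; rewrite mem_filter => /andP[].
  move=> p; rewrite mem_filter mem_index_iota => /and3P[pp kp pm3].
  have km3 : k <= m.+3 by apply: leq_trans (ltnW km).
  have : p %| m.+3`! by rewrite dvdn_fact// prime_gt0.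
  have mk : m.+3 - k = k.+1 by rewrite mE -addnn; lia.
  rewrite -(bin_fact km3) mk (Euclid_dvdM _ _ pp) (Euclid_dvdM _ _ pp) => /or3P[//|pk|pk].
    by have := prime_dvd_fact pp pk; rewrite leqNgt (ltn_trans _ kp).
  by have := prime_dvd_fact pp pk; rewrite leqNgt kp.
have C0 : 0 < 'C(m.+3, k) by rewrite bin_gt0 mE -addnn; lia.
have {}dvd := dvdn_leq C0 dvd.
rewrite (leq_trans (leq_mul (IH k.+1 km) (leq_trans dvd _)) (n := 4 ^ k.+1 * 4 ^ k))//.
  by rewrite mE odd_bin_le.
by rewrite -expnD leq_exp2l// mE -addnn; lia.
Qed.

(** Legendre's formula for the three factorials; each summand is [0] or [1]. *)
Lemma logn_central_bin p n : prime p ->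
  logn p 'C(n.*2, n) = \sum_(1 <= k < n.*2.+1) (n.*2 %/ p ^ k - 2 * (n %/ p ^ k)).
Proof.
move=> pp; have h := @bin_fact n.*2 n; rewrite -addnn leq_addr addnK in h.
have {}h := h isT.
have := congr1 (logn p) h.
rewrite !lognM ?muln_gt0 ?fact_gt0 ?bin_gt0 ?leq_addr// !logn_fact// addnn.
have -> : \sum_(1 <= k < n.+1) n %/ p ^ k = \sum_(1 <= k < n.*2.+1) n %/ p ^ k.
  rewrite [RHS](@big_cat_nat _ _ _ n.+1)//=; last by rewrite -addnn; lia.
  rewrite [X in _ + X]big_nat_cond [X in _ + X]big1 ?addn0// => k /andP[/andP[nk _] _].
  rewrite divn_small// (ltn_trans nk)// ltn_expl// prime_gt1//.
set A := \sum_(1 <= k < n.*2.+1) n %/ _.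
have -> : \sum_(1 <= k < n.*2.+1) n.*2 %/ p ^ k =
  \sum_(1 <= k < n.*2.+1) (n.*2 %/ p ^ k - 2 * (n %/ p ^ k)) + (A + A).
  rewrite addnn -(mul2n A) /A big_distrr/= -big_split/=; apply: eq_bigr => k _.
  rewrite subnK// -mul2n mulnC leq_divRL ?expn_gt0 ?prime_gt0//.
  by rewrite mulnAC [leqRHS]mulnC leq_mul2r leq_trunc_div orbT.
by move=> /addIn.
Qed.

Lemma div_double_le1 n d : n.*2 %/ d - 2 * (n %/ d) <= 1.
Proof.
case: d => [//|d]; rewrite leq_subLR addn1 -ltnS ltn_divLR//.
have := ltn_pmod n (ltn0Sn d); have := divn_eq n d.+1; rewrite -addnn.
move: (n %/ d.+1) (n %% d.+1) => a b; nia.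
Qed.

Lemma logn_central_bin_le p n j : prime p -> n.*2 < p ^ j.+1 -> logn p 'C(n.*2, n) <= j.
Proof.
move=> pp npj; rewrite logn_central_bin//.
have [jn|jn] := leqP j n.*2; last first.
  apply: leq_trans (ltnW jn); apply: (@leq_trans (\sum_(1 <= k < n.*2.+1) 1)).
    by apply: leq_sum => k _; exact: div_double_le1.
  by rewrite sum_nat_const_nat subn1 muln1.
rewrite (@big_cat_nat _ _ _ j.+1)//= [X in _ + X]big_nat_cond [X in _ + X]big1 ?addn0.
  apply: (@leq_trans (\sum_(1 <= k < j.+1) 1)).
    by apply: leq_sum => k _; exact: div_double_le1.
  by rewrite sum_nat_const_nat subn1 muln1.
move=> k /andP[/andP[jk _] _]; rewrite divn_small//.
by rewrite (leq_trans npj)// leq_exp2l// prime_gt1.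
Qed.

Lemma pfactor_central_bin_le p n : 0 < n -> prime p -> p ^ logn p 'C(n.*2, n) <= n.*2.
Proof.
move=> n0 pp; have p1 := prime_gt1 pp.
have n2 : 0 < n.*2 by rewrite double_gt0.
have /andP[h1 h2] := trunc_log_bounds p1 n2.
by apply: leq_trans h1; rewrite leq_exp2l// logn_central_bin_le.
Qed.

(** Only [p] and [2 p] among the multiples of [p] are at most [2 n], so the two factors in the
    numerator cancel those of the two factorials. Hence the primes in [(2 n / 3, n]] are absent. *)
Lemma logn_central_bin_eq0 p n : prime p -> n.*2 < p ^ 2 -> n.*2 < 3 * p -> p <= n ->
  logn p 'C(n.*2, n) = 0.
Proof.
move=> pp np2 n3p pn; have p1 := prime_gt1 pp; have p0 := prime_gt0 pp.
rewrite logn_central_bin// big_nat_cond big1// => -[|[|k]] /andP[/andP[_ _] _] //.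
  rewrite expn1; apply/eqP; rewrite subn_eq0.
  have h : 1 <= n %/ p by rewrite divn_gt0.
  have : n.*2 %/ p < 3 by rewrite ltn_divLR.
  lia.
by rewrite divn_small// (leq_trans np2)// leq_exp2l.
Qed.

Definition dyadic_primes n := [seq p <- iota n.+1 n | prime p].

Lemma central_bin_factorisation n : 0 < n ->
  'C(n.*2, n) = \prod_(0 <= p < n.*2.+1 | prime p) p ^ logn p 'C(n.*2, n).
Proof.
move=> n0; set C := 'C(_, _).
have C0 : 0 < C by rewrite bin_gt0 -addnn leq_addr.
rewrite -[LHS](partnT C0) (@widen_partn (C + n.*2)) ?leq_addr//.
rewrite (@big_cat_nat _ _ _ n.*2.+1)//=; last by rewrite ltnS leq_addl.
rewrite [X in _ * X]big_nat_cond [X in _ * X]big1 ?muln1.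
  rewrite [RHS]big_mkcond; apply: eq_bigr => p _; case: ifP => // pp.
  by rewrite lognE pp.
move=> p /andP[/andP[np _] _].
have [pp|pp] := boolP (prime p); last by rewrite lognE (negbTE pp).
have /eqP -> : logn p C == 0; last by [].
by rewrite -leqn0; apply: logn_central_bin_le => //; rewrite expn1.
Qed.

Lemma prod_if_const (s : seq nat) (Q : pred nat) x :
  \prod_(p <- s | prime p) (if Q p then x else 1) = x ^ size [seq p <- s | prime p && Q p].
Proof. by rewrite -big_mkcondr/= big_const_seq size_filter iter_muln_1. Qed.

(** The argument of Erdos for Bertrand's postulate, kept quantitative. In the factorisation of the
    central coefficient a prime up to [r] counts at most [2 n], one up to [2 n / 3] at most itself,
    one up to [n] nothing, and one above [n] at most [2 n]. The absent range is essential: it leaves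
    [4^(n / 3)] for the last class. *)
Lemma four_pow_le n r : 0 < n -> n.*2 < r.+1 ^ 2 ->
  4 ^ n <= n.*2 * (n.*2 ^ r * 4 ^ (n.*2 %/ 3) * n.*2 ^ size (dyadic_primes n)).
Proof.
move=> n0 nr; apply: (leq_trans (central_bin_ge n0)).
have n2 : 0 < n.*2 by rewrite double_gt0.
rewrite leq_pmul2l// central_bin_factorisation//.
apply: (@leq_trans (\prod_(0 <= p < n.*2.+1 | prime p)
   ((if p < r.+1 then n.*2 else 1) * (if p < (n.*2 %/ 3).+1 then p else 1) *
    (if n < p then n.*2 else 1)))).
  apply: leq_prod => p pp; have p0 := prime_gt0 pp.
  have [pr|pr] := ltnP p r.+1.
    apply: leq_trans (pfactor_central_bin_le n0 pp) _.
    rewrite -mulnA leq_pmulr// muln_gt0; case: ifP => _; case: ifP => _; rewrite ?p0 ?n2//.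
  have np2 : n.*2 < p ^ 2 by rewrite (leq_trans nr)// leq_exp2r.
  have e1 : logn p 'C(n.*2, n) <= 1 by apply: logn_central_bin_le.
  rewrite mul1n; have [p3|p3] := ltnP p (n.*2 %/ 3).+1.
    apply: (@leq_trans p).
      by rewrite -[leqRHS]expn1 leq_exp2l// prime_gt1.
    by rewrite leq_pmulr//; case: ifP => _; rewrite ?n2.
  rewrite mul1n; have [np|pn] := ltnP n p; first exact: pfactor_central_bin_le.
  rewrite logn_central_bin_eq0//.
  by move: p3; rewrite ltn_divLR// mulnC.
rewrite !big_split/=; apply: leq_mul; first apply: leq_mul.
- rewrite prod_if_const leq_pexp2l// -[leqRHS](size_iota 1).
  apply: uniq_leq_size; first by rewrite filter_uniq// iota_uniq.
  move=> p; rewrite mem_filter mem_iota add1n => /andP[/andP[/prime_gt0 -> ->]] //.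
- rewrite -big_mkcondr/= -big_nat_widen; first exact: primorial_le.
  by rewrite ltnS leq_div.
- rewrite prod_if_const leq_pexp2l//.
  apply: uniq_leq_size; first by rewrite filter_uniq// iota_uniq.
  move=> p; rewrite !mem_filter mem_index_iota mem_iota => /andP[/andP[-> ->]] /=.
  by rewrite addSn addnn.
Qed.

End PrimesInDyadicInterval.

(** * A lower bound of Chebyshev type for the number of primes *)

Section PrimeCount.
Context {R : realType}.
Implicit Types (e : R) (n : nat).

Lemma ln4_ge1 : 1 <= ln (4 : R).
Proof.
have h : expR 1 <= (4 : R).
  have h2 : expR (2^-1) <= (2 : R).
    rewrite -[leLHS]invrK -expRN -[leRHS]invrK lef_pV2 ?posrE ?expR_gt0 ?invr_gt0//.
    by apply: le_trans (expR_ge1Dx _); lra.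
  have -> : (4 : R) = 2 ^+ 2 by rewrite expr2 -natrM.
  have -> : expR (1 : R) = expR 2^-1 ^+ 2 by rewrite -expRM_natl divff.
  by rewrite lerXn2r ?nnegrE ?expR_ge0.
by rewrite -[leLHS]expRK ler_ln ?posrE ?expR_gt0.
Qed.

Lemma many_primes n e : (0 < n)%N -> 0 < e <= 2^-1 -> 72 / e ^+ 2 <= ln (n.*2%:R : R) ->
  expR ((1 - e) * ln (n.*2%:R)) <= (size (dyadic_primes n))%:R.
Proof.
move=> n0 /andP[e0 e2]; set x : R := n.*2%:R; set u := ln x => eu.
have x0 : 0 < x by rewrite ltr0n double_gt0.
have xE : x = expR u by rewrite lnK.
have u0 : 0 < u by apply: lt_le_trans eu; rewrite divr_gt0// exprn_gt0.
pose r := Num.truncn (Num.sqrt x).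
have /andP[r1 r2] := truncn_itv (sqrtr_ge0 x).
have nr : (n.*2 < r.+1 ^ 2)%N.
  rewrite -(ltr_nat R) natrX -/x -[x]sqr_sqrtr ?(ltW x0)//.
  by rewrite ltr_pXn2r ?nnegrE.
set c := size _.
(* Logarithms of [four_pow_le]: the exponent [n - 2 n / 3 = x / 6] of [4] remains, and
   [ln 4 >= 1]. *)
have h : x / 6 <= (1 + r%:R + c%:R) * u.
  have /(_ n0) := @four_pow_le n r; move=> /(_ nr).
  rewrite -(ler_nat R) !natrM !natrX -/x => H.
  have : ln ((4 : R) ^+ n) <= ln (x * (x ^+ r * 4 ^+ (n.*2 %/ 3) * x ^+ c)).
    by rewrite ler_ln ?posrE ?exprn_gt0// !mulr_gt0 ?exprn_gt0.
  rewrite !lnM ?posrE ?mulr_gt0 ?exprn_gt0// !lnXn// -/u => {}H.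
  have d3 : (n.*2 %/ 3)%:R <= x / 3.
    by rewrite ler_pdivlMr// -natrM ler_nat leq_trunc_div.
  have nx : n%:R = x / 2 by rewrite /x -mul2n natrM mulrC mulKf.
  have l4 := ln4_ge1; have l40 : 0 <= ln (4 : R) by apply: le_trans l4.
  move: H; rewrite -(mulr_natr (ln 4) n) -(mulr_natr u r) -(mulr_natr u c) -(mulr_natr (ln 4) (n.*2 %/ 3)).
  have : ln 4 * (n.*2 %/ 3)%:R <= ln 4 * (x / 3) by rewrite ler_wpM2l.
  have : 1 * x <= ln 4 * x by rewrite ler_wpM2r// ltW.
  rewrite nx; move: (ln 4) (n.*2 %/ 3)%:R (r%:R) (c%:R) => a b f g ? ? ?; lra.
have rE : r%:R <= expR ((1 - e) * u).
  apply: (le_trans r1); rewrite -ler_sqr ?nnegrE ?expR_ge0 ?sqrtr_ge0// sqr_sqrtr ?(ltW x0)//.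
  rewrite {1}xE -expRM_natl ler_expR mulrA ler_peMl ?(ltW u0)//; lra.
have E1 : 1 <= expR ((1 - e) * u).
  have e1 : 0 <= 1 - e by move: e2; clear -R; lra.
  by rewrite -[leLHS]expR0 ler_expR; apply: mulr_ge0 e1 (ltW u0).
(* It remains to have [3 E u <= x / 6] for [E = expR ((1 - e) * u)], since [1] and [r] are each at
   most [E]. From [exp y >= y] with [y = e u / 2], squared, [18 u <= e^2 u^2 / 4] suffices; this is
   the origin of [72 / e^2]. *)
have key : 18 * u * expR ((1 - e) * u) <= x.
  have -> : x = expR (e * u / 2) ^+ 2 * expR ((1 - e) * u).
    by rewrite xE -expRM_natl -expRD; congr expR; field.
  rewrite ler_wpM2r ?expR_ge0//.
  apply: (@le_trans _ _ ((e * u / 2) ^+ 2)).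
    move: eu; rewrite ler_pdivrMr ?exprn_gt0// => eu.
    have -> : (e * u / 2) ^+ 2 = u * e ^+ 2 * u / 4 by field.
    have : 72 * u <= u * e ^+ 2 * u by rewrite ler_wpM2r// ltW.
    by move: (u * e ^+ 2 * u) => w ?; lra.
  rewrite lerXn2r ?nnegrE ?expR_ge0 ?divr_ge0 ?mulr_ge0 ?(ltW e0) ?(ltW u0)//.
  by apply: le_trans (expR_ge1Dx _); rewrite lerDr.
rewrite -(ler_pM2r u0).
move: h key; have := ler_wpM2r (ltW u0) rE; have := ler_wpM2r (ltW u0) E1.
by move: (expR ((1 - e) * u)) (r%:R) (c%:R) => E f g; lra.
Qed.

End PrimeCount.

(** * Jessen functions of character sums *)

Section CharacterValues.
Context {R : realType} (q : nat) (chi : nat -> R[i]).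
Hypotheses (q_gt0 : (0 < q)%N) (chi_char : dirichlet_character q chi).

Lemma char1 : chi 1 = 1. Proof. by case: chi_char. Qed.

Lemma char_neq0 n : (chi n != 0) = coprime n q. Proof. by case: chi_char. Qed.

Lemma charX n k : chi (n ^ k)%N = chi n ^+ k.
Proof.
case: chi_char => c1 cM _ _; elim: k => [|k IH]; first by rewrite expn0 c1.
by rewrite expnS cM IH exprS.
Qed.

(** By Euler's theorem a nonzero value is a root of unity. *)
Lemma nsq_char n : nsq (chi n) = (coprime n q)%:R.
Proof.
have [cn|cn] := boolP (coprime n q); last first.
  have := char_neq0 n; rewrite (negbTE cn) => /negbFE/eqP ->; exact: nsq0.
case: chi_char => c1 _ cmod _.
have : chi n ^+ totient q = 1 by rewrite -charX -c1; exact/cmod/cyclic.Euler_exp_totient.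
move/(congr1 (@nsq R)); rewrite nsqX nsq1 => /eqP.
by rewrite pexpr_eq1 ?nsq_ge0 ?totient_gt0// => /eqP.
Qed.

End CharacterValues.

(** * The blocks of primes in a character sum *)

Section LowerBoundAtZero.
Context {R : realType} (q : nat) (chi : nat -> R[i]).
Hypotheses (q_gt0 : (0 < q)%N) (chi_char : dirichlet_character q chi).
Variables (n N K s : nat).
Hypotheses (qn : (q <= n)%N) (nN : (n.*2 <= N <= n.*2.+1)%N) (s0 : (0 < s)%N)
  (Ks : (K * s < size (dyadic_primes n))%N).

Let l := dyadic_primes n.

Let l_uniq : uniq l. Proof. by rewrite filter_uniq// iota_uniq. Qed.

(** Runs of [s] consecutive entries of the list of primes form the blocks [1] to [K], and the next
    entry forms the block [K + 1] alone. Outside the list [index] returns its length, which exceeds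
    [K * s], hence the label [0]. *)
Definition prime_label p : nat :=
  let k := index p l in
  if (k < K * s)%N then (k %/ s).+1 else if k == (K * s)%N then K.+1 else 0.

Lemma prime_label_le p : (prime_label p < K.+2)%N.
Proof.
rewrite /prime_label; case: (ltnP (index p l)) => [h|_]; last by case: eqP.
by rewrite !ltnS ltnW// ltn_divLR// .
Qed.

Lemma prime_label_neq0 p : prime_label p != 0 -> p \in l.
Proof.
rewrite /prime_label -index_mem; case: ltnP => [h _|_]; first exact: ltn_trans Ks.
by have [->|_] := eqVneq (index p l) (K * s)%N.
Qed.

Lemma prime_label_last p : (prime_label p == K.+1) = (p == nth 0%N l (K * s)).
Proof.
apply/eqP/eqP => [|->]; last by rewrite /prime_label index_uniq// ltnn eqxx.
move=> h; have pl : p \in l by apply: prime_label_neq0; rewrite h.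
move: h; rewrite /prime_label; case: ltnP => [h [E]|_]; last by case: eqP => // <- _; rewrite nth_index.
by move: h; rewrite -ltn_divLR// E ltnn.
Qed.

Lemma count_prime_label j : (j < K)%N ->
  (\sum_(1 <= p < N.+1 | prime_label p == j.+1) 1 = s)%N.
Proof.
move=> jK; rewrite sum1_count -size_filter.
pose t := [seq nth 0%N l k | k <- iota (j * s) s].
have it k : k \in iota (j * s) s -> (k < K * s)%N /\ (k < size l)%N.
  rewrite mem_iota => /andP[_ kj].
  have h : (k < K * s)%N by rewrite (leq_trans kj)// -mulSnr leq_mul2r jK orbT.
  by split=> //; exact: ltn_trans Ks.
have -> : s = size t by rewrite size_map size_iota.
apply/perm_size/uniq_perm.
- by rewrite filter_uniq// iota_uniq.
- rewrite map_inj_in_uniq ?iota_uniq// => k k' /it[_ kl] /it[_ kl'] /eqP.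
  by rewrite nth_uniq// => /eqP.
move=> p; rewrite mem_filter mem_index_iota; apply/andP/mapP => [[/eqP pj _]|[k kt ->]].
  have pl : p \in l by apply: prime_label_neq0; rewrite pj.
  exists (index p l); last by rewrite nth_index.
  move: pj; rewrite /prime_label mem_iota; case: ltnP => [_ [<-]|_].
    by rewrite leq_trunc_div -mulSnr ltn_ceil.
  by case: eqP => // _ [jE]; rewrite jE ltnn in jK.
have [kK kl] := it _ kt; split.
  rewrite /prime_label index_uniq// kK eqSS.
  move: kt; rewrite mem_iota => /andP[k1 k2]; rewrite eqn_leq leq_divRL// k1 andbT.
  by rewrite -ltnS ltn_divLR// mulSnr.
have := mem_nth 0 kl; rewrite mem_filter mem_iota => /and3P[_ h1 h2].
rewrite (leq_trans _ h1)//= ltnS (leq_trans _ (proj1 (andP nN)))//.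
by move: h2; rewrite addSn addnn ltnS.
Qed.

Definition lab (i : 'I_N) : 'I_K.+2 := inord (prime_label i.+1).

Lemma labE i j : (lab i == j) = (prime_label i.+1 == j).
Proof. by rewrite -val_eqE/= inordK ?prime_label_le. Qed.

(** A prime above [n >= q] does not divide [q], so [chi] is unimodular on the labelled primes; and
    [N <= 2 n + 1 < 2 p] leaves them no other multiple. *)
Lemma logmean_char_lower : (4 <= K)%N ->
  (1 - 4 / K%:R) * ln ((K * s)%:R / 2) - (K.+1)%:R * ln 2 <= logmean (@dcoef R N chi 0).
Proof.
move=> K4; have dE i : @dcoef R N chi 0 i = chi i.+1.
  by rewrite /dcoef mul0r expR0 mulr1.
have labP (i : 'I_N) : lab i != ord0 -> prime i.+1 /\ (n < i.+1)%N.
  rewrite labE => /prime_label_neq0; rewrite mem_filter mem_iota.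
  by move=> /and3P[-> ->].
have p0l : nth 0%N l (K * s) \in l by rewrite mem_nth.
have p0P : (0 < nth 0%N l (K * s) <= N)%N.
  move: p0l; rewrite mem_filter mem_iota => /and3P[/prime_gt0 -> _ /= h].
  by rewrite (leq_trans _ (proj1 (andP nN)))//; move: h; rewrite addSn addnn ltnS.
have i0N : ((nth 0%N l (K * s)).-1 < N)%N by move: p0P; case: nth.
pose i0 := Ordinal i0N.
apply: le_logmean_lmean => [|d d0].
  have N0 : (0 < N)%N by apply: leq_ltn_trans (i0N).
  by exists (Ordinal N0); rewrite dE (char1 chi_char) oner_neq0.
apply: (@lmean_lower R N K s lab) => //.
- move=> i /labP[pi ni]; split=> //; case/andP: nN => _ h.
  by rewrite (leq_ltn_trans h)// -ltnS mul2n -doubleS ltnS leq_double.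
- move=> i /labP[pi ni]; rewrite dE (nsq_char q_gt0 chi_char) prime_coprime//.
  rewrite [~~ _](_ : _ = true)//; apply/negP => /(dvdn_leq q_gt0).
  by rewrite leqNgt (leq_ltn_trans qn).
- move=> j /andP[j0 jm].
  have jE : (j : nat) = j.-1.+1 by rewrite prednK// lt0n.
  have jK : (j.-1 < K)%N.
    rewrite -ltnS -jE ltn_neqAle -ltnS ltn_ord andbT.
    by move: jm; rewrite -val_eqE.
  rewrite -[RHS](count_prime_label jK) big_add1/= big_mkord.
  by apply: eq_bigl => i; rewrite labE -jE.
- exists i0 => i; rewrite labE/= prime_label_last -val_eqE/=.
  by rewrite -[RHS]eqSS prednK ?(proj1 (andP p0P)).
Qed.

End LowerBoundAtZero.

(** * The lower bound at abscissa zero *)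

Section JessenAtZero.
Context {R : realType}.
Implicit Types (e A : R).

Lemma ln_nat_near A : \forall N \near \oo, A <= ln (N%:R : R).
Proof.
exists (Num.truncn (expR A)).+1 => // N /= hN.
have /andP[_ h] := truncn_itv (expR_ge0 A).
rewrite -[leLHS]expRK ler_ln ?posrE ?expR_gt0 ?ltr0n//; last by apply: leq_trans hN.
by apply: (le_trans (ltW h)); rewrite ler_nat.
Qed.

Variables (q : nat) (chi : nat -> R[i]).
Hypotheses (q_gt0 : (0 < q)%N) (chi_char : dirichlet_character q chi).

Lemma char_coef_neq0 N : (0 < N)%N -> exists i : 'I_N, chi i.+1 != 0.
Proof.
by move=> N0; exists (Ordinal N0); rewrite (char1 chi_char) oner_neq0.
Qed.

Lemma jessen_char_zero_ge e : 0 < e ->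
  \forall N \near \oo, (2^-1 - e) * ln N%:R <= jessen_char chi N 0.
Proof.
(* The exceptional density [4 / K] and the prime count each lose [e1], halved by the factor [2^-1];
   the additive constants lose another [e1]. The total is [2 e1 <= e]. The cap [2^-1] is the
   condition of [many_primes]. *)
move=> e0; pose e1 := Num.min (e / 2) 2^-1.
have e1e : e1 <= e / 2 by rewrite ge_min lexx.
have e12 : e1 <= 2^-1 by rewrite ge_min lexx orbT.
have e10 : 0 < e1 by rewrite lt_min divr_gt0//= invr_gt0 ltr0n.
clearbody e1.
have e1h : 2^-1 <= 1 - e1 by lra.
have e1p : 0 <= 1 - e1 by lra.
have e1l : e1 <= 1 by lra.
have e1d : 0 <= 1 - 2 * e1 by lra.
have e1D : 1 - 2 * e1 <= 1 by lra.
have e1e' : 2^-1 - e <= 2^-1 - 2 * e1 by lra.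
have [K [K4 Ke]] : exists K, (4 <= K)%N /\ 4 / K%:R <= e1.
  exists (4 + (Num.truncn (4 / e1)).+1)%N; split; first exact: leq_addr.
  have h0 : 0 <= 4 / e1 by rewrite divr_ge0// ltW.
  have /andP[_ h] := truncn_itv h0.
  rewrite ler_pdivrMr ?ltr0n// mulrC -ler_pdivrMr//.
  by apply: (le_trans (ltW h)); rewrite ler_nat leq_addl.
have K0 : 0 < K%:R :> R by rewrite ltr0n; apply: leq_trans K4.
(* [ln 2] for passing from [N] to [2 n], [ln 4] for passing from the number of primes to [K s / 2],
   and [ln 2] for each of the [K + 1] blocks. *)
pose C : R := ln 2 + ln 4 + K.+1%:R * ln 2.
near=> N.
pose n := N./2.
have NB : 72 / e1 ^+ 2 + ln 2 <= ln (N%:R : R) by near: N; exact: ln_nat_near.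
have NK : 2 * ln (2 * K%:R) + ln 2 <= ln (N%:R : R) by near: N; exact: ln_nat_near.
have NC : C / e1 <= ln (N%:R : R) by near: N; exact: ln_nat_near.
have Nq : (q.*2 <= N)%N by near: N; exact: nbhs_infty_ge.
have N2 : (2 <= N)%N by near: N; exact: nbhs_infty_ge.
have nN : (n.*2 <= N <= n.*2.+1)%N.
  rewrite /n -[in X in (_ <= X <= _)%N](odd_double_half N).
  by case: odd; rewrite /= ?add1n ?add0n leqnn leqnSn.
have qn : (q <= n)%N by rewrite -[q]doubleK half_leq.
have n0 : (0 < n)%N by rewrite -[1%N]/(2./2) half_leq.
pose u : R := ln n.*2%:R.
have uN : ln N%:R - ln 2 <= u.
  rewrite -ln_div ?posrE ?ltr0n ?(ltnW N2)// ler_ln ?posrE ?divr_gt0 ?ltr0n ?double_gt0 ?(ltnW N2)//.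
  rewrite ler_pdivrMr// -natrM ler_nat; case/andP: nN => _ h.
  by apply: (leq_trans h); rewrite muln2 -!addnn; move: n0; clear; lia.
have u72 : 72 / e1 ^+ 2 <= u by apply: le_trans uN; rewrite lerBrDr.
have uK : 2 * ln (2 * K%:R) <= u by apply: le_trans uN; rewrite lerBrDr.
have l2 : 0 <= ln (2 : R) by rewrite ln_ge0// ler1n.
have l4 : 0 <= ln (4 : R) by rewrite ln_ge0// ler1n.
have u0 : 0 <= u by apply: le_trans uK; rewrite mulr_ge0// ln_ge0// -natrM ler1n muln_gt0/= -(ltr0n R).
have cnt := many_primes n0 (introT andP (conj e10 e12)) u72.
rewrite -/u in cnt; clearbody u; set c := size _ in cnt.
have c2K : (2 * K <= c)%N.
  rewrite -(ler_nat R); apply: le_trans cnt; rewrite natrM -[leLHS]lnK ?posrE ?mulr_gt0// ler_expR.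
  have : 2^-1 * u <= (1 - e1) * u by rewrite ler_wpM2r.
  by move: uK; move: (ln _) ((1 - e1) * u) => x y; lra.
(* The predecessor reserves one prime for the last block. *)
pose s := (c.-1 %/ K)%N.
have K0n : (0 < K)%N by apply: leq_trans K4.
have s0 : (0 < s)%N by rewrite divn_gt0//; move: c2K K0n; clear; lia.
have Ksc : (K * s < c)%N.
  have := leq_trunc_div c.-1 K; rewrite -/s mulnC; move: c2K K0n; clear; lia.
have cKs : (c <= 2 * (K * s))%N.
  have := ltn_ceil c.-1 K0n; rewrite -/s mulSnr mulnC.
  by move: c2K K0n; clear; lia.
have low := @logmean_char_lower R q chi q_gt0 chi_char n N K s qn nN s0 Ksc K4.
rewrite /jessen_char jessen_logmean; last by apply: char_coef_neq0; exact: ltnW.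
have Lu : (1 - e1) * u - ln 4 <= ln ((K * s)%:R / 2).
  rewrite -[X in X - _]expRK -ln_div ?posrE ?expR_gt0// ler_ln ?posrE ?divr_gt0 ?expR_gt0 ?ltr0n ?muln_gt0 ?K0n//.
  have : c%:R <= 2 * (K * s)%:R :> R by rewrite -natrM ler_nat.
  by move: cnt; move: (expR _) (c%:R) ((K * s)%:R) => x y z; lra.
have L0 : 0 <= (1 - e1) * u - ln 4.
  have : 2^-1 * u <= (1 - e1) * u by rewrite ler_wpM2r.
  have : ln 4 <= ln (2 * K%:R) :> R.
    by rewrite ler_ln ?posrE ?mulr_gt0// -natrM ler_nat; move: K4; clear; lia.
  by move: uK; move: (ln (2 * _)) (ln 4) ((1 - e1) * u) => x y z; lra.
have h1 : (1 - e1) * ((1 - e1) * u - ln 4) <= (1 - 4 / K%:R) * ln ((K * s)%:R / 2).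
  apply: (@le_trans _ _ ((1 - 4 / K%:R) * ((1 - e1) * u - ln 4))).
    by rewrite ler_wpM2r// lerD2l lerN2.
  by rewrite ler_wpM2l// subr_ge0 (le_trans Ke).
have h2 : (1 - 2 * e1) * u - ln 4 <= (1 - e1) * ((1 - e1) * u - ln 4).
  have -> : (1 - e1) * ((1 - e1) * u - ln 4) =
    (1 - 2 * e1) * u - ln 4 + (e1 ^+ 2 * u + e1 * ln 4) by ring.
  by rewrite lerDl; apply: addr_ge0; apply: mulr_ge0 => //; rewrite ?sqr_ge0// ltW.
have h3 : (1 - 2 * e1) * ln N%:R - ln 2 <= (1 - 2 * e1) * u.
  apply: (@le_trans _ _ ((1 - 2 * e1) * (ln N%:R - ln 2))).
    rewrite mulrBr lerD2l lerN2 ler_piMl//.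
  by rewrite ler_wpM2l.
have h4 : C <= e1 * ln N%:R by rewrite mulrC -ler_pdivrMr.
have h5 : (2^-1 - e) * ln N%:R <= (2^-1 - 2 * e1) * ln N%:R.
  by rewrite ler_wpM2r ?ln_ge0 ?ler1n ?(ltnW N2).
apply: (le_trans h5); move: h4 low; rewrite /C.
have -> : (2^-1 - 2 * e1) * ln N%:R = 2^-1 * ((1 - 2 * e1) * ln N%:R) - e1 * ln N%:R.
  by field.
have h6 : 0 <= e1 * ln N%:R.
  by apply: mulr_ge0 (ltW e10) _; rewrite ln_ge0// ler1n ltnW.
move: h1 h2 h3 h6; move: (logmean _) (ln (4 : R)) (ln (2 : R)) (_%:R * ln (2 : R))
  (_ * ln (_ / 2)) ((1 - e1) * ((1 - e1) * u - _)) ((1 - 2 * e1) * u)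
  ((1 - 2 * e1) * ln _) (e1 * ln _).
by move=> x1 x2 x3 x4 x5 x6 x7 x8 x9 *; lra.
Unshelve. all: by end_near. Qed.

End JessenAtZero.

(** * Monotonicity of convex functions bounded on a half-line *)

Section ConvexBounded.
Context {R : realType}.
Implicit Types (f : R -> R) (x y z a b B A : R).

Lemma convexR_nonincreasing f A B : convexR f -> (forall x, A <= x -> f x <= B) ->
  forall x y, x <= y -> f y <= f x.
Proof.
move=> cf fB x y; rewrite le_eqVlt => /predU1P[->//|xy].
rewrite leNgt; apply/negP => fxy.
have d0 : 0 < f y - f x by rewrite subr_gt0.
(* At this [z] the line through the points over [x < y] has risen above [B], and convexity puts
   [f z] above that line. *)
pose z := Num.max A (y + (y - x) * (`|B - f x| / (f y - f x) + 1)).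
have yz : y + (y - x) * (`|B - f x| / (f y - f x) + 1) <= z by rewrite le_max lexx orbT.
have zA : A <= z by rewrite le_max lexx.
have q0 : 0 <= `|B - f x| / (f y - f x) by rewrite divr_ge0// ltW.
have yz' : y < z.
  by apply: lt_le_trans yz; rewrite ltrDl mulr_gt0 ?subr_gt0// ltr_wpDl.
have /cf h : x < y < z by rewrite xy.
have zxy : (y - x) * (`|B - f x| / (f y - f x) + 1) <= z - x.
  by rewrite lerBrDr; apply: le_trans yz; rewrite addrC lerD2r ltW.
have : (y - x) * (`|B - f x| + (f y - f x)) <= (z - x) * (f y - f x).
  have -> : (y - x) * (`|B - f x| + (f y - f x)) =
      (y - x) * (`|B - f x| / (f y - f x) + 1) * (f y - f x).
    by field; rewrite gt_eqF.
  by rewrite ler_wpM2r// ltW.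
have : (y - x) * (B - f x) <= (y - x) * `|B - f x|.
  by rewrite ler_wpM2l ?ler_norm// subr_ge0 ltW.
have : (y - x) * f z <= (y - x) * B.
  by rewrite ler_wpM2l ?fB// subr_ge0 ltW.
have : 0 < (y - x) * (f y - f x) by rewrite mulr_gt0 ?subr_gt0.
move: h; clear -R; move: (`|B - f x|) => D; nra.
Qed.

Lemma convexR_opp f : convexR f -> convexR (fun x => f (- x)).
Proof.
move=> cf x y z /andP[xy yz]; have := cf (- z) (- y) (- x).
rewrite !ltrN2 yz xy => /(_ isT); rewrite !opprK.
by rewrite (addrC (- x) z) (addrC (- x) y) (addrC (- y) z) [X in _ <= X -> _]addrC.
Qed.

Lemma convexR_addlin f a : convexR f -> convexR (fun x => f x + x * a).
Proof.
move=> cf x y z /cf h.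
have -> : (z - x) * (f y + y * a) = (z - x) * f y + (z - x) * (y * a) by ring.
have -> : (z - y) * (f x + x * a) + (y - x) * (f z + z * a) =
  ((z - y) * f x + (y - x) * f z) + (z - x) * (y * a) by ring.
by rewrite lerD2r.
Qed.

Lemma convexR_nondecreasing f A B : convexR f -> (forall x, x <= A -> f x <= B) ->
  forall x y, x <= y -> f x <= f y.
Proof.
move=> cf fB x y xy.
have := @convexR_nonincreasing _ (- A) B (convexR_opp cf).
move=> /(_ _)/(_ (- y) (- x)); rewrite !opprK lerN2; apply=> // w Aw.
by apply: fB; rewrite lerNl.
Qed.

Lemma convexRZ f a : 0 <= a -> convexR f -> convexR (fun x => a * f x).
Proof.
move=> a0 cf x y z /cf h.
have -> : (z - x) * (a * f y) = a * ((z - x) * f y) by ring.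
have -> : (z - y) * (a * f x) + (y - x) * (a * f z) =
  a * ((z - y) * f x + (y - x) * f z) by ring.
by rewrite ler_wpM2l.
Qed.

Lemma harmonic_le N : (0 < N)%N -> \sum_(i < N) (i.+1%:R)^-1 <= 1 + ln (N%:R : R).
Proof.
elim: N => // -[|N] IH _; first by rewrite big_ord1 ln1 addr0 invr1.
rewrite big_ord_recr/=; apply: (le_trans (lerD (IH isT) (lexx _))).
rewrite -addrA lerD2l -lerBrDl -lerN2 opprB.
rewrite -ln_div ?posrE ?ltr0n//.
have -> : N.+1%:R / N.+2%:R = 1 + - (N.+2%:R^-1) :> R.
  by rewrite -[X in X / _](addrK 1) natr1 mulrBl divff ?pnatr_eq0// mul1r.
apply: le_ln1Dx; rewrite ltrNl opprK invf_lt1 ?ltr0n// ltr1n.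
exact: isT.
Qed.

Lemma ln1D_le_near (e : R) : 0 < e ->
  \forall N \near \oo, ln (1 + ln (N%:R : R)) <= e * ln N%:R.
Proof.
move=> e0; near=> N.
have h : (e / 2 + ln (2 / e)) / (e / 2) <= ln N%:R by near: N; exact: ln_nat_near.
have N0 : (0 < N)%N by near: N; exact: nbhs_infty_gt.
have L0 : 0 <= ln (N%:R : R) by rewrite ln_ge0 ?ler1n.
have e20 : 0 < e / 2 by rewrite divr_gt0.
have p : 0 < (1 + ln (N%:R : R)) * (e / 2) by rewrite mulr_gt0// ltr_pwDl.
have := le_ln1Dx (x := (1 + ln N%:R) * (e / 2) - 1).
rewrite [1 + (_ - 1)]addrC subrK ltrBrDr addNr => /(_ p).
have -> : ln ((1 + ln N%:R) * (e / 2)) = ln (1 + ln N%:R) - ln (2 / e).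
  by rewrite -ln_div ?posrE ?divr_gt0// ?ltr_pwDl// invf_div.
move: h; rewrite ler_pdivrMr//.
move: (ln (1 + ln N%:R)) (ln (2 / e)) => y x.
move: (ln N%:R) => z *; lra.
Unshelve. all: by end_near. Qed.

End ConvexBounded.

Section DominantTerm.
Context {R : realType} (N : nat).
Implicit Types (c : 'I_N -> R[i]).

(** A term at least twice as large as all others together keeps the sum at half its size for every
    [t]. It serves at both ends of the real line, with the term [n = 1] on the right and [n = M] on
    the left. *)
Lemma logmean_dominant c i0 : c i0 != 0 ->
  \sum_(i | i != i0) normc (c i) <= normc (c i0) / 2 ->
  2 * ln (normc (c i0)) - 2 * ln 2 <= logmean c.
Proof.
move=> c0 h; have n0 : 0 < normc (c i0).
  by rewrite lt_neqAle normc_ge0 andbT eq_sym; apply: contra c0 => /eqP/Normc.eq0_normc ->.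
have b0 : 0 < normc (c i0) / 2 by rewrite divr_gt0.
apply: le_trans (logmean_ge (ex_intro _ i0 c0) b0 _).
  by rewrite lnXn// ln_div ?posrE// -[leRHS]mulr_natl mulrBr.
move=> t; have -> : dsum c t = c i0 * cis (freq i0 * t) + \sum_(i | i != i0) c i * cis (freq i * t).
  by rewrite /dsum /tsum (bigD1 i0).
have /ler_normlP[_] := normc_dist (c i0 * cis (freq i0 * t))
  (- \sum_(i | i != i0) c i * cis (freq i * t)).
rewrite opprK Normc.normcM normc_cis mulr1 normcN.
have : normc (\sum_(i | i != i0) c i * cis (freq i * t)) <= normc (c i0) / 2.
  apply: le_trans h; rewrite -big_filter -[leRHS]big_filter.
  apply: (le_trans (normc_sum _ _)); apply: ler_sum => i _.
  by rewrite Normc.normcM normc_cis mulr1.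
move: (normc (c i0)) (normc (\sum_(i | _) _)) (normc (_ + _)) => *; lra.
Qed.

End DominantTerm.

Section MaxCoprime.
Variables (q N : nat).
Hypothesis N0 : (0 < N)%N.

Lemma le_max_coprime n : (0 < n <= N)%N -> coprime n q -> (n <= max_coprime q N)%N.
Proof.
move=> nN cn; rewrite /max_coprime.
by apply: (@leq_bigmax_seq _ _ _ _ n) => //; rewrite mem_index_iota ltnS.
Qed.

Lemma max_coprime_gt0 : (0 < max_coprime q N)%N.
Proof. by apply: le_max_coprime; rewrite ?N0 ?coprime1n. Qed.

Lemma max_coprimeP : (max_coprime q N <= N)%N /\ coprime (max_coprime q N) q.
Proof.
have : max_coprime q N = 0 \/ (max_coprime q N <= N)%N /\ coprime (max_coprime q N) q.
  rewrite /max_coprime big_nat_cond.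
  elim/big_ind: _ => [|x y hx hy|n /andP[/andP[_ nN] cn]]; first by left.
    by rewrite /maxn; case: ifP.
  by right; rewrite -ltnS.
by case=> // M0; have := max_coprime_gt0; rewrite M0.
Qed.

End MaxCoprime.

(** * Upper and lower bounds for the values and slopes *)

Section JessenCharBounds.
Context {R : realType} (q : nat) (chi : nat -> R[i]).
Hypotheses (q_gt0 : (0 < q)%N) (chi_char : dirichlet_character q chi).
Variable N : nat.
Hypothesis N0 : (0 < N)%N.
Implicit Types (s t : R).

Let M := max_coprime q N.
Let J := @jessen_char R chi N.
Let c s := @dcoef R N chi s.
Let L : R := ln N%:R.
Let LM : R := ln M%:R.

Let M0 : (0 < M)%N. Proof. exact: max_coprime_gt0. Qed.
Let MN : (M <= N)%N. Proof. by have [] := max_coprimeP q N0. Qed.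
Let L0 : 0 <= L. Proof. by rewrite ln_ge0// ler1n. Qed.
Let LM0 : 0 <= LM. Proof. by rewrite ln_ge0// ler1n. Qed.

Lemma normc_char n : normc (chi n) = (coprime n q)%:R.
Proof.
by rewrite normc_nsq (nsq_char q_gt0 chi_char); case: coprime; rewrite ?sqrtr1 ?sqrtr0.
Qed.

Lemma normc_dcoef s i : normc (c s i) = (coprime i.+1 q)%:R * expR (s * freq i).
Proof.
rewrite /c /dcoef Normc.normcM normc_char; congr (_ * _).
by rewrite normc_nsq nsq_real sqrtr_sqr ger0_norm// expR_ge0.
Qed.

Lemma nsq_dcoef s i : nsq (c s i) = (coprime i.+1 q)%:R * expR (2 * (s * freq i)).
Proof.
rewrite nsq_normc normc_dcoef exprMn -expRM_natl; congr (_ * _).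
by case: coprime; rewrite ?expr1n ?expr0n.
Qed.

Lemma dcoef_first_neq0 s : exists i, c s i != 0.
Proof. by apply: dcoef_neq0; exact: (char_coef_neq0 chi_char). Qed.

Lemma jessen_charE s : J s = 2^-1 * logmean (c s).
Proof. by rewrite /J /jessen_char jessen_logmean//; exact: (char_coef_neq0 chi_char). Qed.

Lemma convexR_jessen_char : convexR J.
Proof.
have -> : J = fun s => 2^-1 * logmean (c s) by apply/funext => s; exact: jessen_charE.
apply: convexRZ; first by rewrite invr_ge0.
by apply: convex_logmean_dcoef; exact: (char_coef_neq0 chi_char).
Qed.

Lemma freq_bounds (i : 'I_N) : - L <= @freq R N i <= 0.
Proof.
rewrite /freq lerN2 oppr_le0 ln_ge0 ?ler1n// andbT.
by rewrite ler_ln ?posrE ?ltr0n// ler_nat.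
Qed.

Lemma jessen_char_le_sum s B : 0 < B -> \sum_(i < N) nsq (c s i) <= B ->
  J s <= 2^-1 * ln B.
Proof.
move=> B0 h; rewrite jessen_charE ler_wpM2l ?invr_ge0//.
apply: (le_trans (logmean_le_ln_l2 (dcoef_first_neq0 s))).
have [S0|S0] := ltP 0 (\sum_(i < N) nsq (c s i)); first by rewrite ler_ln ?posrE.
have [i ci] := dcoef_first_neq0 s.
have : nsq (c s i) <= 0.
  apply: le_trans S0; rewrite (bigD1 i)//= lerDl.
  by apply: sumr_ge0 => j _; exact: nsq_ge0.
by rewrite le_eqVlt ltNge nsq_ge0 orbF nsq_eq0 (negbTE ci).
Qed.

(** With [m] the positive part of [1/2 - s], each [n^(-2 s)] is at most [N^(2 m) / n]; the harmonic
    sum produces [1 + L]. *)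
Lemma jessen_char_le s : J s <= Num.max (2^-1 - s) 0 * L + 2^-1 * ln (1 + L).
Proof.
set m := Num.max _ _.
have m0 : 0 <= m by rewrite le_max lexx orbT.
have ms : 2^-1 - s <= m by rewrite le_max lexx.
have L1 : 0 < 1 + L by rewrite ltr_pwDl.
have := @jessen_char_le_sum s (expR (2 * (m * L)) * (1 + L)).
rewrite lnM ?posrE ?expR_gt0// expRK [2^-1 * (_ + _)]mulrDr [2^-1 * (2 * _)]mulrA mulVf// mul1r; apply.
  by rewrite mulr_gt0 ?expR_gt0.
apply: le_trans (_ : expR (2 * (m * L)) * \sum_(i < N) (i.+1%:R)^-1 <= _); last first.
  by rewrite ler_wpM2l ?expR_ge0// harmonic_le.
rewrite mulr_sumr; apply: ler_sum => i _; rewrite nsq_dcoef.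
have /andP[f1 f2] := freq_bounds i.
have -> : (i.+1%:R)^-1 = expR (freq i) :> R by rewrite /freq expRN lnK// posrE ltr0n.
rewrite -expRD; apply: (@le_trans _ _ (1 * expR (2 * (s * freq i)))).
  by rewrite ler_wpM2r ?expR_ge0//; case: coprime.
rewrite mul1r ler_expR.
have : (2^-1 - s) * (- freq i) <= m * (- freq i) by rewrite ler_wpM2r// oppr_ge0.
have : m * (- freq i) <= m * L by rewrite ler_wpM2l// lerNl.
by move: (freq i) => f; lra.
Qed.

Lemma jessen_char_nonincreasing s t : s <= t -> J t <= J s.
Proof.
apply: (@convexR_nonincreasing _ J (2^-1) (2^-1 * ln (1 + L)) convexR_jessen_char).
move=> x hx; apply: (le_trans (jessen_char_le x)); rewrite max_r ?subr_le0//.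
by rewrite mul0r add0r.
Qed.

(** Comparison of [(a + 1)^(-3)] with the telescoping [1 / (2 a (a + 1))]. Cubes are used because
    [logmean_dominant] needs a sum of at most [1/2], which inverse squares exceed. *)
Lemma sum_inv_cubes_le n : \sum_(i < n) expR (3 * - ln (i.+2%:R : R)) <= 2^-1 - 2^-1 / n.+1%:R.
Proof.
elim: n => [|n IH]; first by rewrite big_ord0 divr1 subrr.
rewrite big_ord_recr/=; apply: (le_trans (lerD IH (lexx _))).
have -> : expR (3 * - ln (n.+2%:R : R)) = (n.+2%:R ^+ 3)^-1.
  by rewrite mulrN expRN expRM_natl lnK// posrE ltr0n.
rewrite -[n.+2%:R]natr1; set a : R := n.+1%:R.
have a0 : 0 < a by rewrite ltr0n.
rewrite -lerBrDl.
have -> : 2^-1 - 2^-1 / (a + 1) - (2^-1 - 2^-1 / a) = (2 * a * (a + 1))^-1.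
  by field; rewrite gt_eqF// gt_eqF// ltr_pwDl.
have a1 : 0 < a + 1 by rewrite addr_gt0.
rewrite lef_pV2 ?posrE ?exprn_gt0 ?mulr_gt0// exprS expr2 [leRHS]mulrC ler_pM2r//.
by rewrite -subr_ge0 (_ : _ - _ = a ^+ 2 + 1); [rewrite addr_ge0 ?sqr_ge0|ring].
Qed.

Lemma jessen_char_ge s : - ln 2 <= J s.
Proof.
(* [J] is nonincreasing, so the bound may be proved further to the right; from abscissa [3] on the
   term [n = 1] dominates. *)
pose t := Num.max s 3.
have st : s <= t by rewrite le_max lexx.
have t3 : 3 <= t by rewrite le_max lexx orbT.
apply: le_trans (jessen_char_nonincreasing st).
pose i0 : 'I_N := Ordinal N0.
have fi0 : freq i0 = 0 :> R by rewrite /freq/= ln1 oppr0.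
have ni0 : normc (c t i0) = 1.
  by rewrite normc_dcoef/= coprime1n fi0 mulr0 expR0 mulr1.
have c0 : c t i0 != 0.
  by apply/eqP => c0; move: ni0; rewrite c0 Normc.normc0 => /eqP; rewrite eq_sym oner_eq0.
have := logmean_dominant c0; rewrite ni0 ln1 mulr0 sub0r jessen_charE => H.
suff : - (2 * ln 2) <= logmean (c t) by move: (logmean _) => l; lra.
apply: H; apply: (@le_trans _ _ (\sum_(i | i != i0) expR (3 * - ln (i.+1%:R : R)))).
  apply: ler_sum => i _; rewrite normc_dcoef.
  apply: (@le_trans _ _ (1 * expR (t * freq i))).
    by rewrite ler_wpM2r ?expR_ge0//; case: coprime.
  rewrite mul1r ler_expR; have /andP[_ f2] := freq_bounds i.
  by rewrite -/(freq i) ler_wnM2r.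
clear - N0 R; case: N N0 @i0 => // n n0 i0.
have E : \sum_(i < n.+1 | i != i0) expR (3 * - ln (i.+1%:R : R)) =
    \sum_(i < n) expR (3 * - ln (i.+2%:R : R)).
  apply: (addrI (expR (3 * - ln (1%:R : R)))).
  transitivity (\sum_(i < n.+1) expR (3 * - ln (i.+1%:R : R))); last exact: big_ord_recl.
  by rewrite [RHS](bigD1 i0).
rewrite E; apply: (le_trans (sum_inv_cubes_le n)).
by rewrite mul1r gerBl divr_ge0.
Qed.

(** For [x <= 0] all nonzero terms satisfy [n^(-x) <= M^(-x)], so the convex function [J x + x * LM]
    is bounded above towards minus infinity, and a convex function bounded there cannot decrease. *)
Lemma jessen_char_addlin_nondecreasing s t : s <= t -> J s + s * LM <= J t + t * LM.
Proof.
apply: (@convexR_nondecreasing _ (fun s => J s + s * LM) 0 (2^-1 * L)).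
  by apply: convexR_addlin; exact: convexR_jessen_char.
move=> x x0; have NR : 0 < N%:R :> R by rewrite ltr0n.
have := @jessen_char_le_sum x (N%:R * expR (- (2 * (x * LM)))).
rewrite mulr_gt0 ?expR_gt0// lnM ?posrE ?expR_gt0// expRK -/L => /(_ isT) h.
suff /h : \sum_(i < N) nsq (c x i) <= N%:R * expR (- (2 * (x * LM))).
  by move: (J x) (x * LM) L => a b d; lra.
rewrite -[N in N%:R]card_ord mulrC mulr_natr -sumr_const; apply: ler_sum => i _.
rewrite nsq_dcoef; have [cop|] := boolP (coprime i.+1 q); last by rewrite mul0r expR_ge0.
rewrite mul1r ler_expR -mulrN ler_pM2l// /freq mulrN lerN2 ler_wnM2l//.
rewrite ler_ln ?posrE ?ltr0n// ler_nat.
by apply: le_max_coprime => //; exact: ltn_ord.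
Qed.

(** For [n < M] one has [ln n - ln M <= - 1 / M], so the term [n] is at most [exp (s / M)] times the
    term [M]. The threshold makes this factor at most [1 / (2 N)], and the other terms together stay
    below one half of the term [M]. *)
Lemma jessen_char_addlin_ge s : s <= - (M%:R * ln (2 * N%:R)) -> - ln 2 <= J s + s * LM.
Proof.
move=> hs; have i0N : (M.-1 < N)%N by rewrite prednK.
have l2 : 0 <= ln (2 * N%:R : R) by rewrite ln_ge0// -natrM ler1n muln_gt0.
have MR : 0 < M%:R :> R by rewrite ltr0n.
have s0 : s <= 0 by apply: (le_trans hs); rewrite oppr_le0 mulr_ge0.
pose i0 : 'I_N := Ordinal i0N.
have fi0 : freq i0 = - LM by rewrite /freq/= prednK.
have ni0 : normc (c s i0) = expR (- (s * LM)).
  by rewrite normc_dcoef/= prednK// (proj2 (max_coprimeP q N0)) fi0 mul1r mulrN.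
have c0 : c s i0 != 0.
  apply/eqP => c0; move: ni0; rewrite c0 Normc.normc0 => /eqP.
  by rewrite eq_sym gt_eqF// expR_gt0.
have := logmean_dominant c0; rewrite ni0 expRK => H.
suff /H : \sum_(i | i != i0) normc (c s i) <= expR (- (s * LM)) / 2.
  by rewrite jessen_charE; move: (logmean _) (s * LM) => l d; lra.
have NR : 0 < N%:R :> R by rewrite ltr0n.
apply: (@le_trans _ _ (\sum_(i < N) expR (- (s * LM)) / (2 * N%:R))); last first.
  rewrite sumr_const card_ord -mulr_natr.
  by apply: eq_ler; field; rewrite gt_eqF.
rewrite [leRHS](bigID (fun i => i != i0))/= -[leLHS]addr0; apply: lerD; last first.
  by apply: sumr_ge0 => i _; rewrite divr_ge0 ?expR_ge0// mulr_ge0.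
apply: ler_sum => i ii0; rewrite normc_dcoef.
have [cop|_] := boolP (coprime i.+1 q); last first.
  by rewrite mul0r divr_ge0 ?expR_ge0// mulr_ge0.
have iM : (i.+1 < M)%N.
  rewrite ltn_neqAle le_max_coprime ?ltn_ord// andbT.
  apply: contra ii0 => /eqP iM; rewrite -val_eqE/= -eqSS prednK//.
  exact/eqP.
rewrite mul1r -[X in _ / X]lnK ?posrE ?mulr_gt0// -expRN -expRD ler_expR.
have iR : 0 < i.+1%:R :> R by rewrite ltr0n.
have key : ln (i.+1%:R) - LM <= - (M%:R)^-1 :> R.
  rewrite /LM -ln_div ?posrE//.
  have -> : i.+1%:R / M%:R = 1 + (i.+1%:R / M%:R - 1) :> R by rewrite addrC subrK.
  apply: (le_trans (le_ln1Dx _)); first by rewrite ltrBrDr addNr divr_gt0.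
  rewrite lerBlDr ler_pdivrMr// mulrDl mulNr mulVf ?gt_eqF// mul1r addrC.
  by rewrite lerBrDr natr1 ler_nat.
rewrite /freq mulrN.
have h1 : s * (- (M%:R)^-1) <= s * (ln i.+1%:R - LM) by rewrite ler_wnM2l.
have h2 : s / M%:R <= - ln (2 * N%:R) by rewrite ler_pdivrMr// mulNr mulrC.
by move: h1 h2; rewrite /LM; move: (ln (2 * _)) (ln _) (ln _) (_^-1) => x y z w; lra.
Qed.

End JessenCharBounds.

(** * Locally uniform convergence *)

Section LocallyUniform.
Context {R : realType} (q : nat) (chi : nat -> R[i]).
Hypotheses (q_gt0 : (0 < q)%N) (chi_char : dirichlet_character q chi).

Lemma jessen_char_uniform (A e : R) : 0 < e -> \forall N \near \oo, forall s, `|s| <= A ->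
  `|jessen_char chi N s / ln N%:R - Num.max (2^-1 - s) 0| <= e.
Proof.
(* All errors below are multiples of [d * L], with a factor growing linearly in [|s| <= A]; the
   denominator absorbs them. *)
move=> e0; pose d := e / (5 + 4 * `|A|).
have A5 : 0 < 5 + 4 * `|A| by rewrite ltr_pwDl// mulr_ge0.
have d0 : 0 < d by rewrite divr_gt0.
have de : d * (5 + 4 * `|A|) = e by rewrite divfK// gt_eqF.
clearbody d.
near=> N => s sA.
have N0 : (0 < N)%N by near: N; exact: nbhs_infty_gt.
have L1 : 1 <= ln (N%:R : R) by near: N; exact: ln_nat_near.
have L2 : ln 2 / e <= ln (N%:R : R) by near: N; exact: ln_nat_near.
have LL : ln (1 + ln (N%:R : R)) <= d * ln N%:R by near: N; exact: ln1D_le_near.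
have J0 : (2^-1 - d) * ln N%:R <= jessen_char chi N 0.
  by near: N; exact: (jessen_char_zero_ge q_gt0 chi_char).
have up := jessen_char_le q_gt0 chi_char N0.
have lo := jessen_char_ge q_gt0 chi_char N0 s.
have lin := @jessen_char_addlin_nondecreasing _ _ _ q_gt0 chi_char _ N0 0 s.
have cvx := @convexR_jessen_char _ _ _ chi_char _ N0 s 0 2^-1.
have up0 := up 2^-1; have {}up := up s.
have MN : ln (max_coprime q N)%:R <= ln (N%:R : R).
  have [MN _] := max_coprimeP q N0.
  by rewrite ler_ln ?posrE ?ltr0n// ?ler_nat// max_coprime_gt0.
move: up0; rewrite subrr maxxx mul0r add0r => up0.
set J := jessen_char chi N in J0 up lo lin cvx up0 *.
move: (ln N%:R) L1 L2 LL J0 up lin MN up0 => L L1 L2 LL J0 up lin ML up0.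
clearbody J; have L0 : 0 < L by lra.
have Le : ln 2 <= e * L by rewrite mulrC -ler_pdivrMr.
set m := Num.max _ _ in up *.
have -> : J s / L - m = (J s - m * L) / L by rewrite mulrBl mulfK// gt_eqF.
rewrite normrM [X in _ * X]gtr0_norm ?invr_gt0// ler_pdivrMr// ler_distl.
have dL0 : 0 <= d * L by rewrite mulr_ge0// ltW.
have dAL0 : 0 <= d * `|A| * L by rewrite !mulr_ge0// ltW.
have eL : e * L = 5 * (d * L) + 4 * (d * `|A| * L) by rewrite -de; ring.
apply/andP; split; last by apply: (le_trans up); rewrite lerD2l eL; lra.
(* Three ranges for the lower bound: beyond [1/2] the constant [- ln 2] suffices; on [[0, 1/2]] the
   slope is at least [- L] starting from [0]; for [s < 0] the line through the points over [0] and
   [1/2] lies below [J]. *)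
have [s2|s2] := leP 2^-1 s.
  by rewrite /m max_r ?subr_le0// mul0r sub0r; lra.
have mE : m = 2^-1 - s by rewrite /m max_l// subr_ge0 ltW.
rewrite mE; have [s0|s0] := leP 0 s.
  have := lin s0; rewrite mul0r addr0.
  have : s * ln (max_coprime q N)%:R <= s * L by rewrite ler_wpM2l.
  by rewrite eL; lra.
have h2 : 0 < 2^-1 :> R by rewrite invr_gt0.
move: cvx; rewrite s0 h2 => /(_ isT); rewrite subr0 sub0r.
have : (2^-1 - s) * ((2^-1 - d) * L) <= (2^-1 - s) * J 0 by rewrite ler_wpM2l//; lra.
have : - s * J 2^-1 <= - s * (2^-1 * (d * L)).
  by rewrite ler_wpM2l//; lra.
have : - s * (d * L) <= d * `|A| * L.
  have -> : d * `|A| * L = `|A| * (d * L) by ring.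
  by rewrite ler_wpM2r// (le_trans (ler_norm _))// normrN (le_trans sA)// ler_norm.
move: (J s) (J 0) (J 2^-1) => x y z; rewrite eL; lra.
Unshelve. all: by end_near. Qed.

Lemma jessen_char_locally_uniform : locally_uniform_cvg
  (fun N sigma => jessen_char chi N sigma / ln N%:R)
  (fun sigma => Num.max (2^-1 - sigma) 0).
Proof.
move=> x; exists (ball x 1); first exact: nbhsx_ballx.
move=> P /uniform_nbhs[E [/= entE EP]].
move: entE; rewrite -entourage_ballE => -[e /= e0 eE].
have e20 : 0 < e / 2 by rewrite divr_gt0.
have := @jessen_char_uniform (`|x| + 1) _ e20.
apply: filterS => N h; apply: EP => y xy /=; apply: eE => /=.
rewrite /ball/= distrC (le_lt_trans (h y _))//; last by rewrite ltr_pdivrMr// ltr_pMr// ltr1n.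
move: xy; rewrite /ball/= => xy.
by rewrite -[y](subrK x) (le_trans (ler_normD _ _))// addrC lerD2l distrC ltW.
Qed.

End LocallyUniform.

(** * Second derivatives of convex functions *)

Section ConvexSecondDerivative.
Context {R : realType} (f : R -> R).
Hypothesis cf : convexR f.
Implicit Types (x y h k : R).

Let slope x h : R := (f (x + h) - f x) / h.

Lemma slope_le x h k : 0 < h -> h <= k -> slope x h <= slope x k.
Proof.
move=> h0; rewrite le_eqVlt => /predU1P[->//|hk].
have k0 := lt_trans h0 hk.
have := @cf x (x + h) (x + k); rewrite ltrDl h0 ltrD2l hk => /(_ isT).
rewrite /slope ler_pdivrMr// mulrAC ler_pdivlMr//.
by move: (f x) (f (x + h)) (f (x + k)) => a b c; lra.
Qed.

Lemma left_slope_le x h k : 0 < h -> 0 < k -> (f x - f (x - k)) / k <= slope x h.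
Proof.
move=> h0 k0; have := @cf (x - k) x (x + h).
rewrite ltrDl h0 gtrBl k0 => /(_ isT).
rewrite /slope ler_pdivrMr// mulrAC ler_pdivlMr//.
by move: (f x) (f (x + h)) (f (x - k)) => a b c; lra.
Qed.

Lemma right_derivative_cvg x : slope x h @[h --> 0^'+] --> right_derivative f x.
Proof.
have : cvg (slope x h @[h --> 0^'+]).
  apply: nondecreasing_at_right_is_cvgr.
    near=> b => h k; rewrite !in_itv/= => /andP[h0 _] /andP[k0 _]; exact: slope_le.
  apply: nearW => b; exists ((f x - f (x - 1)) / 1) => y [h].
  rewrite /= in_itv/= => /andP[h0 _] <-.
  exact: left_slope_le.
by [].
Unshelve. all: by end_near. Qed.

Lemma right_derivative_le x y : x < y -> right_derivative f x <= (f y - f x) / (y - x).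
Proof.
move=> xy; have d0 : 0 < y - x by rewrite subr_gt0.
have -> : (f y - f x) / (y - x) = slope x (y - x) by rewrite /slope [x + _]addrC subrK.
apply: limr_le; first exact: right_derivative_cvg.
near=> h; apply: slope_le; first by near: h; exact: nbhs_right_gt.
by near: h; exact: nbhs_right_le.
Unshelve. all: by end_near. Qed.

Lemma right_derivative_ge x y : x < y -> (f y - f x) / (y - x) <= right_derivative f y.
Proof.
move=> xy; have d0 : 0 < y - x by rewrite subr_gt0.
apply: limr_ge; first exact: right_derivative_cvg.
near=> h; have -> : f x = f (y - (y - x)) by rewrite subKr.
by apply: left_slope_le => //; near: h; exact: nbhs_right_gt.
Unshelve. all: by end_near. Qed.

Lemma right_derivative_nondecreasing : nondecreasing (right_derivative f).
Proof.
move=> x y; rewrite le_eqVlt => /predU1P[->//|xy].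
by apply: le_trans (right_derivative_le xy) (right_derivative_ge xy).
Qed.

Lemma right_derivative_right_continuous : right_continuous (right_derivative f).
Proof.
move=> x; apply/cvgrPdist_le => e e0; set D := right_derivative f.
have e20 : 0 < e / 2 by rewrite divr_gt0.
have [h [h0 hD]] : exists h, 0 < h /\ slope x h <= D x + e / 2.
  have /cvgrPdist_le/(_ _ e20) H := @right_derivative_cvg x.
  near (0 : R)^'+ => h; exists h; split; first by near: h; exact: nbhs_right_gt.
  have : `|D x - slope x h| <= e / 2 by near: h.
  by rewrite ler_distlC => /andP[_].
near=> y.
have xy : x < y by near: y; exact: nbhs_right_gt.
(* The chord from [y] to [x + h] then has length at least [h / 2], so the error [e / 2] at most
   doubles. *)
have yh : y < x + h / 2 by near: y; apply: nbhs_right_lt; rewrite ltrDl divr_gt0.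
have h20 : h / 2 < h by rewrite ltr_pdivrMr// ltr_pMr// ltr1n.
have yh' : y < x + h by apply: (lt_trans yh); rewrite ltrD2l.
rewrite distrC ger0_norm ?subr_ge0; last by apply: right_derivative_nondecreasing; exact: ltW.
rewrite lerBlDr; apply: (le_trans (right_derivative_le yh')).
have := right_derivative_le xy; rewrite -/D ler_pdivlMr ?subr_gt0// => Dxy.
rewrite ler_pdivrMr ?subr_gt0//.
move: hD; rewrite /slope ler_pdivrMr// => hD.
have : e * (x + h - y) >= e / 2 * h.
  rewrite -mulrA ler_wpM2l ?(ltW e0)//; lra.
move: (f x) (f y) (f (x + h)) (D x) hD Dxy => a b c d; lra.
Unshelve. all: by end_near. Qed.

(** Monotonicity and right continuity of the derivative rule out the default in [cumulative_or0]. *)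
Lemma second_derivative_itv a b : a <= b ->
  second_derivative_measure f `]a, b]%classic =
  (right_derivative f b - right_derivative f a)%:E.
Proof.
move=> ab; rewrite /second_derivative_measure/= /lebesgue_stieltjes_measure.
rewrite /measure_extension measurable_mu_extE/=; last exact: is_ocitv.
rewrite wlength_itv_bnd// /cumulative_or0; case: pselect => // -[]; split.
  exact: right_derivative_nondecreasing.
exact: right_derivative_right_continuous.
Qed.

Lemma second_derivative_setT l r :
  right_derivative f x @[x --> -oo] --> l -> right_derivative f x @[x --> +oo] --> r ->
  second_derivative_measure f [set: R] = (r - l)%:E.
Proof.
move=> Dl Dr; rewrite -(bigcup_itvT false false).
pose I n : set R := `]- (n%:R), n%:R]%classic.
have h1 : (second_derivative_measure f \o I) n @[n --> \oo] --> (r - l)%:E.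
  have -> : second_derivative_measure f \o I =
      (fun n => (right_derivative f n%:R - right_derivative f (- n%:R))%:E).
    by apply/funext => n /=; rewrite second_derivative_itv// ge0_cp.
  apply/cvg_EFin; first by near=> n.
  apply: cvgB; first exact/(cvg_comp _ _ (@cvgr_idn R)).
  apply: (cvg_ninftyP _ _).1 => //.
  by apply: (cvg_comp _ _ (@cvgr_idn R)); rewrite ninfty.
have : (second_derivative_measure f \o I) n @[n --> \oo] -->
    second_derivative_measure f (\bigcup_n I n).
  apply: nondecreasing_cvg_mu; rewrite /I//; first exact: bigcup_measurable.
  by move=> *; apply/subsetPset/subset_itv; rewrite leBSide/= ?lerN2 ler_nat.
by move=> h2; rewrite -(cvg_unique _ h1 h2).
Unshelve. all: end_near. Qed.

End ConvexSecondDerivative.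

(** * A criterion for weak convergence to a point mass *)

Section WeakConvergenceToDirac.
Context {R : realType}.
Local Open Scope ereal_scope.

(** Inside the interval continuity at [a] applies; outside, the boundedness of [f] is multiplied by
    a vanishing mass. Half-open intervals are those on which Stieltjes measures are computed
    directly. *)
Lemma weak_cvg_dirac (mu : nat -> {measure set (measurableTypeR R) -> \bar R}) (a : R) :
  (\forall N \near \oo, mu N [set: R] = 1) ->
  (forall h e : R, (0 < h)%R -> (0 < e)%R ->
     \forall N \near \oo, (1 - e)%:E <= mu N `](a - h)%R, (a + h)%R]%classic) ->
  weak_cvg mu (dirac (a : measurableTypeR R)).
Proof.
move=> mu1 muI f ctf [B [Breal fB]].
have {B Breal fB} [B B0 fB] : exists2 B : R, (0 < B)%R & forall x : R, (`|f x| <= B)%R.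
  exists (`|B| + 1)%R; first by rewrite ltr_wpDl.
  by move=> x; apply: fB => //; rewrite (le_lt_trans (ler_norm _))// ltrDl.
have mf : measurable_fun [set: measurableTypeR R] f by exact: continuous_measurable_fun.
have -> : \int[dirac (a : measurableTypeR R)]_x (f x)%:E = (f a)%:E.
  by rewrite integral_dirac ?diracE ?in_setT ?mul1e//; exact/measurable_EFinP.
have mI h : measurable (`](a - h)%R, (a + h)%R]%classic : set (measurableTypeR R)).
  exact: measurable_itv.
have intg N (g : R -> R) : mu N [set: R] = 1 -> measurable_fun [set: measurableTypeR R] g ->
    (exists C : R, forall x : R, (`|g x| <= C)%R) -> (mu N).-integrable [set: R] (EFin \o g).
  move=> m1 mg [C gC]; apply: measurable_bounded_integrable => //; first by rewrite m1 ltry.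
  by exists C; split; [exact: num_real|move=> M CM x _ /=; rewrite (le_trans (gC x))// ltW].
apply/fine_cvgP; split.
  apply: filterS mu1 => N m1; apply: integrable_fin_num => //; apply: intg => //.
  by exists B.
apply/cvgrPdist_le => e e0.
have e20 : (0 < e / 2)%R by rewrite divr_gt0.
have /cvgrPdist_le/(_ _ e20)/nbhs_ballP[h /= h0 hf] := ctf a.
have h20 : (0 < h / 2)%R by rewrite divr_gt0.
(* Outside the interval [f] differs from [f a] by at most [2 B], so this mass costs [e / 2]. *)
have d0 : (0 < e / (4 * B))%R by rewrite divr_gt0// mulr_gt0.
near=> N.
have m1 : mu N [set: R] = 1 by near: N.
set I : set (measurableTypeR R) := `](a - h / 2)%R, (a + h / 2)%R]%classic.
have mIm : measurable I by exact: mI.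
have mI1 : (1 - e / (4 * B))%:E <= mu N I by near: N; exact: muI.
have mu_fin : mu N I \is a fin_num.
  rewrite ge0_fin_numE//; have : mu N I <= mu N [set: R].
    by apply: le_measure; rewrite ?inE//; exact: mI.
  by rewrite m1 => /le_lt_trans; apply; rewrite ltry.
have mC : mu N (~` I) <= (e / (4 * B))%:E.
  have : 1 = mu N I + mu N (~` I).
    have := measureU (mu N) mIm (measurableC mIm) (setICr I).
    by rewrite setUv => <-; exact/esym.
  move: mI1 mu_fin.
  case: (mu N I) => [r| |]// + _; case: (mu N _) => [s| |]//.
  by rewrite -EFinD !lee_fin => + [] ; lra.
have mind : measurable_fun [set: measurableTypeR R] (\1_(~` I) : R -> R).
  by apply: measurable_indic; exact: measurableC.
have IfB x : (`|f x - f a| <= e / 2 + 2 * B * \1_(~` I) x)%R.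
  have [xI|xI] := pselect (I x).
    rewrite indicE memNset ?mulr0 ?addr0; last by move=> /(_ xI).
    rewrite distrC; apply: hf; rewrite /ball/=.
    move: xI; rewrite /I/= in_itv/= => /andP[x1 x2].
    by rewrite ltr_distl; apply/andP; split; lra.
  rewrite indicE mem_set// mulr1 (le_trans (ler_normB _ _))//.
  by rewrite (le_trans (lerD (fB x) (fB a)))//; lra.
have cst_bnd (r : R) : exists C : R, forall x : R, (`|cst r x| <= C)%R by exists `|r|%R.
have key : `|\int[mu N]_x ((f x)%:E - (f a)%:E)| <= e%:E.
  have mfa : measurable_fun [set: measurableTypeR R] (fun x => (f x)%:E - (f a)%:E).
    by apply/measurable_EFinP; apply: measurable_funB.
  apply: (le_trans (le_abse_integral _ _ mfa)) => //.
  apply: (@le_trans _ _ (\int[mu N]_x ((e / 2)%:E + (2 * B)%:E * (\1_(~` I) x)%:E))).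
    apply: ge0_le_integral => //.
    - exact: measurableT_comp.
    - by apply: emeasurable_funD => //; apply: measurable_funeM; exact/measurable_EFinP.
    - by move=> x _; rewrite -EFinB abse_EFin -EFinM -EFinD lee_fin; exact: IfB.
  have ind0 x : 0 <= (2 * B)%:E * (\1_(~` I) x)%:E :> \bar R.
    by rewrite -EFinM lee_fin mulr_ge0// mulr_ge0// ltW.
  rewrite ge0_integralD//; last 2 first.
  - by move=> x _; rewrite lee_fin ltW.
  - by apply: measurable_funeM; exact/measurable_EFinP.
  rewrite integral_cst// m1 mule1 ge0_integralZl_EFin//; last 2 first.
  - exact/measurable_EFinP.
  - by rewrite mulr_ge0// ltW.
  rewrite integral_indic//; last exact: measurableC.
  rewrite setIT; apply: (@le_trans _ _ ((e / 2)%:E + (2 * B)%:E * (e / (4 * B))%:E)).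
    by rewrite leeD2l// lee_pmul2l// lte_fin mulr_gt0.
  rewrite -EFinM -EFinD lee_fin le_eqVlt; apply/orP; left; apply/eqP.
  by field; rewrite gt_eqF.
move: key; rewrite integralB_EFin//; last 2 first.
- by apply: intg => //; exists B.
- exact: (intg N (cst (f a))).
rewrite integral_cst// m1 mule1.
case: (\int[mu N]_x (f x)%:E) => [r| |]//=.
by rewrite lee_fin distrC.
Unshelve. all: end_near. Qed.

End WeakConvergenceToDirac.

(** * Total mass and concentration of the second derivative *)

Section CharacterMeasures.
Context {R : realType} (q : nat) (chi : nat -> R[i]).
Hypotheses (q_gt0 : (0 < q)%N) (chi_char : dirichlet_character q chi).

Section FixedN.
Variable N : nat.
Hypothesis N0 : (0 < N)%N.
Let J := @jessen_char R chi N.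
Let D := right_derivative J.
Let L : R := ln N%:R.
Let LM : R := ln (max_coprime q N)%:R.
Let cJ : convexR J. Proof. exact: (convexR_jessen_char chi_char N0). Qed.

(** From [1/2] on, [J] can drop by at most [C], because it stays above [- ln 2]. The slope at [x] is
    thus at least [- C] over the distance to [1/2]. *)
Lemma jessen_char_deriv_pinfty : D x @[x --> +oo] --> (0 : R).
Proof.
pose C := 2^-1 * ln (1 + L) + ln 2.
have L0 : 0 <= L by rewrite ln_ge0// ler1n.
have C0 : 0 <= C.
  by rewrite addr_ge0 ?mulr_ge0 ?ln_ge0 ?ler1n// lerDl.
have bnd x : 2^-1 < x -> - C / (x - 2^-1) <= D x <= 0.
  move=> x2; have x0 : 0 < x - 2^-1 by rewrite subr_gt0.
  apply/andP; split.
    apply: le_trans (right_derivative_ge cJ x2); rewrite ler_pM2r ?invr_gt0//.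
    have := jessen_char_le q_gt0 chi_char N0 2^-1; rewrite subrr maxxx mul0r add0r.
    have := jessen_char_ge q_gt0 chi_char N0 x.
    by rewrite -/J -/L /C; move: (J x) (J _) (ln (1 + L)) => a b c *; lra.
  have x1 : x < x + 1 by rewrite ltrDl.
  apply: (le_trans (right_derivative_le cJ x1)).
  rewrite ler_pdivrMr ?subr_gt0// mul0r subr_le0.
  exact: (jessen_char_nonincreasing q_gt0 chi_char N0 (ltW x1)).
apply/cvgrPdist_le => e e0; near=> x.
have x2 : 2^-1 < x by near: x; exact: nbhs_pinfty_gt.
have xC : C / e + 2^-1 < x by near: x; apply: nbhs_pinfty_gt; exact: num_real.
have /andP[h1 h2] := bnd _ x2.
rewrite sub0r normrN ler0_norm// lerNl (le_trans _ h1)// mulNr lerN2.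
by rewrite ler_pdivrMr ?subr_gt0// mulrC -ler_pdivrMr// lerBrDr ltW.
Unshelve. all: by end_near. Qed.

(** The mirror argument for [J s + s * LM], which is nondecreasing and stays above [- ln 2] to the
    left of [S]. *)
Lemma jessen_char_deriv_ninfty : D x @[x --> -oo] --> - LM.
Proof.
pose S : R := - ((max_coprime q N)%:R * ln (2 * N%:R)).
pose C := J S + S * LM + ln 2.
have low s : s <= S -> - ln 2 <= J s + s * LM.
  exact: (jessen_char_addlin_ge q_gt0 chi_char N0).
have C0 : 0 <= C by rewrite /C -lerBlDr sub0r low.
have bnd x : x < S -> - LM <= D x <= - LM + C / (S - x).
  move=> xS; have x0 : 0 < S - x by rewrite subr_gt0.
  apply/andP; split.
    have x1 : x - 1 < x by rewrite gtrBl.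
    apply: le_trans (right_derivative_ge cJ x1).
    rewrite subKr divr1.
    have := jessen_char_addlin_nondecreasing q_gt0 chi_char N0 (ltW x1).
    by rewrite -/J -/LM; move: (J x) (J _) LM => a b c; lra.
  apply: (le_trans (right_derivative_le cJ xS)).
  have -> : - LM + C / (S - x) = (C - LM * (S - x)) / (S - x).
    by field; rewrite gt_eqF.
  rewrite ler_pM2r ?invr_gt0// /C.
  have := low _ (ltW xS); move: (J x) (J S) LM => a b c; lra.
apply/cvgrPdist_le => e e0; near=> x.
have xS : x < S by near: x; apply: nbhs_ninfty_lt; exact: num_real.
have xC : x < S - C / e by near: x; apply: nbhs_ninfty_lt; exact: num_real.
have /andP[h1 h2] := bnd _ xS.
rewrite distrC ger0_norm ?subr_ge0// lerBlDl (le_trans h2)// lerD2l.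
by rewrite ler_pdivrMr ?subr_gt0// mulrC -ler_pdivrMr// lerBrDr -lerBrDl ltW.
Unshelve. all: by end_near. Qed.

Lemma jessen_char_measure_setT : (1 < max_coprime q N)%N ->
  jessen_char_measure q chi N [set: R] = 1%E.
Proof.
move=> M1; transitivity (LM^-1%:E * second_derivative_measure J [set: R])%E; first by [].
rewrite (second_derivative_setT cJ jessen_char_deriv_ninfty jessen_char_deriv_pinfty).
rewrite sub0r opprK -EFinM mulVf// gt_eqF// ln_gt0// ltr1n//.
Qed.

End FixedN.

Lemma max_coprime_gt1 : \forall N \near \oo, (1 < max_coprime q N)%N.
Proof.
exists q.+1 => // N /= qN; apply: (@leq_trans q.+1); first by rewrite ltnS.
by apply: le_max_coprime => //; rewrite coprimeSn.
Qed.

(** The [j] are values of [J] at [1/2 - h], [1/2 - h / 2], [1/2 + h / 2] and [1/2 + h]; [d1] and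
    [d2] are its right derivatives at the two outer points. Each value carries an error [d * l],
    hence the factor [4]. *)
Lemma slope_gap (h d l j1 j2 j3 j4 d1 d2 : R) :
  (h - d) * l <= j1 -> j2 <= (h / 2 + d) * l -> j3 <= (0 + d) * l -> (0 - d) * l <= j4 ->
  d1 * (h / 2) <= j2 - j1 -> j4 - j3 <= d2 * (h / 2) ->
  h / 2 * l - 4 * (d * l) <= d2 * (h / 2) - d1 * (h / 2).
Proof. by move: (d1 * _) (d2 * _) => a b; lra. Qed.

Lemma jessen_char_measure_concentrates (h e : R) : 0 < h -> 0 < e ->
  \forall N \near \oo,
    ((1 - e)%:E <= jessen_char_measure q chi N `](2^-1 - h)%R, (2^-1 + h)%R]%classic)%E.
Proof.
(* Four errors [d * L] over chords of length [h / 2] change the slope by [8 d L / h = e L]. *)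
move=> h0 e0; pose d := e * h / 8.
have d0 : 0 < d by rewrite divr_gt0// mulr_gt0.
have near_half k : `|k| <= h -> `|2^-1 + k| <= 2^-1 + h.
  by move=> kh; rewrite (le_trans (ler_normD _ _))// gtr0_norm ?invr_gt0// lerD2l.
have h2h : h / 2 <= h by rewrite ler_pdivrMr// ler_peMr ?(ltW h0)// ler1n.
near=> N.
have N1 : (1 < N)%N by near: N; exact: nbhs_infty_gt.
have N0 : (0 < N)%N by exact: ltnW.
have M1 : (1 < max_coprime q N)%N by near: N; exact: max_coprime_gt1.
have unif (s : R) : `|s| <= 2^-1 + h ->
    `|jessen_char chi N s / ln N%:R - Num.max (2^-1 - s) 0| <= d.
  by move: s; near: N; exact: (jessen_char_uniform q_gt0 chi_char).
set J := jessen_char chi N in unif.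
have cJ : convexR J by exact: (convexR_jessen_char chi_char N0).
have L0 : 0 < ln (N%:R : R) by rewrite ln_gt0// ltr1n.
have LM0 : 0 < ln ((max_coprime q N)%:R : R) by rewrite ln_gt0// ltr1n.
have LML : ln (max_coprime q N)%:R <= ln (N%:R : R).
  have [MN _] := max_coprimeP q N0.
  by rewrite ler_ln ?posrE ?ltr0n// ?ler_nat// ltnW.
have hh : 2^-1 - h <= 2^-1 + h by rewrite lerD2l ge0_cp// ltW.
have -> : jessen_char_measure q chi N `](2^-1 - h)%R, (2^-1 + h)%R]%classic =
    ((ln (max_coprime q N)%:R)^-1%:E *
      second_derivative_measure J `](2^-1 - h)%R, (2^-1 + h)%R]%classic)%E by [].
rewrite second_derivative_itv// -EFinM lee_fin.
set L := ln (N%:R : R) in unif L0 LML *; set LM := ln (_%:R : R) in LM0 LML *.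
have J1 s : `|s| <= 2^-1 + h -> (Num.max (2^-1 - s) 0 - d) * L <= J s <= (Num.max (2^-1 - s) 0 + d) * L.
  by move=> /unif; rewrite ler_distl => /andP[]; rewrite ler_pdivlMr// ler_pdivrMr// => -> ->.
have h20 : 0 < h / 2 by rewrite divr_gt0.
have := right_derivative_ge cJ (_ : 2^-1 + h / 2 < 2^-1 + h).
have := right_derivative_le cJ (_ : 2^-1 - h < 2^-1 - h / 2).
have -> : 2^-1 - h / 2 - (2^-1 - h) = h / 2 by field.
have -> : 2^-1 + h - (2^-1 + h / 2) = h / 2 by field.
move=> /(_ _) D1 /(_ _) D2.
have {}D1 := D1 ltac:(by rewrite ltrD2l ltrN2 ltr_pdivrMr// ltr_pMr// ltr1n).
have {}D2 := D2 ltac:(by rewrite ltrD2l ltr_pdivrMr// ltr_pMr// ltr1n).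
have DD : right_derivative J (2^-1 - h) <= right_derivative J (2^-1 + h).
  exact: right_derivative_nondecreasing.
have /andP[j1 _] : (h - d) * L <= J (2^-1 - h) <= (h + d) * L.
  have := J1 (2^-1 - h); rewrite subKr max_l ?(ltW h0)//; apply.
  by apply: near_half; rewrite ?normrN gtr0_norm.
have /andP[_ j2] : (h / 2 - d) * L <= J (2^-1 - h / 2) <= (h / 2 + d) * L.
  have := J1 (2^-1 - h / 2); rewrite subKr max_l ?(ltW h20)//; apply.
  by apply: near_half; rewrite ?normrN gtr0_norm.
have /andP[_ j3] : (0 - d) * L <= J (2^-1 + h / 2) <= (0 + d) * L.
  have := J1 (2^-1 + h / 2); rewrite opprD addNKr max_r ?oppr_le0 ?(ltW h20)//; apply.
  by apply: near_half; rewrite ?normrN gtr0_norm.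
have /andP[j4 _] : (0 - d) * L <= J (2^-1 + h) <= (0 + d) * L.
  have := J1 (2^-1 + h); rewrite opprD addNKr max_r ?oppr_le0 ?(ltW h0)//; apply.
  by apply: near_half; rewrite ?normrN gtr0_norm.
rewrite mulrC ler_pdivlMr//.
set D := right_derivative J in D1 D2 DD *.
have key : (1 - e) * L <= D (2^-1 + h) - D (2^-1 - h).
  move: D1 D2; rewrite ler_pdivlMr// ler_pdivrMr// => D1 D2.
  rewrite -(ler_pM2r h20) [leRHS]mulrBl.
  have -> : (1 - e) * L * (h / 2) = h / 2 * L - 4 * (d * L) by rewrite /d; field.
  exact: slope_gap j1 j2 j3 j4 D1 D2.
(* Passing from [L] to the smaller [LM] needs a nonnegative factor [1 - e]; for [e > 1]
   nonnegativity of the mass is enough. *)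
have [e1|e1] := leP e 1.
  by apply: le_trans key; rewrite ler_wpM2l// subr_ge0.
apply: (@le_trans _ _ 0); last by rewrite subr_ge0.
by rewrite nmulr_rle0 ?ltW// subr_lt0.
Unshelve. all: by end_near. Qed.

End CharacterMeasures.

Theorem theorem2p5 (R : realType) (q : nat) (q_gt0 : (0 < q)%N)
    (chi : nat -> R[i]) (chi_char : dirichlet_character q chi) :
  locally_uniform_cvg
    (fun N sigma => jessen_char chi N sigma / ln N%:R)
    (fun sigma => Num.max (2^-1 - sigma) 0) /\
  (forall N : nat, (1 < max_coprime q N)%N ->
     jessen_char_measure q chi N [set: R] = 1%E) /\
  weak_cvg (jessen_char_measure q chi) (dirac ((2^-1 : R) : measurableTypeR R)).
Proof.
have posN N : (1 < max_coprime q N)%N -> (0 < N)%N.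
  by case: N => //; rewrite /max_coprime big_nil.
have mass N : (1 < max_coprime q N)%N -> jessen_char_measure q chi N [set: R] = 1%E.
  by move=> M1; exact: (jessen_char_measure_setT q_gt0 chi_char (posN _ M1)).
split; first exact: (jessen_char_locally_uniform q_gt0 chi_char).
split=> //; apply: weak_cvg_dirac.
  by apply: filterS (max_coprime_gt1 q_gt0) => N; exact: mass.
by move=> h e h0 e0; exact: (jessen_char_measure_concentrates q_gt0 chi_char).
Qed.
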